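(* Let $q\ge2$, $c>0$, $\delta>0$, $f\in L^2(Q_T)$, $u_0\in H_0^1(\Omega)$, $v_0\in L^2(\Omega)$. There exists a constant $C_{\mathrm{CFL}}>0$ depending only on $p$, $q$ (and on the dimension $d$ and the shape-regularity constant of $\mathcal T_h$) such that, if $\tau\le C_{\mathrm{CFL}}h_{\min}/c$, then any $u_{h\tau}\in\mathring{\mathcal V}_{h\tau}^{\mathsf{disc}(q)}$ satisfying $\mathcal B_{h\tau}(u_{h\tau},w_{h\tau})=\ell(w_{h\tau})$ for all $w_{h\tau}\in\mathring{\mathcal V}_{h\tau}^{\mathsf{disc}(q)}$ satisfies $$\|\partial_\tau u_{h\tau}\|_{L^\infty(0,T;L^2(\Omega))}^2+c^2\|\nabla u_{h\tau}\|_{L^\infty(0,T;L^2(\Omega)^d)}^2+|\partial_\tau u_{h\tau}|_{\mathsf J}^2+c^2|\nabla u_{h\tau}|_{\mathsf J}^2+\delta\|\partial_\tau u_{h\tau}\|_{L^2(Q_T)}^2$$ $$\le C\Big(\|f\|_{L^1(0,T;L^2(\Omega))}^2+\|v_0\|_{L^2(\Omega)}^2+c^2\|\nabla u_0\|_{L^2(\Omega)^d}^2\Big),$$ where $C>0$ depends only on $q$.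
   Context: Setting: $\Omega\subset\mathbb R^d$ ($d\in\{1,2,3\}$) is a polytopic domain, $T>0$, $Q_T=\Omega\times(0,T)$. $\mathcal T_h$ is a shape-regular conforming simplicial mesh of $\Omega$ with meshsize $h$ and minimum element diameter $h_{\min}$. $0=t_0<t_1<\dots<t_N=T$ is an arbitrary partition, $I_n=(t_{n-1},t_n)$, $\tau_n=t_n-t_{n-1}$, $\tau=\max_n\tau_n$, $Q_n=\Omega\times I_n$. $(\cdot,\cdot)_D$ is the $L^2(D)$ inner product. $p\ge1$ is an integer. Spaces: $\mathring{\mathcal V}_h^p=\{v_h\in H_0^1(\Omega): v_h|_K\in\mathbb P^p(K)\ \forall K\in\mathcal T_h\}$; $\mathring{\mathcal V}_{h\tau}^{\mathsf{disc}(q)}$ is the space of functions whose restriction to each $Q_n$ lies in $\mathbb P^q(I_n)\otimes\mathring{\mathcal V}_h^p$ (no continuity in time across the $t_n$). $\partial_\tau$ is the broken first time derivative. Jumps: $[\![v]\!]_n=v(t_n^+)-v(t_n^-)$ for $n=1,\dots,N-1$; values at $t=0,T$ are one-sided traces from inside $(0,T)$. $|v|_{\mathsf J}^2=\|v(\cdot,T)\|_{L^2(\Omega)}^2+\sum_{n=1}^{N-1}\|[\![v]\!]_n\|_{L^2(\Omega)}^2+\|v(\cdot,0)\|_{L^2(\Omega)}^2$ (with $L^2(\Omega)^d$ norms for vector-valued $v$). Forms (DG time discretization of the damped wave equation $\partial_{tt}u+\delta\partial_tu-c^2\Delta u=f$): $$\mathcal B_{h\tau}(u,w)=\sum_{n=1}^N(\partial_{tt}u,\partial_tw)_{Q_n}+\sum_{n=1}^{N-1}([\![\partial_tu]\!]_n,\partial_tw(\cdot,t_n^+))_\Omega+(\partial_tu(\cdot,0),\partial_tw(\cdot,0))_\Omega+\delta\sum_{n=1}^N(\partial_tu,\partial_tw)_{Q_n}$$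 $$\qquad+c^2\sum_{n=1}^N(\nabla u,\nabla\partial_tw)_{Q_n}+c^2\sum_{n=1}^{N-1}([\![\nabla u]\!]_n,\nabla w(\cdot,t_n^+))_\Omega+c^2(\nabla u(\cdot,0),\nabla w(\cdot,0))_\Omega,$$ $$\ell(w)=\sum_{n=1}^N(f,\partial_tw)_{Q_n}+(v_0,\partial_tw(\cdot,0))_\Omega+c^2(\nabla u_0,\nabla w(\cdot,0))_\Omega.$$ *)

(* Defs.v *)
From HB Require Import structures.
From mathcomp Require Import all_boot all_order all_algebra.
From mathcomp Require Import all_classical all_reals all_analysis.

Set Implicit Arguments.
Unset Strict Implicit.
Unset Printing Implicit Defensive.

Import Order.TTheory GRing.Theory Num.Theory.
Import numFieldNormedType.Exports.

Local Open Scope classical_set_scope.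
Local Open Scope ring_scope.

(** * Lebesgue measure on R^n *)

Fact measure_row_display : measure_display.
Proof. exact: default_measure_display. Qed.

(* 'rV[R]_n carries the sigma-algebra generated by the coordinates, that is,
   the Borel sigma-algebra. *)
Section measurable_row.
Context {R : realType}.
Variable n : nat.

Definition row_coor (i : 'I_n) (x : 'rV[R]_n) : R := x ord0 i.

Let row_set0 : g_sigma_preimage row_coor set0.
Proof. exact: sigma_algebra0. Qed.

Let row_setC A : g_sigma_preimage row_coor A -> g_sigma_preimage row_coor (~` A).
Proof. exact: sigma_algebraC. Qed.

Let row_bigcup (F : (set 'rV[R]_n)^nat) :
  (forall i, g_sigma_preimage row_coor (F i)) ->
  g_sigma_preimage row_coor (\bigcup_i (F i)).
Proof. exact: sigma_algebra_bigcup. Qed.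

HB.instance Definition _ := @isMeasurable.Build measure_row_display
  'rV[R]_n (g_sigma_preimage row_coor) row_set0 row_setC row_bigcup.

End measurable_row.

Section measurable_row_lemmas.
Context {R : realType}.

Lemma measurable_row_coor n (i : 'I_n) :
  measurable_fun [set: 'rV[R]_n] (row_coor i).
Proof.
move=> _ Y mY; rewrite setTI; apply: sub_sigma_algebra => /=.
rewrite -bigcup_seq/=; exists i => /=; first by rewrite mem_index_enum.
by exists Y => //; rewrite setTI.
Qed.

Lemma measurable_fun_rowP d (T : measurableType d) n (f : T -> 'rV[R]_n) :
  measurable_fun [set: T] f <->
  forall i, measurable_fun [set: T] (row_coor i \o f).
Proof.
apply: (@iff_trans _ (g_sigma_preimage
    (fun i => row_coor i \o f) `<=` measurable)).
  rewrite g_sigma_preimage_comp; split=> [mf A [/= C preC <-]|prefS].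
    exact: mf.
  by move=> _ A mA; apply: prefS; exists A.
split=> [tnthfS i|mf].
- move=> _ A mA.
  apply: tnthfS; apply: sub_sigma_algebra.
  case: n i => [[] []//|n i] in f *.
  rewrite -bigcup_mkord_ord.
  exists i; first exact: ltn_ord.
  by exists A => //; rewrite inord_val.
- apply: smallest_sub; first exact: sigma_algebra_measurable.
  case: n => [|n] in f mf *; first by rewrite big_ord0.
  rewrite -bigcup_mkord_ord; apply: bigcup_sub => i Ii.
  by move=> A [B mB <-]; exact: mf.
Qed.

Definition row_cons n (z : measurableTypeR R * 'rV[R]_n) : 'rV[R]_n.+1 :=
  row_mx (z.1 : R)%:M z.2.

Definition row_uncons n (x : 'rV[R]_n.+1) : measurableTypeR R * 'rV[R]_n :=
  (x ord0 ord0, @rsubmx _ 1 1 n x).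

Lemma row_consK n : cancel (@row_cons n) (@row_uncons n).
Proof.
case=> a x; rewrite /row_uncons /row_cons /=; congr pair; last by rewrite row_mxKr.
transitivity (row_mx a%:M x ord0 (lshift n ord0)).
  by congr (fun_of_matrix _ _ _); exact: val_inj.
by rewrite row_mxEl mxE eqxx.
Qed.

Lemma measurable_row_cons n : measurable_fun [set: _] (@row_cons n).
Proof.
apply/measurable_fun_rowP => i.
rewrite -(@splitK 1 n i); case: (fintype.split _) => j /=.
  rewrite (_ : _ \o _ = fst); first exact: measurable_fst.
  apply/funext => z /=; apply: (etrans (@row_mxEl _ 1 1 n _ _ _ j)).
  by rewrite (ord1 j) mxE eqxx.
rewrite (_ : _ \o _ = row_coor j \o snd).
  exact: measurableT_comp (measurable_row_coor j) measurable_snd.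
by apply/funext => z /=; exact: (@row_mxEr _ 1 1 n).
Qed.

Lemma measurable_row_uncons n : measurable_fun [set: _] (@row_uncons n).
Proof.
apply: measurable_fun_pair; first exact: measurable_row_coor.
apply/measurable_fun_rowP => i.
rewrite (_ : _ \o _ = row_coor (rshift 1 i)); first exact: measurable_row_coor.
by apply/funext => x /=; rewrite /row_coor mxE.
Qed.

End measurable_row_lemmas.

Section lebesgue_row.
Context {R : realType}.
Local Open Scope ereal_scope.

Section cons.
Variables (n : nat) (m : {sigma_finite_measure set 'rV[R]_n -> \bar R}).

Definition lebesgue_row_cons :=
  pushforward (@lebesgue_measure R \x m) (@row_cons R n).

HB.instance Definition _ := Measure.copy lebesgue_row_cons
  (measure_function_pushforward__canonical__measure_function_Measure
    (@lebesgue_measure R \x m) (@measurable_row_cons R n)).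

Let lebesgue_row_cons_sigma_finite : sigma_finite setT lebesgue_row_cons.
Proof.
have /sigma_finiteP[F [TF ndF Foo]] := sigma_finiteT (@lebesgue_measure R).
have /sigma_finiteP[G [TG ndG Goo]] := sigma_finiteT m.
exists (fun k => @row_uncons R n @^-1` (F k `*` G k)).
  rewrite -preimage_bigcup (_ : \bigcup_k _ = setT) ?preimage_setT//.
  rewrite -subTset => -[x y] _.
  have [i _ Fx] : (\bigcup_i F i) x by rewrite -TF.
  have [j _ Gy] : (\bigcup_j G j) y by rewrite -TG.
  exists (maxn i j) => //; split.
    by move: x Fx; exact/subsetPset/ndF/leq_maxl.
  by move: y Gy; exact/subsetPset/ndG/leq_maxr.
move=> k; have [mF Fk] := Foo k; have [mG Gk] := Goo k; split.
  rewrite -[X in measurable X]setTI; apply: measurable_row_uncons => //.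
  exact: measurableX.
rewrite /lebesgue_row_cons /pushforward.
rewrite (_ : _ @^-1` _ = F k `*` G k).
  by rewrite product_measure1E// lte_mul_pinfty// ge0_fin_numE.
by apply/seteqP; split=> z; rewrite /preimage /mkset row_consK.
Qed.

HB.instance Definition _ := Measure_isSigmaFinite.Build _ _ _
  lebesgue_row_cons lebesgue_row_cons_sigma_finite.

End cons.

(* On the one-point space R^0 Lebesgue measure is the unit mass. *)
Fixpoint lebesgue_row (n : nat) : {sigma_finite_measure set 'rV[R]_n -> \bar R} :=
  if n is n'.+1 then lebesgue_row_cons (lebesgue_row n')
  else dirac (0%R : 'rV[R]_0).

End lebesgue_row.

(** * Simplices and meshes *)

Section mesh.
Context {R : realType} {d : nat}.
Implicit Types (x y : 'rV[R]_d) (A : set 'rV[R]_d) (V W : 'I_d.+1 -> 'rV[R]_d).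

Definition dotv x y : R := \sum_(i < d) x ord0 i * y ord0 i.

(* The library norm on 'rV[R]_d is the sup norm. *)
Definition eucl x : R := Num.sqrt (dotv x x).

Definition diam A : R := sup [set eucl (z.1 - z.2) | z in A `*` A].

(* Diameter of the largest ball contained in A. *)
Definition indiam A : R := sup [set 2 * r | r in
  [set r | 0 <= r /\ exists x, [set y | eucl (y - x) <= r] `<=` A]].

Definition convex_hull A : set 'rV[R]_d :=
  [set x | exists n (a : 'I_n -> R) (y : 'I_n -> 'rV[R]_d),
    [/\ forall i, 0 <= a i, \sum_i a i = 1, forall i, A (y i)
      & x = \sum_i a i *: y i]].

Definition simplex V : set 'rV[R]_d := convex_hull (range V).

Definition affinely_independent V :=
  row_free (\matrix_(i < d) (V (lift ord0 i) - V ord0)).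

Definition polytopic_domain (Omega : set 'rV[R]_d) :=
  [/\ Omega !=set0, connected Omega
    & exists m (V : 'I_m -> 'I_d.+1 -> 'rV[R]_d),
        (forall k, affinely_independent (V k)) /\
        Omega = interior (\bigcup_(k in [set: 'I_m]) simplex (V k))].

(* A mesh is given by the vertices of its m elements. *)
Definition conforming_mesh (Omega : set 'rV[R]_d) m
    (V : 'I_m -> 'I_d.+1 -> 'rV[R]_d) :=
  [/\ forall k, affinely_independent (V k),
      closure Omega = \bigcup_(k in [set: 'I_m]) simplex (V k)
    & forall k l, k != l -> simplex (V k) <> simplex (V l) /\
        simplex (V k) `&` simplex (V l)
        = convex_hull (range (V k) `&` range (V l))].

Definition shape_regular (kappa : R) m (V : 'I_m -> 'I_d.+1 -> 'rV[R]_d) :=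
  forall k, diam (simplex (V k)) <= kappa * indiam (simplex (V k)).

Definition hmin m (V : 'I_m -> 'I_d.+1 -> 'rV[R]_d) : R :=
  inf [set diam (simplex (V k)) | k in [set: 'I_m]].

(* v coincides on A with a polynomial of total degree at most p. *)
Definition poly_on (p : nat) A (v : 'rV[R]_d -> R) :=
  exists a : {ffun 'I_d -> 'I_p.+1} -> R, forall x, A x ->
    v x = \sum_(e : {ffun 'I_d -> 'I_p.+1} | (\sum_(i < d) e i <= p)%N)
            a e * \prod_(i < d) x ord0 i ^+ e i.

End mesh.

(** * L2 and H^1_0 *)

Section L2.
Context {dT : measure_display} {T : measurableType dT} {R : realType}.
Variables (mu : {measure set T -> \bar R}) (D : set T).

Definition l2norm (f : T -> R) : \bar R := ('N[mu]_2%:E[EFin \o (f \_ D)])%E.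

Definition L2 (f : T -> R) := measurable_fun D f /\ (l2norm f < +oo)%E.

Definition L2v n (g : T -> 'rV[R]_n) := forall i, L2 (fun x => g x ord0 i).

Definition ip (f g : T -> R) : R := \int[mu]_(x in D) (f x * g x).

Definition ipv n (f g : T -> 'rV[R]_n) : R :=
  \int[mu]_(x in D) dotv (f x) (g x).

End L2.

Section H01.
Context {R : realType} {d : nat}.
Variable Omega : set 'rV[R]_d.
Local Notation leb := (@lebesgue_row R d).

Definition partial (i : 'I_d) (f : 'rV[R]_d -> R) : 'rV[R]_d -> R :=
  fun x => 'D_(delta_mx ord0 i) f x.

Definition gradient (f : 'rV[R]_d -> R) : 'rV[R]_d -> 'rV[R]_d :=
  fun x => \row_i partial i f x.

Definition smooth (f : 'rV[R]_d -> R) :=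
  forall (s : seq 'I_d) x, differentiable (foldr partial f s) x.

Definition test_function (f : 'rV[R]_d -> R) :=
  [/\ smooth f, compact (closure [set x | f x != 0])
    & closure [set x | f x != 0] `<=` Omega].

Definition weak_gradient (v : 'rV[R]_d -> R) (g : 'rV[R]_d -> 'rV[R]_d) :=
  forall phi, test_function phi -> forall i,
    ip leb Omega v (partial i phi) = - ip leb Omega (fun x => g x ord0 i) phi.

(* v is in H^1(Omega) with gradient g, which is determined almost everywhere *)
Definition H1 v g :=
  [/\ L2 leb Omega v, L2v leb Omega g & weak_gradient v g].

(* H^1_0 is the closure of the test functions in H^1. *)
Definition H01 v g := H1 v g /\
  exists phi : nat -> 'rV[R]_d -> R,
    [/\ forall k, test_function (phi k),
        l2norm leb Omega (fun x => phi k x - v x) @[k --> \oo] --> 0%E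
      & l2norm leb Omega (fun x => eucl (gradient (phi k) x - g x))
          @[k --> \oo] --> 0%E].

End H01.

(** * Space-time discretization *)

Section time.
Context {R : realType} {X : Type} {E : normedModType R}.
Implicit Types v : X -> R -> E.

Definition dt v : X -> R -> E := fun x s => derive1 (v x) s.

Definition trace_right v (s : R) : X -> E := fun x => lim (v x r @[r --> s^'+]).

Definition trace_left v (s : R) : X -> E := fun x => lim (v x r @[r --> s^'-]).

Definition jump v (s : R) : X -> E :=
  fun x => trace_right v s x - trace_left v s x.

End time.

Section discretization.
Context {R : realType} {d : nat}.
Variables (Omega : set 'rV[R]_d) (T : R).
Local Notation leb := (@lebesgue_row R d).

Definition leb_xt : {measure set ('rV[R]_d * measurableTypeR R) -> \bar R} :=
  (leb \x @lebesgue_measure R)%E.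

(* A function of (x, t) as a function on the product measurable space. *)
Definition xt {E : Type} (v : 'rV[R]_d -> R -> E)
    (z : 'rV[R]_d * measurableTypeR R) : E := v z.1 z.2.

Definition QT : set ('rV[R]_d * measurableTypeR R) := Omega `*` `]0, T[.

(* Norm of L^r(0,T; L^2(Omega)) *)
Definition LrL2norm (r : \bar R) (v : 'rV[R]_d -> R -> R) : \bar R :=
  ('N[@lebesgue_measure R]_r[(fun s => l2norm leb Omega (v ^~ s)) \_ `]0%R, T[])%E.

Definition time_partition (N : nat) (t : nat -> R) :=
  [/\ (0 < N)%N, t 0%N = 0, t N = T & forall n, (n < N)%N -> t n < t n.+1].

Definition tau (N : nat) (t : nat -> R) : R :=
  \big[Num.max/0]_(n < N) (t n.+1 - t n).

Variables (N : nat) (t : nat -> R).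

(* |v|_J^2, where nrm is the absolute value or the Euclidean norm on E *)
Definition jumpnorm2 (E : normedModType R) (nrm : E -> R)
    (v : 'rV[R]_d -> R -> E) : \bar R :=
  (l2norm leb Omega (nrm \o trace_left v T) ^+ 2
   + \sum_(1 <= n < N) l2norm leb Omega (nrm \o jump v (t n)) ^+ 2
   + l2norm leb Omega (nrm \o trace_right v 0%R) ^+ 2)%E.

(* v is in the space of continuous piecewise polynomials vanishing on the
   boundary, and g is its gradient. *)
Definition Vh (p : nat) m (V : 'I_m -> 'I_d.+1 -> 'rV[R]_d)
    (v : 'rV[R]_d -> R) (g : 'rV[R]_d -> 'rV[R]_d) :=
  H01 Omega v g /\ forall k, poly_on p (simplex (V k)) v.

(* On each slab, u is in P^q(I_n) (x) V_h, and Du is its spatial gradient; Du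
   is carried along as it is a weak gradient, given up to a null set. *)
Definition Vdisc (p q : nat) m (V : 'I_m -> 'I_d.+1 -> 'rV[R]_d)
    (u : 'rV[R]_d -> R -> R) (Du : 'rV[R]_d -> R -> 'rV[R]_d) :=
  forall n, (n < N)%N ->
  exists (v : 'I_q.+1 -> 'rV[R]_d -> R) (g : 'I_q.+1 -> 'rV[R]_d -> 'rV[R]_d),
    (forall k, Vh p V (v k) (g k)) /\
    forall x s, Omega x -> t n < s < t n.+1 ->
      u x s = \sum_(k < q.+1) s ^+ k * v k x /\
      Du x s = \sum_(k < q.+1) s ^+ k *: g k x.

Definition slab (n : nat) : set ('rV[R]_d * measurableTypeR R) :=
  Omega `*` `]t n, t n.+1[.

Local Notation "( u , w )_Omega" := (ip leb Omega u w).
Local Notation "( u , w )_Omega^d" := (ipv leb Omega u w).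
Local Notation "( u , w )_Q[ n ]" := (ip leb_xt (slab n) (xt u) (xt w)).
Local Notation "( u , w )_Q[ n ]^d" := (ipv leb_xt (slab n) (xt u) (xt w)).

(* The gradient and the time derivative commute on Vdisc, so that the gradient
   of dt w is dt Dw. *)
Definition Bform (c delta : R) (u : 'rV[R]_d -> R -> R)
    (Du : 'rV[R]_d -> R -> 'rV[R]_d) (w : 'rV[R]_d -> R -> R)
    (Dw : 'rV[R]_d -> R -> 'rV[R]_d) : R :=
  \sum_(n < N) (dt (dt u), dt w)_Q[n]
  + \sum_(1 <= n < N) (jump (dt u) (t n), trace_right (dt w) (t n))_Omega
  + (trace_right (dt u) 0, trace_right (dt w) 0)_Omega
  + delta * \sum_(n < N) (dt u, dt w)_Q[n]
  + c ^+ 2 * \sum_(n < N) (Du, dt Dw)_Q[n]^d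
  + c ^+ 2 * \sum_(1 <= n < N) (jump Du (t n), trace_right Dw (t n))_Omega^d
  + c ^+ 2 * (trace_right Du 0, trace_right Dw 0)_Omega^d.

Definition lform (c : R) (f : 'rV[R]_d -> R -> R) (Du0 : 'rV[R]_d -> 'rV[R]_d)
    (v0 : 'rV[R]_d -> R) (w : 'rV[R]_d -> R -> R)
    (Dw : 'rV[R]_d -> R -> 'rV[R]_d) : R :=
  \sum_(n < N) (f, dt w)_Q[n] + (v0, trace_right (dt w) 0)_Omega
  + c ^+ 2 * (Du0, trace_right Dw 0)_Omega^d.

End discretization.

(* Main.v *)
(* On a slab, test with the function w such that, at every point x, the
   polynomial w(x, .) satisfies
     w' = M u' + Pi(lambda u')  and  w = (M + 1) u at the left end,
   where lambda decreases affinely from 1 to 0 on the slab and Pi is the L2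
   projection onto polynomials of degree < q in time.  The kinetic term does not
   see Pi, the potential term only gains a nonnegative contribution from it, and
   the error in the jump term is absorbed by the jump if M is large.  This
   bounds the mean over the slab of |u'|^2 + c^2 |grad u|^2, hence, by an inverse
   inequality for polynomials in time, its supremum, by the energy at the left
   end and the load.  Testing with u itself on each slab bounds those energies
   and the jumps; on the first slab the initial data take the place of the trace
   from the left.  All coercivity estimates hold pointwise in x, so that they are
   inequalities between real polynomials. *)

(* Testing with u controls traces at the nodes only, whereas a load in L1(0,T) acts against the
   supremum of u' inside the slabs; this gap forces the second test function. The weight lambda
   would fill it, because its slope turns half the derivative of |u'|^2 into the mean of |u'|^2, but
   lambda u' has one degree too many to be the derivative of an element of the space. Truncating by
   Pi costs a multiple of the Legendre polynomial of degree q: being orthogonal to u' and u'', it is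
   felt only by u itself and by the value at the left end. The factor M + 1 at the left end is the
   value there of the weight M + lambda, and it completes the square in the jump of the gradient
   just as in the jump of u'. The test function comes from a linear map W on polynomials in time,
   which commutes with the spatial gradient, so one map serves u and every component of its
   gradient. The inequalities are homogeneous under affine changes of time, hence their constants
   are those of the unit interval and depend on q alone. Over the slabs no Gronwall argument is
   needed: the loads are summed against the largest slab mean, and a quadratic inequality for that
   maximum remains. *)
Require Import Defs.
From HB Require Import structures.
From mathcomp Require Import all_boot all_order all_algebra.
From mathcomp Require Import all_classical all_reals all_analysis.
From mathcomp Require Import measurable_realfun ess_sup_inf polyrcf ring lra.
Set Implicit Arguments.
Unset Strict Implicit.
Unset Printing Implicit Defensive.
Import Order.TTheory GRing.Theory Num.Theory.
Import numFieldNormedType.Exports.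
Local Open Scope classical_set_scope.
Local Open Scope ring_scope.

(** * Polynomials in time *)
Section poly_integral.
Context {R : rcfType}.
Implicit Types (a b c s : R) (p r : {poly R}).

(* The coefficient of degree 0 is 0 because [0^-1 = 0]. *)
Definition primitive p : {poly R} := \poly_(i < (size p).+1) (p`_i.-1 / i%:R).

Lemma coef_primitive p i : (primitive p)`_i = p`_i.-1 / i%:R.
Proof.
rewrite coef_poly; case: ltnP => // h; rewrite nth_default ?mul0r//.
by case: i h => // i h; exact: ltnW.
Qed.

Lemma primitive_is_linear : linear primitive.
Proof.
by move=> a p r; apply/polyP => i; rewrite !(coef_primitive, coefD, coefZ) mulrDl mulrA.
Qed.

HB.instance Definition _ :=
  GRing.isLinear.Build R {poly R} {poly R} _ primitive primitive_is_linear.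

Lemma deriv_primitive p : (primitive p)^`() = p.
Proof.
apply/polyP => i; rewrite coef_deriv coef_primitive -[LHS]mulr_natr divfK ?pnatr_eq0//.
Qed.

Lemma primitive_deriv p : primitive p^`() = p - (p`_0)%:P.
Proof.
apply/polyP => -[|i]; rewrite coef_primitive coefB coefC/=.
  by rewrite invr0 mulr0 subrr.
by rewrite coef_deriv subr0 -(mulr_natr p`_i.+1) mulfK// pnatr_eq0.
Qed.

(** The integral over [a, b] by pure algebra, meaningful over any real closed field;
    [integral_horner] identifies it with the Lebesgue integral. *)
Definition pint a b p := (primitive p).[b] - (primitive p).[a].

Lemma pint_is_scalar a b : scalar (pint a b).
Proof.
move=> c p r; rewrite /pint linearP/= !hornerD !hornerZ mulrBr opprD.
exact: addrACA.
Qed.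

HB.instance Definition _ a b :=
  GRing.isLinear.Build R {poly R} R _ (pint a b) (pint_is_scalar a b).

Lemma pint_deriv a b p : pint a b p^`() = p.[b] - p.[a].
Proof. by rewrite /pint primitive_deriv !hornerE; ring. Qed.

(** The mean value theorem for the primitive takes the place of monotonicity of the integral: the
    sign of an integral is read off at one interior point. *)
Lemma pint_mean a b p : a < b ->
  exists2 c, a < c < b & pint a b p = p.[c] * (b - a).
Proof.
move=> ab; have [c cab e] := poly_mvt (primitive p) ab.
by exists c; [move: cab; rewrite in_itv|rewrite /pint e deriv_primitive].
Qed.

Lemma pint_ge0 a b p : a < b -> (forall s, a <= s <= b -> 0 <= p.[s]) ->
  0 <= pint a b p.
Proof.
move=> ab p0; have [c /andP[ac cb] ->] := pint_mean p ab.
by rewrite mulr_ge0 ?subr_ge0 ?(ltW ab)// p0// !ltW.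
Qed.

Lemma pint_sqr_ge0 a b p : a < b -> 0 <= pint a b (p * p).
Proof. by move=> ab; apply: pint_ge0 => // s _; rewrite hornerM -expr2 sqr_ge0. Qed.

Lemma pint_half_sqr a b p : pint a b (p^`() * p) = 2^-1 * (p.[b] ^+ 2 - p.[a] ^+ 2).
Proof.
have /(congr1 (pint a b)) : p^`() * p + p^`() * p = (p * p)^`().
  by rewrite derivM [p * _]mulrC.
by rewrite linearD/= pint_deriv !hornerM -!expr2 => h; lra.
Qed.

Definition rescale a b : {poly R} := a%:P + (b - a) *: 'X.

Lemma horner_rescale a b s : (rescale a b).[s] = a + (b - a) * s.
Proof. by rewrite !hornerE. Qed.

Lemma deriv_rescale a b p : (p \Po rescale a b)^`() = (b - a) *: (p^`() \Po rescale a b).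
Proof.
rewrite deriv_comp derivD derivC add0r derivZ derivX.
by rewrite -mulrC -scalerAl mul1r.
Qed.

Lemma pint_rescale a b p : pint a b p = (b - a) * pint 0 1 (p \Po rescale a b).
Proof.
rewrite -[in RHS](deriv_primitive p).
transitivity (pint 0 1 ((b - a) *: ((primitive p)^`() \Po rescale a b))); last by rewrite linearZ.
rewrite -deriv_rescale pint_deriv !horner_comp !horner_rescale.
by rewrite /pint mulr0 addr0 mulr1 subrKC.
Qed.

End poly_integral.

(** * Legendre polynomials on [0, 1] and inverse inequalities *)

Section legendre.
Context {R : rcfType}.
Implicit Types (p r : {poly R}).
Local Notation I := (pint (0 : R) 1).

Let om : {poly R} := 'X * (1 - 'X).

Let om_root k : (om ^+ k.+1).[0] = 0 /\ (om ^+ k.+1).[1] = 0.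
Proof. by rewrite exprS !hornerE !(mul0r, subrr, mulr0). Qed.

(** Each derivative costs at most one factor [om], so for k < n the derivative still vanishes at 0
    and 1, and integrations by parts leave no boundary term. *)
Let derivn_om n k : (k <= n)%N -> exists h, (om ^+ n)^`(k) = om ^+ (n - k) * h.
Proof.
elim: k => [|k IH] kn; first by exists 1; rewrite subn0 mulr1.
have [h e] := IH (ltnW kn).
rewrite derivnS e; have -> : (n - k = (n - k.+1).+1)%N by rewrite subnSK.
set m := (n - k.+1)%N; exists (om^`() *+ m.+1 * h + om * h^`()).
rewrite derivM deriv_exp /= mulrDr exprSr -!mulrA; congr (_ + _).
by rewrite mulrA mulrnAr [om ^+ m * _]mulrC.
Qed.

Let pint_derivn_om n k r : (k <= n)%N ->
  I ((om ^+ n)^`(k) * r) = (-1) ^+ k * I (om ^+ n * r^`(k)).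
Proof.
elim: k r => [|k IH] r kn; first by rewrite expr0 mul1r !derivn0.
have [h e] := derivn_om (ltnW kn).
have -> : (om ^+ n)^`(k.+1) * r = ((om ^+ n)^`(k) * r)^`() - (om ^+ n)^`(k) * r^`().
  by rewrite derivM derivnS; ring.
rewrite linearB/= pint_deriv IH ?(ltnW kn)// -derivSn e !hornerM.
have -> : (n - k = (n - k.+1).+1)%N by rewrite subnSK.
by have [-> ->] := om_root (n - k.+1); rewrite !mul0r subrr sub0r exprS mulN1r mulNr.
Qed.

(* Rodrigues' formula: the polynomial is the n-th derivative of (x(1-x))^n. *)
Lemma legendre_exists n : exists l : {poly R},
  [/\ size l = n.+1, l`_n = 1,
      forall r, (size r <= n)%N -> I (l * r) = 0 & 0 < I (l * l)].
Proof.
pose l0 := (om ^+ n)^`(n).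
have som : size om = 3%N /\ lead_coef om = -1.
  have e : om = - ('X * ('X - 1%:P)) by rewrite /om polyC1; ring.
  rewrite e size_polyN lead_coefN lead_coefM lead_coefX lead_coefXsubC mulr1.
  by rewrite size_mul ?polyX_eq0 ?polyXsubC_eq0// size_polyX size_XsubC.
have [so lo] := som.
have so2 : size (om ^+ n) = (n + n).+1.
  have: (size (om ^+ n)).-1 = ((size om).-1 * n)%N by exact: size_exp.
  rewrite so /= mul2n -addnn; have : size (om ^+ n) != 0%N.
    by rewrite size_poly_eq0 expf_neq0// -size_poly_eq0 so.
  by case: (size _) => // m _ /= ->.
have l0n : l0`_n != 0.
  rewrite coef_derivn -mulr_natr mulf_neq0//; last first.
    by rewrite pnatr_eq0 -lt0n ffact_gt0 leq_addr.
  have := lead_coef_exp om n; rewrite lead_coefE so2 /= lo => ->.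
  by rewrite expf_neq0// oppr_eq0 oner_eq0.
have sl0 : (size l0 <= n.+1)%N.
  by apply/leq_sizeP => j nj; rewrite coef_derivn nth_default ?mul0rn// so2 -addnS leq_add2l.
(* Monic rather than of unit norm: subtracting the leading coefficient times [l] then lowers the
   degree. *)
pose l := (l0`_n)^-1 *: l0.
have ln : l`_n = 1 by rewrite coefZ mulVf.
have orth r : (size r <= n)%N -> I (l * r) = 0.
  move=> sr; rewrite /l -scalerAl linearZ/= /l0 pint_derivn_om// (_ : r^`(n) = 0) ?mulr0 ?linear0 ?mulr0//.
  apply/polyP => j; rewrite coef_derivn coef0 nth_default ?mul0rn//.
  exact: leq_trans sr (leq_addr _ _).
have sl : size l = n.+1.
  apply/eqP; rewrite eqn_leq (leq_trans (size_scale_leq _ _))//=.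
  by rewrite ltnNge; apply/negP => /leq_sizeP/(_ n (leqnn _))/eqP; rewrite ln oner_eq0.
exists l; split => //.
(* As [l] is monic, it differs from the monomial by a polynomial of lower degree, to which it is
   orthogonal. *)
have e : I (l * l) = I (l * 'X^n).
  apply/eqP; rewrite -subr_eq0 -linearB/= -mulrBr; apply/eqP/orth.
  apply/leq_sizeP => j; rewrite leq_eqVlt => /predU1P[<-|nj].
    by rewrite coefB ln coefXn eqxx subrr.
  by rewrite coefB coefXn gtn_eqF// subr0 nth_default// sl.
(* Integrating by parts n times leaves, up to a nonzero factor, n! times the integral of [om ^+ n],
   and [om] has no zero inside the interval. *)
have : I (l * l) != 0.
  rewrite e /l -scalerAl linearZ/= mulf_neq0 ?invr_eq0// /l0 pint_derivn_om//.
  rewrite mulf_neq0 ?expf_neq0 ?oppr_eq0 ?oner_eq0//.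
  rewrite (_ : 'X^n^`(n) = (n`!)%:R%:P); last first.
    apply/polyP => j; rewrite coef_derivn coefXn coefC addnC -{2}[n]add0n eqn_add2r.
    by case: eqP => [->|_]; rewrite ?mul0rn// ?add0n ?addn0 ffactnn.
  rewrite mulrC mul_polyC linearZ/= mulf_neq0 ?pnatr_eq0 -?lt0n ?fact_gt0//.
  have [c /andP[c0 c1] ->] := pint_mean (om ^+ n) (@ltr01 R).
  rewrite subr0 mulr1 horner_exp expf_neq0// /om !hornerE mulf_neq0// ?gt_eqF//.
  by rewrite subr_gt0.
by rewrite lt_def => ->/=; exact: pint_sqr_ge0.
Qed.

(** Equivalence of norms in bounded degree, obtained without compactness since the field is only
    real closed. The Legendre component splits off orthogonally, so the integral of the square
    bounds the leading coefficient and the remainder separately. *)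
Lemma coef_inverse_ineq n : exists2 K : R, 0 < K &
  forall p, (size p <= n)%N -> forall i, p`_i ^+ 2 <= K * I (p * p).
Proof.
elim: n => [|n [K K0 IH]].
  exists 1 => // p; rewrite leqn0 size_poly_eq0 => /eqP-> i.
  by rewrite coef0 expr0n/= mul0r linear0 mulr0.
have [l [sl ln orth l0]] := legendre_exists n.
pose B := \sum_(i < n.+1) l`_i ^+ 2.
have B0 : 0 <= B by apply: sumr_ge0 => i _; exact: sqr_ge0.
have lB i : l`_i ^+ 2 <= B.
  have [ni|ni] := ltnP i n.+1; last by rewrite nth_default ?sl// expr0n.
  by rewrite /B (bigD1 (Ordinal ni))//= lerDl; apply: sumr_ge0 => *; exact: sqr_ge0.
(* The square of a sum is at most twice the sum of the squares: [K] serves the remainder,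
   [B / I (l * l)] the Legendre component. *)
exists (2 * K + 2 * B / I (l * l)).
  by rewrite ltr_pwDl ?mulr_gt0// divr_ge0 ?mulr_ge0// ltW.
move=> p sp i; pose r := p - p`_n *: l.
have sr : (size r <= n)%N.
  apply/leq_sizeP => j; rewrite leq_eqVlt => /predU1P[<-|nj].
    by rewrite coefB coefZ ln mulr1 subrr.
  have lj : (size l <= j)%N by rewrite sl.
  by rewrite coefB coefZ (nth_default _ (leq_trans sp nj)) (nth_default _ lj) mulr0 subrr.
have pE : p = p`_n *: l + r by rewrite addrC subrK.
have IE : I (p * p) = p`_n ^+ 2 * I (l * l) + I (r * r).
  have -> : p * p = p`_n ^+ 2 *: (l * l) + (2 * p`_n) *: (l * r) + r * r.
    rewrite {1 2}pE -!mul_polyC !rmorphM/= ; ring.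
  by rewrite !linearD/= !linearZ/= (orth _ sr) mulr0 addr0.
have Ir : 0 <= I (r * r) by exact: pint_sqr_ge0.
have pn : p`_n ^+ 2 <= I (p * p) / I (l * l) by rewrite ler_pdivlMr// IE lerDl.
have ri : r`_i ^+ 2 <= K * I (p * p).
  apply: (le_trans (IH _ sr i)); rewrite ler_pM2l// IE lerDr mulr_ge0 ?sqr_ge0// ltW//.
have pi : p`_i ^+ 2 <= 2 * (p`_n ^+ 2 * l`_i ^+ 2) + 2 * r`_i ^+ 2.
  have -> : p`_i = p`_n * l`_i + r`_i by rewrite {1}pE coefD coefZ.
  by rewrite -exprMn; set x := _ * _; set y := r`_i; have := sqr_ge0 (x - y); nra.
apply: (le_trans pi); rewrite [leRHS]mulrDl [leLHS]addrC; apply: lerD.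
  by rewrite -mulrA ler_pM2l.
have -> : 2 * B / I (l * l) * I (p * p) = 2 * (I (p * p) / I (l * l) * B) by ring.
by rewrite ler_pM2l// ler_pM ?sqr_ge0.
Qed.

Lemma sup_inverse_ineq n : exists2 K : R, 0 < K &
  forall p, (size p <= n)%N -> forall s, 0 <= s <= 1 -> p.[s] ^+ 2 <= K * I (p * p).
Proof.
have [K K0 HK] := coef_inverse_ineq n.
suff [K' K'0 H] : exists2 K' : R, 0 <= K' &
    forall p, (size p <= n)%N -> forall s, 0 <= s <= 1 -> p.[s] ^+ 2 <= K' * I (p * p).
  (* The constant built below starts at 0 for the empty sum; adding 1 makes it positive. *)
  exists (K' + 1); first exact: ltr_wpDl.
  move=> p sp s s01; apply: (le_trans (H _ sp _ s01)).
  by rewrite ler_wpM2r ?pint_sqr_ge0// lerDl.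
have aux k : exists2 K' : R, 0 <= K' & forall p, (size p <= n)%N ->
    forall s, 0 <= s <= 1 -> (\sum_(i < k) p`_i * s ^+ i) ^+ 2 <= K' * I (p * p).
  elim: k => [|k [K' K'0 IH]].
    by exists 0 => // p _ s _; rewrite big_ord0 expr0n/= mul0r.
  exists (2 * K' + 2 * K); first by rewrite addr_ge0 ?mulr_ge0 ?(ltW K0).
  move=> p sp s s01; rewrite big_ord_recr/=.
  have h1 := IH _ sp _ s01; have h2 := HK _ sp k.
  have h3 : (p`_k * s ^+ k) ^+ 2 <= p`_k ^+ 2.
    move: s01 => /andP[s0 s1].
    by rewrite exprMn ler_piMr ?sqr_ge0// -exprM exprn_ile1.
  move: h1 h2 h3; set x := \sum_(i < k) _; set y := p`_k * _; set z := I _; set w := p`_k ^+ 2.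
  by have := sqr_ge0 (x - y); nra.
have [K' K'0 H] := aux n; exists K' => // p sp s s01.
by rewrite (horner_coef_wide _ sp); exact: H.
Qed.

End legendre.

(** * The test function on one slab, pointwise in space *)

Section slab_test_function.
Context {R : rcfType}.
Implicit Types (a b m s : R) (p : {poly R}).
Local Notation I := (pint (0 : R) 1).

(** The clauses follow the terms of the scheme at a point of space: kinetic term with its jump,
    damping, potential term with its jump, and inverse inequalities for the supremum in time. The
    number m is the trace from the left, hence arbitrary. Integrals are normalised to means, which
    makes [M] and [K] independent of the length of the slab. *)
Definition slab_test_spec q (M K a b : R) (W : {poly R} -> {poly R}) := linear W /\
  forall p, (size p <= q.+1)%N ->
  [/\ (size (W p) <= q.+1)%N,
      forall m, 4^-1 * ((b - a)^-1 * pint a b (p^`() * p^`())) - (M + 1) / 2 * m ^+ 2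
        <= pint a b (p^`()^`() * (W p)^`()) + (p^`().[a] - m) * (W p)^`().[a],
      0 <= pint a b (p^`() * (W p)^`()),
      forall m, 4^-1 * ((b - a)^-1 * pint a b (p * p)) - (M + 1) / 2 * m ^+ 2
        <= pint a b (p * (W p)^`()) + (p.[a] - m) * (W p).[a]
    & forall s, a <= s <= b ->
      [/\ (W p)^`().[s] ^+ 2 <= K * ((b - a)^-1 * pint a b (p^`() * p^`())),
          p^`().[s] ^+ 2 <= K * ((b - a)^-1 * pint a b (p^`() * p^`()))
        & p.[s] ^+ 2 <= K * ((b - a)^-1 * pint a b (p * p))]].

(* The test function W p is determined by
   (W p)' = M p' + Pi((1 - x) p') and (W p)(0) = (M + 1) p(0), where Pi is the
   L2-projection onto polynomials of degree < q; since the leading coefficient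
   of (1 - x) p' is opposite to that of p', the projection error of the
   potential term has a favourable sign. *)
Lemma reference_test q : (0 < q)%N -> exists M K : R, [/\ 0 <= M, 0 < K &
  exists W : {poly R} -> {poly R}, linear W /\
  forall p, (size p <= q.+1)%N ->
  [/\ (size (W p) <= q.+1)%N,
      forall m, 4^-1 * I (p^`() * p^`()) - (M + 1) / 2 * m ^+ 2
        <= I (p^`()^`() * (W p)^`()) + (p^`().[0] - m) * (W p)^`().[0],
      0 <= I (p^`() * (W p)^`()),
      forall m, 4^-1 * I (p * p) - (M + 1) / 2 * m ^+ 2
        <= I (p * (W p)^`()) + (p.[0] - m) * (W p).[0]
    & forall s, 0 <= s <= 1 ->
      [/\ (W p)^`().[s] ^+ 2 <= K * I (p^`() * p^`()),
          p^`().[s] ^+ 2 <= K * I (p^`() * p^`())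
        & p.[s] ^+ 2 <= K * I (p * p)]]].
Proof.
move=> q0.
have [l [sl lq orth l0]] := @legendre_exists R q.
have [K1 K10 HK1] := @coef_inverse_ineq R q.
have [K2 K20 HK2] := @sup_inverse_ineq R q.+1.
(* Young's inequality for the projection error at the left end costs a quarter of the mean of the
   square of p' and M / 2 times the squared jump; of the latter, (M + 1) / 2 is available. *)
pose M := 2 * (l.[0] ^+ 2 * K1).
have M0 : 0 <= M by rewrite mulr_ge0// mulr_ge0 ?sqr_ge0// ltW.
(* This is Pi((1 - x) p'): the coefficient of degree q in (1 - x) p' is minus the top coefficient of
   p', so adding that multiple of the monic [l] cancels it, and [l] is orthogonal to all lower
   degrees. *)
pose U p := (1 - 'X) * p^`() + p^`()`_q.-1 *: l.
pose W p := M *: p + primitive (U p) + (p.[0])%:P.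
(* The first two summands bound the two parts of (W p)'(s) = (M + 1 - s) p'(s) + k l(s), where k is
   the top coefficient of p'; the 1 gives K2 <= K for the bounds on p' and p. *)
pose K := K2 * (2 * (M + 1) ^+ 2 + 2 * K1 * I (l * l) + 1).
have Kge : K2 <= K.
  have A0 := sqr_ge0 (M + 1).
  have B0 : 0 <= K1 * I (l * l) by rewrite mulr_ge0// ltW.
  by rewrite /K ler_peMr ?(ltW K20)// -[2 * K1 * _]mulrA; lra.
exists M, K; split => //; first exact: lt_le_trans Kge.
have dW p : (W p)^`() = M *: p^`() + U p.
  by rewrite /W 2!derivD derivZ derivC deriv_primitive addr0.
have W0 p : (W p).[0] = (M + 1) * p.[0].
  rewrite /W !hornerE [X in _ + X + _]horner_coef0 coef_primitive invr0 mulr0.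
  by rewrite mulrDl mul1r addr0.
exists W; split.
  move=> k p r; rewrite /W.
  have -> : U (k *: p + r) = k *: U p + U r.
    rewrite /U derivD derivZ coefD coefZ mulrDr -scalerAr scalerDr scalerDl scalerA.
    by rewrite addrACA.
  have -> : primitive (k *: U p + U r) = k *: primitive (U p) + primitive (U r).
    exact: linearP.
  rewrite hornerD hornerZ polyCD polyCM -!mul_polyC.
  by move: (M%:P) (primitive _) (primitive _) (_%:P) (_%:P) => *; ring.
move=> p sp.
have sp' : (size p^`() <= q)%N.
  by apply/leq_sizeP => j qj; rewrite coef_deriv nth_default ?mul0rn// (leq_trans sp).
have sp'' : (size p^`()^`() <= q)%N.
  by apply/leq_sizeP => j qj; rewrite coef_deriv nth_default ?mul0rn// (leq_trans sp')// ltnW.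
have sU : (size (U p) <= q)%N.
  apply/leq_sizeP => j; rewrite leq_eqVlt => /predU1P[<-|qj];
    rewrite /U mulrBl mul1r coefD coefB coefXM coefZ.
    rewrite lq mulr1 gtn_eqF// nth_default// sub0r addNr//.
  have j1 : (size p^`() <= j.-1)%N.
    by rewrite (leq_trans sp')// -ltnS (leq_trans qj)// leqSpred.
  have lj : (size l <= j)%N by rewrite sl.
  rewrite gtn_eqF ?(leq_trans _ qj)// (nth_default _ (leq_trans sp' (ltnW qj))).
  by rewrite (nth_default _ j1) (nth_default _ lj) mulr0 subrr addr0.
(* The weight vanishes at 1, so no term at the right end is left, and its slope -1 produces the mean
   of r^2 that the unweighted test does not give. *)
have weight r : I ((1 - 'X) * (r^`() * r)) = 2^-1 * (I (r * r) - r.[0] ^+ 2).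
  have /(congr1 I) : (1 - 'X) * (r^`() * r) + (1 - 'X) * (r^`() * r) =
      ((1 - 'X) * (r * r))^`() + r * r.
    by rewrite derivM derivM derivB derivX derivC; ring.
  rewrite !linearD/= pint_deriv !hornerM hornerD hornerN hornerX hornerC.
  by rewrite hornerD hornerN hornerX hornerC -!expr2 => h; lra.
have mulU r : I (r * U p) = I ((1 - 'X) * (p^`() * r)) + p^`()`_q.-1 * I (l * r).
  rewrite /U mulrDr linearD/= -scalerAr linearZ/= [r * l]mulrC; congr (pint _ _ _ + _).
  ring.
have U1 : I (p^`()^`() * U p) = 2^-1 * (I (p^`() * p^`()) - p^`().[0] ^+ 2).
  by rewrite mulU orth// mulr0 addr0 [p^`() * _]mulrC weight.
have U2 : I (p^`() * U p) = I ((1 - 'X) * (p^`() * p^`())).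
  by rewrite mulU orth// mulr0 addr0.
(* The projection error does not vanish against p, which has degree q. As the top coefficient of p'
   is q times that of p, the error is q times a square times the integral of [l * l]. *)
have U3 : 2^-1 * (I (p * p) - p.[0] ^+ 2) <= I (p * U p).
  rewrite mulU weight lerDl.
  have -> : I (l * p) = p`_q * I (l * l).
    have sr : (size (p - p`_q *: l)%R <= q)%N.
      apply/leq_sizeP => j; rewrite leq_eqVlt => /predU1P[<-|qj].
        by rewrite coefB coefZ lq mulr1 subrr.
      have lj : (size l <= j)%N by rewrite sl.
      by rewrite coefB coefZ (nth_default _ (leq_trans sp qj)) (nth_default _ lj) mulr0 subrr.
    have := orth _ sr; rewrite mulrBr linearB/= -scalerAr linearZ/= => /eqP.
    by rewrite subr_eq0 => /eqP.
  rewrite coef_deriv prednK// mulrA mulr_ge0 ?(ltW l0)// mulrnAl mulrn_wge0//.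
  by rewrite -expr2 sqr_ge0.
have U0 : (U p).[0] = p^`().[0] + p^`()`_q.-1 * l.[0].
  by rewrite /U !hornerE subr0 mul1r.
have dWI r : I (r * (W p)^`()) = M * I (r * p^`()) + I (r * U p).
  by rewrite dW mulrDr linearD/= -scalerAr linearZ.
have c1 : p^`()`_q.-1 ^+ 2 <= K1 * I (p^`() * p^`()) by exact: HK1.
split.
- rewrite /W (leq_trans (size_polyD _ _))// geq_max (leq_trans (size_polyC_leq1 _)) ?andbT//.
  rewrite (leq_trans (size_polyD _ _))// geq_max (leq_trans (size_scale_leq _ _))//=.
  apply/leq_sizeP => j qj; rewrite coef_primitive nth_default ?mul0r//.
  by rewrite (leq_trans sU)// -ltnS (leq_trans qj)// leqSpred.
- move=> m; rewrite dWI U1 pint_half_sqr dW.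
  rewrite hornerD hornerZ U0.
  have := sqr_ge0 p^`().[1]; move: c1 M0; rewrite /M.
  set z := p^`().[0]; set k := p^`()`_q.-1; set P := I _; set y := p^`().[1] ^+ 2 => c1 M0 y0.
  (* Young's inequality, with the square completed so that the part in k is exactly what
     [coef_inverse_ineq] bounds by a quarter of [P]. *)
  have h : - (4^-1 * P + (z - m) ^+ 2 * (l.[0] ^+ 2 * K1)) <= (z - m) * (k * l.[0]).
    have : 0 <= (k * (2 * K1)^-1 + (z - m) * l.[0]) ^+ 2 by exact: sqr_ge0.
    have -> : (k * (2 * K1)^-1 + (z - m) * l.[0]) ^+ 2 =
      (k ^+ 2 * (4^-1 / K1) + (z - m) * (k * l.[0]) + (z - m) ^+ 2 * (l.[0] ^+ 2 * K1)) / K1.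
      by field; rewrite gt_eqF.
    rewrite pmulr_lge0 ?invr_gt0//.
    have : k ^+ 2 * (4^-1 / K1) <= 4^-1 * P.
      by rewrite mulrA ler_pdivrMr//; nra.
    lra.
  move: M0 h; set N := l.[0] ^+ 2 * K1 => N0 h.
  rewrite -subr_ge0.
  have := sqr_ge0 (z - m). nra.
- rewrite dWI U2 addr_ge0//.
    by rewrite mulr_ge0// pint_sqr_ge0.
  by apply: pint_ge0 => // s /andP[s0 s1]; rewrite !hornerM -expr2 mulr_ge0 ?sqr_ge0// !hornerE subr_ge0.
(* The endpoint terms add up to (M + 1) / 2 times (p(0) - m)^2 - m^2, plus M / 2 times p(1)^2; this
   is why W p starts from (M + 1) p(0). *)
- move=> m; rewrite W0 dWI [p * p^`()]mulrC pint_half_sqr.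
  have := sqr_ge0 p.[1]; have := sqr_ge0 (p.[0] - m); have := pint_sqr_ge0 p (@ltr01 R).
  move: U3; nra.
move=> s s01.
have P0 := pint_sqr_ge0 p (@ltr01 R); have P1 := pint_sqr_ge0 p^`() (@ltr01 R).
have hp : p.[s] ^+ 2 <= K2 * I (p * p) by exact: HK2.
have hp' : p^`().[s] ^+ 2 <= K2 * I (p^`() * p^`()) by exact/HK2/s01/(leq_trans sp').
split; [|exact: le_trans hp' (ler_wpM2r P1 Kge)|exact: le_trans hp (ler_wpM2r P0 Kge)].
have hl : l.[s] ^+ 2 <= K2 * I (l * l) by apply: HK2; rewrite ?sl.
have -> : (W p)^`().[s] = (M + 1 - s) * p^`().[s] + p^`()`_q.-1 * l.[s].
  by rewrite dW /U !hornerD !hornerZ hornerM hornerD hornerN hornerX hornerC; ring.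
move: c1 hl hp' P1; set z := p^`().[s]; set k := p^`()`_q.-1; set P := I (p^`() * _).
set L := I (l * l); set y := l.[s] => c1 hl hp' P1.
have e1 : ((M + 1 - s) * z) ^+ 2 <= (M + 1) ^+ 2 * (K2 * P).
  rewrite exprMn ler_pM ?sqr_ge0// ler_pXn2r ?nnegrE//;
  by move: s01 M0 => /andP[s0 s1]; lra.
have e2 : (k * y) ^+ 2 <= K1 * P * (K2 * L) by rewrite exprMn ler_pM ?sqr_ge0.
have e3 : 0 <= K2 * P by rewrite mulr_ge0// ltW.
rewrite /K -/L.
have -> : K2 * (2 * (M + 1) ^+ 2 + 2 * K1 * L + 1) * P =
  2 * ((M + 1) ^+ 2 * (K2 * P)) + 2 * (K1 * P * (K2 * L)) + K2 * P by ring.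
move: e1 e2 e3; set A := (_ - _) * z; set B := k * y; have := sqr_ge0 (A - B); nra.
Qed.

(** Conjugation of the reference map by the affine map of [0, 1] onto the slab; every clause picks
    up the same power of the slab length on both sides. *)
Lemma slab_test q : (0 < q)%N -> exists M K : R, [/\ 0 <= M, 0 < K &
  forall a b, a < b -> exists W, slab_test_spec q M K a b W].
Proof.
move=> q0; have [M [K [M0 K0 [W [linW HW]]]]] := reference_test q0.
exists M, K; split => // a b ab.
have t0 : 0 < b - a by rewrite subr_gt0.
have tn0 : b - a != 0 by rewrite gt_eqF.
pose sg := rescale a b; pose sg' : {poly R} := (b - a)^-1 *: ('X - a%:P).
have ssg : size sg = 2%N.
  rewrite /sg /rescale addrC size_polyDl size_scale ?size_polyX//.
  by rewrite (leq_ltn_trans (size_polyC_leq1 _)).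
have ssg' : size sg' = 2%N by rewrite size_scale ?invr_eq0// size_XsubC.
have sgK : sg' \Po sg = 'X.
  rewrite /sg' comp_polyZ comp_polyB comp_polyX comp_polyC /sg /rescale addrAC subrr add0r.
  by rewrite scalerA mulVf// scale1r.
exists (fun p => W (p \Po sg) \Po sg'); split.
  by move=> k p r; rewrite comp_polyD comp_polyZ linW comp_polyD comp_polyZ.
move=> p sp; set w := W _ \Po _.
have wsg : w \Po sg = W (p \Po sg) by rewrite /w -comp_polyA sgK comp_polyXr.
have sy : (size (p \Po sg) <= q.+1)%N by rewrite size_comp_poly2.
have [s1 s2 s3 s4 s5] := HW _ sy.
have dy : (p \Po sg)^`() = (b - a) *: (p^`() \Po sg) by exact: deriv_rescale.
have ddy : (p \Po sg)^`()^`() = (b - a) ^+ 2 *: (p^`()^`() \Po sg).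
  by rewrite dy derivZ [(_ \Po sg)^`()]deriv_rescale scalerA.
have dw : (W (p \Po sg))^`() = (b - a) *: (w^`() \Po sg).
  by rewrite -wsg; exact: deriv_rescale.
have sg0 r : (r \Po sg).[0] = r.[a].
  by rewrite horner_comp horner_rescale mulr0 addr0.
have mean r : (b - a)^-1 * pint a b r = I (r \Po sg) by rewrite pint_rescale mulKf.
have pintE r : pint a b r = (b - a) * I (r \Po sg) by exact: pint_rescale.
have IM k1 k2 (r1 r2 : {poly R}) :
    I ((k1 *: (r1 \Po sg)) * (k2 *: (r2 \Po sg))) = k1 * k2 * I ((r1 * r2) \Po sg).
  by rewrite -scalerAl -scalerAr scalerA linearZ/= comp_polyM.
have IMr k2 (r1 r2 : {poly R}) :
    I ((r1 \Po sg) * (k2 *: (r2 \Po sg))) = k2 * I ((r1 * r2) \Po sg).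
  by rewrite -scalerAr linearZ/= comp_polyM.
have t2 : 0 < (b - a) ^+ 2 by rewrite exprn_gt0.
split.
- by rewrite size_comp_poly2.
(* Time derivatives gain a factor [b - a], so the left velocity m must be rescaled as well. In the
   potential clause below, m is a value and stays as it is. *)
- move=> m; move: (s2 ((b - a) * m)); rewrite ddy dw dy !IM !hornerZ !sg0 mean pintE.
  set A := I _; set B := I _; set u := p^`().[a]; set v := w^`().[a] => h.
  rewrite -(ler_pM2l t2); move: h; rewrite [X in X <= _ -> _](_ : _ =
    (b - a) ^+ 2 * (4^-1 * A - (M + 1) / 2 * m ^+ 2)); last by ring.
  by rewrite [X in _ <= X -> _](_ : _ =
    (b - a) ^+ 2 * ((b - a) * B + (u - m) * v)); last by ring.
- move: s3; rewrite dw dy IM pintE; rewrite -expr2 pmulr_rge0// => h.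
  by rewrite mulr_ge0// ltW.
- move=> m; move: (s4 m); rewrite dw IMr sg0 mean pintE -comp_polyM.
  by rewrite -wsg sg0.
move=> s /andP[sa sb].
have s01 : 0 <= (s - a) / (b - a) <= 1.
  by rewrite divr_ge0 ?subr_ge0 ?(ltW ab)//= ler_pdivrMr// mul1r lerD2r.
have sgs r : (r \Po sg).[(s - a) / (b - a)] = r.[s].
  by rewrite horner_comp horner_rescale mulrC divfK// subrKC.
have [] := s5 _ s01.
rewrite dw dy !hornerZ !sgs IM -comp_polyM !mean !exprMn -expr2.
rewrite [K * (_ * _)]mulrCA !(ler_pM2l t2) => h1 h2 h3.
by split.
Qed.

End slab_test_function.

(** * The space L2 *)

Section L2_theory.
Context {dT : measure_display} {T : measurableType dT} {R : realType}.
Variables (mu : {measure set T -> \bar R}) (D : set T).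
Hypothesis mD : measurable D.
Implicit Types f g : T -> R.

Lemma poweR2 (x : \bar R) : (0 <= x -> x `^ 2 = x ^+ 2)%E.
Proof.
case: x => [r|_|//]; last by rewrite poweRyr ?pnatr_eq0 // expe2 mulyy.
by rewrite lee_fin => r0; rewrite poweR_EFin powR_mulrn// -EFin_expe.
Qed.

Lemma l2norm_sqr f : (l2norm mu D f ^+ 2 = \int[mu]_(x in D) (f x ^+ 2)%:E)%E.
Proof.
rewrite -poweR2 ?Lnorm_ge0// poweR_Lnorm// [RHS]integral_mkcond.
apply: eq_integral => x _; rewrite /= powR_mulrn// /patch.
by case: ifPn => _ /=; rewrite real_normK ?num_real// expr0n.
Qed.

Lemma sqr_integrableP f : L2 mu D f <->
  measurable_fun D f /\ mu.-integrable D (EFin \o (fun x => f x ^+ 2)).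
Proof.
have -> : L2 mu D f <-> measurable_fun D f /\ (l2norm mu D f ^+ 2 < +oo)%E.
  split=> -[mf h]; split => //; move: h; have := Lnorm_ge0 mu 2%:E (EFin \o f \_ D).
    by rewrite -/(l2norm mu D f); case: (l2norm mu D f) => // r _ _; rewrite -EFin_expe ltry.
  rewrite -/(l2norm mu D f); case: (l2norm mu D f) => [r|_|//]; last by rewrite expe2 mulyy.
  by move=> _ _; rewrite ltry.
rewrite l2norm_sqr; split=> -[mf h]; split => //.
  apply/integrableP; split; first by apply/measurable_EFinP; exact: measurable_funX.
  rewrite (eq_integral (fun x => (f x ^+ 2)%:E))// => x _ /=.
  by rewrite ger0_norm ?sqr_ge0.
move/integrableP : h => [_]; rewrite (eq_integral (fun x => (f x ^+ 2)%:E))// => x _ /=.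
by rewrite ger0_norm ?sqr_ge0.
Qed.

Lemma L2_measurable f : L2 mu D f -> measurable_fun D f. Proof. by case. Qed.

Lemma L2_mul_integrable f g : L2 mu D f -> L2 mu D g ->
  mu.-integrable D (EFin \o (fun x => f x * g x)).
Proof.
move=> /sqr_integrableP[mf f2] /sqr_integrableP[mg g2].
apply: le_integrable (integrableD mD f2 g2) => //.
  by apply/measurable_EFinP; exact: measurable_funM.
move=> x _ /=; rewrite lee_fin (@ger0_norm _ (_ + _)) ?addr_ge0 ?sqr_ge0//.
rewrite normrM -(real_normK (num_real (f x))) -(real_normK (num_real (g x))).
have := normr_ge0 (f x); have := normr_ge0 (g x); nra.
Qed.

Lemma L2D f g : L2 mu D f -> L2 mu D g -> L2 mu D (fun x => f x + g x).
Proof.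
move=> lf lg; apply/sqr_integrableP; split.
  by apply: measurable_funD; apply: L2_measurable.
have -> : EFin \o (fun x => (f x + g x) ^+ 2) =
    (EFin \o (fun x => f x * (f x))) \+ (EFin \o (fun x => f x * g x))
    \+ (EFin \o (fun x => g x * f x)) \+ (EFin \o (fun x => g x * g x)).
  by apply/funext => x /=; rewrite -!EFinD; congr EFin; ring.
by do 3 (apply: integrableD => //; last exact: L2_mul_integrable); exact: L2_mul_integrable.
Qed.

Lemma L2Z k f : L2 mu D f -> L2 mu D (fun x => k * f x).
Proof.
move=> /sqr_integrableP[mf h]; apply/sqr_integrableP; split; first exact: measurable_funM.
have -> : EFin \o (fun x => (k * f x) ^+ 2) =
    (fun x => (k ^+ 2)%:E * (EFin \o (fun x => (f x ^+ 2)%R)) x)%E.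
  by apply/funext => x /=; rewrite exprMn EFinM.
exact: integrableZl.
Qed.

Lemma L2_0 : L2 mu D (fun=> 0).
Proof.
apply/sqr_integrableP; split; first exact: measurable_cst.
by rewrite (_ : _ \o _ = cst 0%E) ?integrable0//; apply/funext => x /=; rewrite expr0n.
Qed.

Lemma L2_eq f g : {in D, f =1 g} -> L2 mu D f -> L2 mu D g.
Proof.
move=> fg /sqr_integrableP[mf h]; apply/sqr_integrableP; split.
  exact: eq_measurable_fun mf.
by apply: eq_integrable h => // x xD /=; rewrite fg.
Qed.

Lemma L2_sum I (s : seq I) (F : I -> T -> R) : (forall i, L2 mu D (F i)) ->
  L2 mu D (fun x => \sum_(i <- s) F i x).
Proof.
move=> h; elim: s => [|i s IH].
  by apply: L2_eq L2_0 => x _; rewrite big_nil.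
by apply: L2_eq (L2D (h i) IH) => x _; rewrite big_cons.
Qed.

Lemma l2norm_eq f g : {in D, f =1 g} -> l2norm mu D f = l2norm mu D g.
Proof.
move=> fg; congr (Lnorm _ _ _); apply/funext => x /=; rewrite /patch.
by case: ifPn => // /fg ->.
Qed.

Lemma l2norm_sqr_fin f : L2 mu D f ->
  (l2norm mu D f ^+ 2 = (\int[mu]_(x in D) (f x ^+ 2))%:E)%E.
Proof.
move=> /sqr_integrableP[mf h]; rewrite l2norm_sqr /Rintegral fineK//.
exact: integrable_fin_num.
Qed.

Lemma Rintegral_sum I (s : seq I) (F : I -> T -> R) :
  (forall i, mu.-integrable D (EFin \o F i)) ->
  \int[mu]_(x in D) (\sum_(i <- s) F i x) = \sum_(i <- s) \int[mu]_(x in D) F i x.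
Proof.
move=> h; have aux s' : mu.-integrable D (EFin \o (fun x => \sum_(i <- s') F i x)).
  rewrite (_ : _ \o _ = (fun x => \sum_(i <- s') (EFin \o F i) x)%E).
    exact: integrable_sum.
  by apply/funext => x /=; rewrite sumEFin.
elim: s => [|i s IH].
  by rewrite big_nil; under eq_Rintegral do rewrite big_nil; rewrite Rintegral_cst// mul0r.
by rewrite big_cons -IH -RintegralD//; apply: eq_Rintegral => x _; rewrite big_cons.
Qed.

End L2_theory.

Section off_null.
Import HBNNSimple.

(* The pointwise bound on f may fail on a null set where f is not even
   measurable. *)
Lemma ge0_le_integral_off_null {dT : measure_display} {T : measurableType dT} {R : realType}
    (mu : {measure set T -> \bar R}) (D A : set T) (f g : T -> \bar R) :
  measurable D -> measurable A -> mu A = 0%E -> measurable_fun D g ->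
  (forall x, D x -> 0 <= f x)%E -> (forall x, D x -> 0 <= g x)%E ->
  (forall x, D x -> ~ A x -> f x <= g x)%E ->
  (\int[mu]_(x in D) f x <= \int[mu]_(x in D) g x)%E.
Proof.
move=> mD mA A0 mg f0 g0 fg.
rewrite integral_mkcond [leRHS]integral_mkcond ge0_integralTE; last first.
  by move=> x; rewrite /patch; case: ifPn => // /set_mem /f0.
(* The integral of f is a supremum over simple functions below f. Each of these is measurable, so
   the almost everywhere comparison applies to it instead of f. *)
apply: ge_ereal_sup => _ [h hf <-].
rewrite -integralT_nnsfun.
apply: ae_ge0_le_integral => //.
- by move=> x _; rewrite lee_fin fun_ge0.
- exact/measurable_EFinP.
- by move=> x _; rewrite /patch; case: ifPn => // /set_mem /g0.
- exact/(measurable_restrictT _ mD).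
exists A; split => // x /=; apply: contra_notP => nA _; apply: (le_trans (hf x)).
by rewrite /patch; case: ifPn => // /set_mem Dx; exact: fg.
Qed.

End off_null.

(** * Lebesgue measure on rows *)

Section row_borel.
Context {R : realType} {d : nat}.
Local Notation leb := (@lebesgue_row R d).

Lemma measurable_row_ball (c : 'rV[R]_d) (e : R) : measurable (ball c e).
Proof.
have [e0|e0] := ltP 0 e; last first.
  rewrite (_ : ball c e = set0); first exact: measurable0.
  by apply/seteqP; split => // y [e1]; rewrite ltNge e0 in e1.
rewrite (_ : ball c e = \bigcap_(i in [set: 'I_d]) (row_coor i @^-1` (ball (c ord0 i) e))).
  apply: fin_bigcap_measurable => // i _; rewrite -[X in measurable X]setTI.
  exact: measurable_row_coor (measurable_ball _ _).
apply/seteqP; split => [y [_ h] i _|y h]; first exact: h.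
by split => // i j; rewrite (ord1 i); exact: h.
Qed.

(** The sigma-algebra is generated by the coordinates, so an open set has to be written as a
    countable union: balls with rational centre and radius 1 / (n + 1). Balls of the sup norm are
    boxes, hence measurable. *)
Lemma open_measurable_row (A : set 'rV[R]_d) : open A -> measurable A.
Proof.
move=> oA.
pose B (z : 'rV[rat]_d * nat) : set 'rV[R]_d := ball (map_mx ratr z.1 : 'rV[R]_d) (z.2.+1%:R^-1).
pose F z := if `[< B z `<=` A >] then B z else set0.
rewrite (_ : A = \bigcup_z F z).
  apply: countable_bigcupT_measurable => // z.
  by rewrite /F; case: ifPn => _; [exact: measurable_row_ball|exact: measurable0].
apply/seteqP; split=> [x Ax|x [z _]]; last by rewrite /F; case: ifPn => // /asboolP; exact.
have /nbhs_ballP[e /= e0 xeA] : nbhs x A by exact: open_nbhs_nbhs.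
have e20 : 0 < e / 2 by rewrite divr_gt0.
(* Below e / 2, since two points of a ball are less than two radii apart. *)
have [n _ /(_ n (leqnn n))] := near_infty_natSinv_lt (PosNum e20) => /= ne.
have n0 : 0 < n.+1%:R^-1 :> R by rewrite invr_gt0.
have /choice[r rP] : forall i : 'I_d, exists r : rat,
    x ord0 i - n.+1%:R^-1 < ratr r < x ord0 i + n.+1%:R^-1.
  move=> i; have [|r] := @rat_in_itvoo R (x ord0 i - n.+1%:R^-1) (x ord0 i + n.+1%:R^-1).
    by rewrite ltrD2l gt0_cp.
  by exists r; rewrite in_itv in p.
pose c : 'rV[rat]_d := \row_i r i.
have xc : B (c, n) x.
  split => // i j; rewrite (ord1 i) /ball/= !mxE ltr_distl.
  exact: rP.
exists (c, n) => //; rewrite /F; case: ifPn => // /asboolP; case => y yc.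
apply: xeA; apply: (@le_ball _ _ x (n.+1%:R^-1 + n.+1%:R^-1)); first by rewrite (splitr e) lerD// ltW.
by apply: ball_triangle yc; exact: ball_sym.
Qed.

Lemma continuous_measurable_row (f : 'rV[R]_d -> R) :
  continuous f -> measurable_fun setT f.
Proof.
move=> /continuousP cf; apply: (measurability _ (RGenOpens.measurableE R)).
move=> _ [_ [a [b ->] <-]]; rewrite setTI; apply: open_measurable_row.
exact/cf/interval_open.
Qed.

End row_borel.

(** Makes bounded functions of bounded support, in particular test functions, square integrable. *)
Lemma lebesgue_row_ball {R : realType} n (r : R) : 0 < r ->
  (@lebesgue_row R n (ball (0%R : 'rV[R]_n) r) < +oo)%E.
Proof.
move=> r0; elim: n => [|n IH].
  rewrite /= diracE; case: (_ \in _) => //=; exact: ltry.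
rewrite /= /lebesgue_row_cons /pushforward.
rewrite (_ : _ @^-1` _ = (ball (0 : R) r) `*` (ball (0 : 'rV[R]_n) r)).
  rewrite product_measure1E//; last 2 first.
  - exact: measurable_ball.
  - exact: measurable_row_ball.
  rewrite lte_mul_pinfty//.
  rewrite ge0_fin_numE//.
  have h : (lebesgue_measure (ball (0%R : R) r) < +oo)%E.
    by rewrite lebesgue_measure_ball ?ltry// ltW.
  exact: h.
apply/seteqP; split => [[a x] [_ h]|[a x] [/= ha [_ hx]]].
  have {}h j := h ord0 j.
  split => /=.
    have := h (@lshift 1 n ord0); rewrite /row_cons /= (@row_mxEl _ 1 1 n) !mxE eqxx.
    by [].
  split => // i j; rewrite (ord1 i).
  by have := h (@rshift 1 n j); rewrite /row_cons /= (@row_mxEr _ 1 1 n) !mxE.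
split => // i j; rewrite (ord1 i) /row_cons /=.
rewrite -(@splitK 1 n j); case: (fintype.split _) => k /=.
  by rewrite (@row_mxEl _ 1 1 n) (ord1 k) !mxE eqxx.
by have := hx ord0 k; rewrite (@row_mxEr _ 1 1 n) !mxE.
Qed.

(** * Linear structure of the finite element space *)

Section test_functions.
Context {R : realType} {d : nat}.
Variable Omega : set 'rV[R]_d.
Local Notation leb := (@lebesgue_row R d).
Implicit Types (f g v : 'rV[R]_d -> R) (k : R).

Lemma smooth_continuous f : smooth f -> continuous f.
Proof. by move=> sf x; apply: differentiable_continuous; exact: (sf [::]). Qed.

Lemma partial_comb k f g i x : differentiable f x -> differentiable g x ->
  partial i (fun y => k * f y + g y) x = k * partial i f x + partial i g x.
Proof.
move=> df dg; rewrite /partial.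
have -> : (fun y => k * f y + g y) = (k *: f) + g by [].
rewrite deriveD; [|exact/diff_derivable/differentiableZ|exact: diff_derivable].
by rewrite deriveZ//; exact: diff_derivable.
Qed.

Lemma foldr_partial_comb k f g s : smooth f -> smooth g ->
  foldr partial (fun y => k * f y + g y) s =
  (fun y => k * foldr partial f s y + foldr partial g s y).
Proof.
move=> sf sg; elim: s => //= i s ->; apply/funext => x.
by rewrite partial_comb.
Qed.

Lemma gradient_comb k f g x : smooth f -> smooth g ->
  gradient (fun y => k * f y + g y) x = k *: gradient f x + gradient g x.
Proof.
move=> sf sg; apply/rowP => i; rewrite !mxE partial_comb//.
  exact: (sf [::]).
exact: (sg [::]).
Qed.

Lemma smooth_comb k f g : smooth f -> smooth g -> smooth (fun y => k * f y + g y).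
Proof.
move=> sf sg s x; rewrite foldr_partial_comb//.
have := differentiableD (differentiableZ k (sf s x)) (sg s x); exact.
Qed.

Lemma compact_closure_sub (A B : set 'rV[R]_d) :
  compact B -> A `<=` B -> compact (closure A) /\ closure A `<=` B.
Proof.
move=> cB AB; have clB : closed B.
  by apply: compact_closed => //; exact: norm_hausdorff.
have h : closure A `<=` B by rewrite [X in _ `<=` X](closure_id B).1//; exact: closure_subset.
by split => //; apply: subclosed_compact h => //; exact: closed_closure.
Qed.

Lemma test_function_comb k f g : test_function Omega f -> test_function Omega g ->
  test_function Omega (fun y => k * f y + g y).
Proof.
move=> [sf cf fO] [sg cg gO].
have [] := @compact_closure_sub [set x | k * f x + g x != 0]
  (closure [set x | f x != 0] `|` closure [set x | g x != 0]).
- exact: compactU.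
- move=> x /= h; have [fx|fx] := eqVneq (f x) 0; last by left; exact: subset_closure.
  by right; apply: subset_closure; move: h; rewrite /= fx mulr0 add0r.
move=> h1 h2; split => //; first exact: smooth_comb.
by apply: subset_trans h2 _ => x [/fO|/gO].
Qed.

Lemma test_function_partial f i : test_function Omega f -> test_function Omega (partial i f).
Proof.
move=> [sf cf fO].
have [] := @compact_closure_sub [set x | partial i f x != 0] _ cf.
  move=> x /=; apply: contra_neqP => nx; rewrite /partial.
  rewrite (@near_eq_derive _ _ _ f (cst 0)) ?derive_cst//.
  have : nbhs x (~` closure [set x | f x != 0]).
    by apply: open_nbhs_nbhs; split => //; apply: closed_openC; exact: closed_closure.
  apply: filterS => y; apply: contra_notP => /eqP fy; exact: subset_closure.
move=> h1 h2; split => //; last exact: subset_trans fO.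
by move=> s x; have := sf (rcons s i) x; rewrite foldr_rcons.
Qed.

Hypothesis oO : open Omega.
Let mO : measurable Omega. Proof. exact: open_measurable_row. Qed.

Lemma test_function_L2 f : test_function Omega f -> L2 leb Omega f.
Proof.
move=> [sf cf fO]; have cof := smooth_continuous sf.
have mf : measurable_fun Omega f.
  by apply: measurable_funTS; exact: continuous_measurable_row.
have [M [Mr HM]] : bounded_set (f @` closure [set x | f x != 0]).
  by apply/compact_bounded/continuous_compact => //; exact: continuous_subspaceT.
have [N [Nr HN]] := compact_bounded cf.
(* The bounds hold for every number strictly above [M] and [N]. The radius needs one more unit
   because the ball is open. *)
pose r : R := `|N| + 2; pose K : R := `|M| + 1.
have r0 : 0 < r by rewrite ltr_wpDl.
have K0 : 0 <= K by rewrite addr_ge0.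
have fK x : `|f x| <= K.
  have [->|fx] := eqVneq (f x) 0; first by rewrite normr0 addr_ge0.
  apply: HM; first by rewrite /K (le_lt_trans (ler_norm _))// ltrDl.
  by exists x => //; exact: subset_closure.
have fB x : f x != 0 -> ball (0 : 'rV[R]_d) r x.
  move=> fx; have : `|x| <= `|N| + 1.
    apply: HN; first by rewrite (le_lt_trans (ler_norm _))// ltrDl.
    exact: subset_closure.
  move=> h; rewrite -ball_normE /= sub0r normrN (le_lt_trans h)// /r ltrD2l.
  by rewrite ltr1n.
apply/sqr_integrableP; split => //.
pose B := ball (0 : 'rV[R]_d) r.
have iB : leb.-integrable Omega (EFin \o (fun x => K ^+ 2 * \1_B x)).
  rewrite (_ : _ \o _ = (fun x => (K ^+ 2)%:E * (EFin \o \1_B) x)%E).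
    have mB : measurable B by exact: measurable_row_ball.
    apply: integrableZl => //; apply/integrableP; split.
      by apply/measurable_EFinP; exact: measurable_indic.
    rewrite (eq_integral (fun x => (\1_B x)%:E)); last first.
      by move=> x _ /=; rewrite ger0_norm.
    rewrite integral_indic//; apply: le_lt_trans (lebesgue_row_ball d r0).
    by apply: le_measure; rewrite ?inE//; exact: measurableI.
  by apply/funext => x /=; rewrite EFinM.
apply: le_integrable iB => //.
  by apply/measurable_EFinP; exact: measurable_funX.
move=> x _ /=; rewrite lee_fin !ger0_norm ?sqr_ge0 ?mulr_ge0//.
have [->|fx] := eqVneq (f x) 0; first by rewrite expr0n mulr_ge0 ?sqr_ge0.
rewrite indicE mem_set; last exact: fB.
rewrite mulr1 -real_normK ?num_real// ler_pXn2r ?nnegrE//.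
Qed.

Lemma L2_comb k f g : L2 leb Omega f -> L2 leb Omega g ->
  L2 leb Omega (fun x => k * f x + g x).
Proof. by move=> lf lg; apply: L2D => //; exact: L2Z. Qed.

Lemma ip_comb k f g h : L2 leb Omega f -> L2 leb Omega g -> L2 leb Omega h ->
  ip leb Omega (fun x => k * f x + g x) h = k * ip leb Omega f h + ip leb Omega g h.
Proof.
move=> lf lg lh; rewrite /ip -RintegralZl//; last exact: L2_mul_integrable.
rewrite -RintegralD//; first last.
- exact: L2_mul_integrable.
- exact: integrableZl (L2_mul_integrable mO lf lh).
by apply: eq_Rintegral => x _; rewrite mulrDl mulrA.
Qed.

Lemma weak_gradient_comb k v v' (g g' : 'rV[R]_d -> 'rV[R]_d) :
  H1 Omega v g -> H1 Omega v' g' ->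
  H1 Omega (fun x => k * v x + v' x) (fun x => k *: g x + g' x).
Proof.
move=> [lv lg wg] [lv' lg' wg']; split; first exact: L2_comb.
  by move=> i; apply: (L2_eq mO _ (L2_comb k (lg i) (lg' i))) => x _; rewrite !mxE.
move=> phi tphi i; rewrite ip_comb//; last exact/test_function_L2/test_function_partial.
rewrite wg// wg'// mulrN -opprD -ip_comb//; last exact: test_function_L2.
by congr (- _); apply: eq_Rintegral => x _; rewrite !mxE.
Qed.

Lemma eucl_ge0 (x : 'rV[R]_d) : 0 <= eucl x. Proof. exact: sqrtr_ge0. Qed.

Lemma dotv_ge0 (x : 'rV[R]_d) : 0 <= dotv x x.
Proof. by apply: sumr_ge0 => i _; rewrite -expr2 sqr_ge0. Qed.

Lemma eucl_sqr (x : 'rV[R]_d) : eucl x ^+ 2 = \sum_(i < d) x ord0 i ^+ 2.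
Proof. by rewrite sqr_sqrtr ?dotv_ge0//; apply: eq_bigr => i _; rewrite expr2. Qed.

Lemma measurable_eucl (g : 'rV[R]_d -> 'rV[R]_d) :
  (forall i, measurable_fun Omega (fun x => g x ord0 i)) ->
  measurable_fun Omega (fun x => eucl (g x)).
Proof.
move=> mg; apply: (measurableT_comp (continuous_measurable_fun (@sqrt_continuous R))).
by apply: measurable_sum => i; exact: measurable_funM.
Qed.

Lemma le_sqre (a b : \bar R) : (0 <= b -> a ^+ 2 <= b ^+ 2 -> a <= b)%E.
Proof.
case: a => [a| |]; last by rewrite leNye.
  2: case: b => [b| |] //; by rewrite -EFin_expe (_ : (+oo ^+ 2 = +oo :> \bar R)%E) ?expe2 ?mulyy.
case: b => [b| |] //; last by move=> _ _; rewrite leey.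
rewrite -!EFin_expe !lee_fin => b0; apply: contraTT; rewrite -!ltNge => ba.
by rewrite ltr_pXn2r// nnegrE (le_trans b0 (ltW ba)).
Qed.

Lemma le_l2norm f g : measurable_fun Omega f -> measurable_fun Omega g ->
  (forall x, Omega x -> `|f x| <= `|g x|) -> (l2norm leb Omega f <= l2norm leb Omega g)%E.
Proof.
move=> mf mg fg; apply: le_sqre; first exact: Lnorm_ge0.
rewrite !l2norm_sqr; apply: ge0_le_integral => //.
- by move=> x _; rewrite lee_fin sqr_ge0.
- by apply/measurable_EFinP; exact: measurable_funX.
- by apply/measurable_EFinP; exact: measurable_funX.
- move=> x Ox; rewrite lee_fin -(real_normK (num_real (f x))) -(real_normK (num_real (g x))).
  by rewrite ler_pXn2r ?nnegrE// fg.
Qed.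

Lemma l2norm_comb k f g : measurable_fun Omega f -> measurable_fun Omega g ->
  (l2norm leb Omega (fun x => (k * f x + g x)%R)
   <= `|k|%:E * l2norm leb Omega f + l2norm leb Omega g)%E.
Proof.
move=> mf mg; pose kf := (fun x => k * f x) \_ Omega.
have mkf : measurable_fun Omega (fun x => k * f x) by exact: measurable_funM.
have -> : l2norm leb Omega (fun x => k * f x + g x) =
    'N[leb]_2%:E[EFin \o (kf \+ (g \_ Omega))%R]%E.
  congr (Lnorm _ _ _); apply/funext => x /=; rewrite /kf /patch.
  by case: ifPn => // _; rewrite addr0.
apply: (le_trans (minkowski_EFin _ _ _ _)).
- exact: (measurable_restrictT _ mO).1 mkf.
- exact: (measurable_restrictT _ mO).1 mg.
- by rewrite ler1n.
rewrite leeD2r// -/(l2norm leb Omega (fun x => k * f x)) -/(l2norm leb Omega f).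
apply: le_sqre; first by rewrite mule_ge0 ?Lnorm_ge0.
rewrite expe2 [leRHS]expe2 muleACA -!expe2 !l2norm_sqr -EFin_expe real_normK ?num_real//.
rewrite -ge0_integralZl_EFin ?sqr_ge0//; last 2 first.
- by move=> x _; rewrite lee_fin sqr_ge0.
- by apply/measurable_EFinP; exact: measurable_funX.
by under eq_integral do rewrite exprMn EFinM.
Qed.

Lemma cvg0_comb k (F G H : nat -> \bar R) :
  (forall n, 0 <= H n)%E -> (forall n, H n <= k%:E * F n + G n)%E ->
  F @ \oo --> 0%E -> G @ \oo --> 0%E -> H @ \oo --> 0%E.
Proof.
move=> H0 HFG F0 G0.
apply: (@squeeze_cvge _ _ _ _ (cst 0%E) _ (fun n => k%:E * F n + G n)%E).
- by apply: nearW => n; rewrite H0 HFG.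
- exact: cvg_cst.
rewrite -[X in _ --> X]adde0 -[X in (X + _)%E](mule0 k%:E).
by apply: cvgeD => //; exact: cvgeZl.
Qed.

(** The test function on a slab has coefficients that are linear combinations of those of u, so
    membership in H^1_0, together with the chosen gradient, must pass to linear combinations. *)
Lemma H01_comb k v v' (g g' : 'rV[R]_d -> 'rV[R]_d) :
  H01 Omega v g -> H01 Omega v' g' ->
  H01 Omega (fun x => k * v x + v' x) (fun x => k *: g x + g' x).
Proof.
move=> [h1 [phi [tphi cphi cgphi]]] [h1' [psi [tpsi cpsi cgpsi]]].
have mtest f : test_function Omega f -> measurable_fun Omega f.
  by move=> /test_function_L2[].
split; first exact: weak_gradient_comb.
have [[mv _] lg _] := h1; have [[mv' _] lg' _] := h1'.
exists (fun n x => k * phi n x + psi n x); split.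
- by move=> n; exact: test_function_comb.
- apply: cvg0_comb cphi cpsi; first by move=> n; exact: Lnorm_ge0.
  move=> n; rewrite -(_ : l2norm leb Omega (fun x => k * (phi n x - v x) + (psi n x - v' x)) =
    l2norm leb Omega (fun x => k * phi n x + psi n x - (k * v x + v' x))).
    by apply: l2norm_comb; apply: measurable_funB => //; exact: mtest.
  by apply: l2norm_eq => x _; ring.
have mgr n i : measurable_fun Omega (fun x => (gradient (phi n) x - g x) ord0 i).
  rewrite (_ : (fun _ => _) = fun x => partial i (phi n) x - g x ord0 i); last first.
    by apply/funext => x; rewrite !mxE.
  by apply: measurable_funB; [exact: (mtest _ (test_function_partial i (tphi n)))|have [] := lg i].
have mgr' n i : measurable_fun Omega (fun x => (gradient (psi n) x - g' x) ord0 i).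
  rewrite (_ : (fun _ => _) = fun x => partial i (psi n) x - g' x ord0 i); last first.
    by apply/funext => x; rewrite !mxE.
  by apply: measurable_funB; [exact: (mtest _ (test_function_partial i (tpsi n)))|have [] := lg' i].
(* The factors 2 are harmless in the limit and replace the Euclidean triangle inequality by an
   inequality between squares, checked coordinate by coordinate. *)
apply: (@cvg0_comb (`|2 * k|)
    (fun n => l2norm leb Omega (fun x => eucl (gradient (phi n) x - g x)))
    (fun n => `|2%R|%:E * l2norm leb Omega (fun x => eucl (gradient (psi n) x - g' x)%R))%E) => //.
- by move=> n; exact: Lnorm_ge0.
- move=> n.
  pose A x := gradient (phi n) x - g x; pose B x := gradient (psi n) x - g' x.
  have mA : measurable_fun Omega (fun x => eucl (A x)) by apply: measurable_eucl => i; exact: mgr.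
  have mB : measurable_fun Omega (fun x => eucl (B x)) by apply: measurable_eucl => i; exact: mgr'.
  have m2B : measurable_fun Omega (fun x => 2 * eucl (B x)) by exact: measurable_funM.
  apply: (@le_trans _ _ (l2norm leb Omega (fun x => `|2 * k| * eucl (A x) + (2 * eucl (B x))))).
    rewrite (_ : l2norm _ _ _ = l2norm leb Omega (fun x => eucl (k *: A x + B x))); last first.
      apply: l2norm_eq => x _; congr eucl; rewrite gradient_comb; last 2 first.
      - by have [] := tphi n.
      - by have [] := tpsi n.
      by rewrite /A /B scalerBr opprD addrACA.
    apply: le_l2norm.
    + apply: measurable_eucl => i.
      rewrite (_ : (fun _ => _) = fun x => k * A x ord0 i + B x ord0 i); last first.
        by apply/funext => x; rewrite !mxE.
      apply: measurable_funD; last exact: mgr'.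
      by apply: measurable_funM => //; exact: mgr.
    + by apply: measurable_funD => //; exact: measurable_funM.
    + move=> x _; have A0 := eucl_ge0 (A x); have B0 := eucl_ge0 (B x).
      have S0 : 0 <= `|2 * k| * eucl (A x) + 2 * eucl (B x) by rewrite addr_ge0// mulr_ge0.
      rewrite (ger0_norm S0) (ger0_norm (eucl_ge0 _)) -(@ler_pXn2r _ 2) ?nnegrE ?eucl_ge0//.
      apply: (@le_trans _ _ (2 * (k ^+ 2 * eucl (A x) ^+ 2) + 2 * eucl (B x) ^+ 2)).
        rewrite !eucl_sqr !mulr_sumr -big_split/=; apply: ler_sum => i _; rewrite !mxE.
        rewrite -exprMn; set a := k * _; set b := partial i _ x - _.
        by have := sqr_ge0 (a - b); nra.
      rewrite normrM (ger0_norm (ler0n _ 2)) -(real_normK (num_real k)).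
      have := normr_ge0 k; move: (`|k|) (eucl _) (eucl _) A0 B0 => a b e b0 e0 a0.
      rewrite -exprMn -(mulrA 2); have := mulr_ge0 a0 b0; move: (a * b) => w w0.
      by have := mulr_ge0 w0 e0; have := sqr_ge0 w; have := sqr_ge0 e; nra.
  apply: (le_trans (l2norm_comb _ _ _)) => //.
  rewrite normr_id leeD2l//.
  rewrite (_ : l2norm _ _ _ = l2norm leb Omega (fun x => 2 * eucl (B x) + 0)); last first.
    by apply: l2norm_eq => x _; rewrite addr0.
  apply: (le_trans (l2norm_comb _ _ _)) => //.
  rewrite (_ : l2norm leb Omega (fun=> 0) = 0%E) ?adde0//.
  rewrite -(@Lnorm0 _ _ _ leb 2%:E) ?eqe ?pnatr_eq0//.
  by apply: eq_Lnorm => x /=; rewrite /patch; case: ifPn.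
- rewrite -[X in _ --> X](mule0 (`|2|%:E)); exact: cvgeZl.
Qed.

End test_functions.

Lemma Vh_comb {R : realType} {d : nat} (Omega : set 'rV[R]_d) p m
    (V : 'I_m -> 'I_d.+1 -> 'rV[R]_d) k v v' (g g' : 'rV[R]_d -> 'rV[R]_d) :
  open Omega -> Vh Omega p V v g -> Vh Omega p V v' g' ->
  Vh Omega p V (fun x => k * v x + v' x) (fun x => k *: g x + g' x).
Proof.
move=> oO [hv pv] [hv' pv']; split; first exact: H01_comb.
move=> j; have [a Ha] := pv j; have [b Hb] := pv' j.
exists (fun e => k * a e + b e) => x Ax; rewrite Ha// Hb// mulr_sumr -big_split/=.
by apply: eq_bigr => e _; rewrite mulrDl mulrA.
Qed.

Lemma Vh_sum {R : realType} {d : nat} (Omega : set 'rV[R]_d) p m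
    (V : 'I_m -> 'I_d.+1 -> 'rV[R]_d) n (c : 'I_n.+1 -> R)
    (v : 'I_n.+1 -> 'rV[R]_d -> R) (g : 'I_n.+1 -> 'rV[R]_d -> 'rV[R]_d) :
  open Omega -> (forall i, Vh Omega p V (v i) (g i)) ->
  Vh Omega p V (fun x => \sum_(i < n.+1) c i * v i x) (fun x => \sum_(i < n.+1) c i *: g i x).
Proof.
move=> oO h.
suff aux s : Vh Omega p V (fun x => \sum_(i <- s) c i * v i x) (fun x => \sum_(i <- s) c i *: g i x).
  exact: aux.
elim: s => [|i s IH].
  (* The empty sum is zero, obtained as -v + v from the member of index 0; this is why the family is
     indexed by a nonempty ordinal. *)
  have := Vh_comb (-1) oO (h ord0) (h ord0); congr Vh; apply/funext => x; rewrite big_nil.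
    by rewrite mulN1r addNr.
  by rewrite scaleN1r addNr.
have := Vh_comb (c i) oO (h i) IH; congr Vh; apply/funext => x; by rewrite big_cons.
Qed.

(** * Polynomials in time with coefficients in L2 *)

Section time_calculus.
Context {R : realType}.
Implicit Types (a b s : R) (p : {poly R}).

Lemma continuous_horner p : continuous (horner p).
Proof.
move=> s; apply: differentiable_continuous; apply/derivable1_diffP.
exact: derivable_horner.
Qed.

Lemma near_itvoo a b s : a < s < b -> \forall r \near s, a < r < b.
Proof.
move=> sab; have : s \in `]a, b[ by rewrite in_itv.
by move=> /near_in_itvoo; apply: filterS => r; rewrite in_itv.
Qed.

Section scalar.
Variables (a b : R) (f : R -> R) (p : {poly R}).
Hypothesis fp : forall s, a < s < b -> f s = p.[s].

Lemma derive1_poly s : a < s < b -> derive1 f s = p^`().[s].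
Proof.
move=> sab; rewrite derivE !derive1E; apply: near_eq_derive.
by near=> r; apply: fp; near: r; exact: near_itvoo.
Unshelve. all: by end_near. Qed.

Lemma lim_right_poly : a < b -> lim (f r @[r --> a^'+]) = p.[a].
Proof.
move=> ab; apply: cvg_lim => //.
apply: cvg_trans; last exact: cvg_at_right_filter (@continuous_horner p a).
apply: near_eq_cvg; near=> r; apply/esym/fp; apply/andP; split; near: r.
  exact: nbhs_right_gt.
exact: nbhs_right_lt.
Unshelve. all: by end_near. Qed.

Lemma lim_left_poly : a < b -> lim (f r @[r --> b^'-]) = p.[b].
Proof.
move=> ab; apply: cvg_lim => //.
apply: cvg_trans; last exact: cvg_at_left_filter (@continuous_horner p b).
apply: near_eq_cvg; near=> r; apply/esym/fp; apply/andP; split; near: r.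
  exact: nbhs_left_gt.
exact: nbhs_left_lt.
Unshelve. all: by end_near. Qed.

End scalar.

Section vector.
Variables (d : nat) (a b : R) (f : R -> 'rV[R]_d) (p : 'I_d -> {poly R}).
Hypothesis fp : forall s, a < s < b -> f s = \row_i (p i).[s].

Lemma derivable_row_horner s : derivable (fun s => \row_i (p i).[s] : 'rV[R]_d) s 1.
Proof.
apply/derivable_mxP => i j.
rewrite (_ : (fun _ => _) = horner (p j)); first exact: derivable_horner.
by apply/funext => r; rewrite mxE.
Qed.

Lemma continuous_row_horner : continuous (fun s => \row_i (p i).[s] : 'rV[R]_d).
Proof.
move=> s; apply: differentiable_continuous; apply/derivable1_diffP.
exact: derivable_row_horner.
Qed.

Lemma derive1_row_poly s : a < s < b -> derive1 f s = \row_i (p i)^`().[s].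
Proof.
move=> sab; rewrite derive1E.
rewrite (@near_eq_derive _ _ _ _ (fun s => \row_i (p i).[s] : 'rV[R]_d)); last first.
  by near=> r; apply: fp; near: r; exact: near_itvoo.
rewrite derive_mx; last exact: derivable_row_horner.
apply/rowP => i; rewrite !mxE derivE derive1E; congr ('D_1 _ s).
by apply/funext => r; rewrite mxE.
Unshelve. all: by end_near. Qed.

Lemma lim_right_row_poly : a < b -> lim (f r @[r --> a^'+]) = \row_i (p i).[a].
Proof.
move=> ab; apply: cvg_lim => //.
apply: cvg_trans; last exact: cvg_at_right_filter (@continuous_row_horner a).
apply: near_eq_cvg; near=> r; apply/esym/fp; apply/andP; split; near: r.
  exact: nbhs_right_gt.
exact: nbhs_right_lt.
Unshelve. all: by end_near. Qed.

Lemma lim_left_row_poly : a < b -> lim (f r @[r --> b^'-]) = \row_i (p i).[b].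
Proof.
move=> ab; apply: cvg_lim => //.
apply: cvg_trans; last exact: cvg_at_left_filter (@continuous_row_horner b).
apply: near_eq_cvg; near=> r; apply/esym/fp; apply/andP; split; near: r.
  exact: nbhs_left_gt.
exact: nbhs_left_lt.
Unshelve. all: by end_near. Qed.

End vector.

Lemma measurable_horner p (D : set R) : measurable_fun D (horner p).
Proof.
apply: measurable_funTS; apply: continuous_measurable_fun; exact: continuous_horner.
Qed.

(** The bridge between the algebraic [pint] and the Lebesgue integral. *)
Lemma integral_horner a b p : a < b ->
  (\int[lebesgue_measure]_(s in `]a, b[) (p.[s])%:E = (pint a b p)%:E)%E.
Proof.
move=> ab; rewrite -(@integral_itv_bndoo _ a b (fun s => (p.[s])%:E) true false); last first.
  by apply/measurable_EFinP; exact: measurable_horner.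
rewrite (@continuous_FTC2 _ (horner p) (horner (primitive p)))//.
- by apply: continuous_subspaceT; exact: continuous_horner.
- split.
  + by move=> s _; exact: derivable_horner.
  + by apply: cvg_at_right_filter; exact: continuous_horner.
  + by apply: cvg_at_left_filter; exact: continuous_horner.
- by move=> s _; rewrite -derivE deriv_primitive.
Qed.

Lemma integrable_horner a b p : a < b ->
  lebesgue_measure.-integrable `]a, b[ (EFin \o horner p).
Proof.
move=> ab; have h : lebesgue_measure.-integrable `[a, b] (EFin \o horner p).
  apply: continuous_compact_integrable; first exact: segment_compact.
  by apply: continuous_subspaceT; exact: continuous_horner.
by apply: integrableS h => //; exact: subset_itv_oo_cc.
Qed.

End time_calculus.

(** * Integrals of products of a space factor and a time factor *)

Section tensor.
Context d1 d2 (X : measurableType d1) (Y : measurableType d2) (R : realType).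
Variables (m1 : {sigma_finite_measure set X -> \bar R}).
Variables (m2 : {sigma_finite_measure set Y -> \bar R}).
Variables (D : set X) (E : set Y) (u : X -> R) (v : Y -> R).
Hypotheses (mD : measurable D) (mE : measurable E).
Hypotheses (iu : m1.-integrable D (EFin \o u)) (iv : m2.-integrable E (EFin \o v)).

Let f (z : X * Y) : R := u z.1 * v z.2.

Let u0 := u \_ D.
Let v0 := v \_ E.

Let fE : (EFin \o f) \_ (D `*` E) = (fun z : X * Y => (u0 z.1 * v0 z.2)%:E).
Proof.
apply/funext => -[x y]; rewrite /u0 /v0 /patch /= in_setX.
case: ifPn => /=; first by move=> /andP[-> ->].
by rewrite negb_and => /orP[|] /negbTE ->; rewrite ?mul0r ?mulr0.
Qed.

Let iu0 : m1.-integrable setT (EFin \o u0).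
Proof. by rewrite -restrict_EFin; exact/(integrable_mkcond _ mD).1. Qed.

Let iv0 : m2.-integrable setT (EFin \o v0).
Proof. by rewrite -restrict_EFin; exact/(integrable_mkcond _ mE).1. Qed.

Let mu0 : measurable_fun setT u0.
Proof. by have /measurable_int/measurable_EFinP := iu0. Qed.

Let mv0 : measurable_fun setT v0.
Proof. by have /measurable_int/measurable_EFinP := iv0. Qed.

Let mf0 : measurable_fun setT (fun z : X * Y => (u0 z.1 * v0 z.2)%:E).
Proof.
apply/measurable_EFinP; apply: measurable_funM.
  exact: measurableT_comp mu0 measurable_fst.
exact: measurableT_comp mv0 measurable_snd.
Qed.

Let if0 : (m1 \x m2)%E.-integrable setT (fun z : X * Y => (u0 z.1 * v0 z.2)%:E).
Proof.
apply/(integrable12ltyP m1 m2 mf0) => /=.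
have /integrableP[_ hu] := iu0; have /integrableP[_ hv] := iv0.
set c := (\int[m2]_y `|(EFin \o v0) y|)%E in hv.
have c0 : (0 <= c)%E by exact: integral_ge0.
rewrite (eq_integral (fun x => c * `|(EFin \o u0) x|)%E); last first.
  move=> x _ /=.
  under eq_integral do rewrite normrM EFinM.
  rewrite ge0_integralZl_EFin//; first by rewrite muleC.
  by apply/measurable_EFinP; exact: measurableT_comp.
rewrite ge0_integralZl//.
  by rewrite lte_mul_pinfty// ge0_fin_numE.
by apply/measurable_EFinP; exact: measurableT_comp.
Qed.

Lemma integrable_tensor : (m1 \x m2)%E.-integrable (D `*` E) (EFin \o f).
Proof.
apply/(integrable_mkcond _ _); first exact: measurableX.
by rewrite fE.
Qed.

(** Polynomials in time with coefficients in space are finite sums of such products, so this much of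
    Fubini suffices for the bilinear form. *)
Lemma integral_tensor :
  \int[(m1 \x m2)%E]_(z in D `*` E) f z = \int[m1]_(x in D) u x * \int[m2]_(y in E) v y.
Proof.
rewrite {1}/Rintegral integral_mkcond fE -(integral12_prod_meas1 if0) /fubini_F /=.
have fiv : (\int[m2]_y (v0 y)%:E)%E \is a fin_num by exact: integrable_fin_num iv0.
have fiu : (\int[m1]_x (u0 x)%:E)%E \is a fin_num by exact: integrable_fin_num iu0.
rewrite (eq_integral (fun x => (\int[m2]_y (v0 y)%:E) * (u0 x)%:E)%E); last first.
  move=> x _; under eq_integral do rewrite EFinM.
  by rewrite integralZl// muleC.
rewrite -(fineK fiv) integralZl//= fineM//= mulrC; congr (_ * _).
  by rewrite [in RHS]Rintegral_mkcond.
by rewrite [in RHS]Rintegral_mkcond.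
Qed.

End tensor.

(** In the monomial basis W is a fixed matrix. This carries square integrability and membership in
    the finite element space from the coefficients of u to those of the test function. *)
Lemma linear_poly_expand {R : realType} (W : {poly R} -> {poly R}) n (p : {poly R}) :
  linear W -> (size p <= n)%N -> W p = \sum_(k < n) p`_k *: W 'X^k.
Proof.
move=> linW sp.
have W0 : W 0 = 0.
  have := linW (-1) 0 0; rewrite scaleN1r addNr => ->.
  by rewrite scaleN1r addNr.
have WD a b : W (a + b) = W a + W b by have := linW 1 a b; rewrite !scale1r.
have WZ k a : W (k *: a) = k *: W a by have := linW k a 0; rewrite !addr0 W0 addr0.
have -> : p = \sum_(k < n) p`_k *: 'X^k.
  by rewrite -{1}(coefK p) poly_def (big_ord_widen n (fun k => p`_k *: 'X^k))// big_mkcond/=;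
    apply: eq_bigr => k _; case: ltnP => // h; rewrite nth_default// scale0r.
rewrite (big_morph W WD W0); apply: eq_bigr => k _; rewrite WZ; congr (_ *: _).
rewrite coef_sum (bigD1 k)//= coefZ coefXn eqxx mulr1 big1 ?addr0// => j jk.
by rewrite coefZ coefXn (_ : _ == _ = false) ?mulr0//; apply/negbTE; rewrite eq_sym.
Qed.

Section L2poly.
Context {R : realType} {d : nat}.
Variable Omega : set 'rV[R]_d.
Hypothesis mO : measurable Omega.
Local Notation leb := (@lebesgue_row R d).
Local Notation X := 'rV[R]_d.

(** Elements of P^(n-1) tensor L2(Omega), read as polynomial-valued functions of the space
    variable. *)
Definition L2poly n (P : X -> {poly R}) :=
  (forall x, (size (P x) <= n)%N) /\ forall i, L2 leb Omega (fun x => (P x)`_i).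

Lemma L2poly_linear n (W : {poly R} -> {poly R}) P : linear W ->
  (forall p : {poly R}, (size p <= n)%N -> (size (W p) <= n)%N) ->
  L2poly n P -> L2poly n (fun x => W (P x)).
Proof.
move=> linW sW [sP lP]; split=> [x|i]; first exact/sW/sP.
apply: (L2_eq mO _ (L2_sum mO (index_enum 'I_n)
    (F := fun k x => (W 'X^k)`_i * (P x)`_k) _)); last first.
  by move=> k; exact: L2Z.
move=> x _; rewrite (linear_poly_expand linW (sP x)) coef_sum.
by apply: eq_bigr => k _; rewrite coefZ mulrC.
Qed.

Lemma L2poly_deriv n P : L2poly n P -> L2poly n (fun x => (P x)^`()).
Proof.
apply: (L2poly_linear (W := fun p => p^`())).
  by move=> k p r; rewrite derivD derivZ.
move=> p sp; apply/leq_sizeP => j nj.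
by rewrite coef_deriv nth_default ?mul0rn// (leq_trans sp)// leqW.
Qed.

Lemma L2poly0 n : L2poly n (fun=> 0).
Proof.
split=> [x|i]; first by rewrite size_poly0.
by apply: (L2_eq mO _ (L2_0 leb Omega)) => x _; rewrite coef0.
Qed.

Lemma L2poly_horner n P s : L2poly n P -> L2 leb Omega (fun x => (P x).[s]).
Proof.
move=> [sP lP]; apply: (L2_eq mO _ (L2_sum mO (index_enum 'I_n)
    (F := fun k x => s ^+ k * (P x)`_k) _)); last first.
  by move=> k; exact: L2Z.
move=> x _; rewrite (horner_coef_wide _ (sP x)).
by apply: eq_bigr => k _; rewrite mulrC.
Qed.

Definition L1poly n (H : X -> {poly R}) :=
  (forall x, (size (H x) <= n)%N) /\
  forall i, leb.-integrable Omega (EFin \o (fun x => (H x)`_i)).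

Lemma L2poly_mul n n' P Q : L2poly n P -> L2poly n' Q ->
  L1poly (n + n')%N (fun x => P x * Q x).
Proof.
move=> [sP lP] [sQ lQ]; split=> [x|i].
  rewrite (leq_trans (size_polyMleq _ _))// (leq_trans (leq_pred _))//.
  exact: leq_add.
rewrite (_ : _ \o _ = (fun x => \sum_(j < i.+1) (EFin \o (fun x => ((P x)`_j * (Q x)`_(i - j))%R)) x)%E).
  by apply: integrable_sum => // j _; exact: L2_mul_integrable.
by apply/funext => x /=; rewrite coefM sumEFin.
Qed.

Variables (a b : R).
Hypothesis ab : a < b.
Local Notation I := `]a, b[%classic.

Let mI : measurable (I : set (measurableTypeR R)).
Proof. exact: measurable_itv. Qed.

Let mOI : measurable (Omega `*` (I : set (measurableTypeR R))).
Proof. exact: measurableX. Qed.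

Let iXn k : lebesgue_measure.-integrable I (EFin \o (fun s : R => s ^+ k)).
Proof.
have := integrable_horner 'X^k ab; congr integrable.
by apply/funext => s /=; rewrite hornerXn.
Qed.

Let intXn k : \int[lebesgue_measure]_(s in I) (s ^+ k) = pint a b 'X^k.
Proof.
rewrite /Rintegral; under eq_integral do rewrite -hornerXn.
by rewrite integral_horner.
Qed.

Lemma slab_integrable n (H : X -> {poly R}) : L1poly n H ->
  (@leb_xt R d).-integrable (Omega `*` I) (EFin \o (fun z => (H z.1).[z.2])).
Proof.
move=> [sH iH].
rewrite (_ : _ \o _ =
    (fun z => \sum_(k < n) (EFin \o (fun z => ((H z.1)`_k * z.2 ^+ k)%R)) z)%E); last first.
  by apply/funext => z /=; rewrite (horner_coef_wide _ (sH _)) sumEFin.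
apply: integrable_sum => // k _.
exact: (@integrable_tensor _ _ _ _ _ leb lebesgue_measure _ _
  (fun x => (H x)`_k) (fun s => s ^+ k)).
Qed.

Lemma pint_integrable n (H : X -> {poly R}) : L1poly n H ->
  leb.-integrable Omega (EFin \o (fun x => pint a b (H x))).
Proof.
move=> [sH iH].
rewrite (_ : _ \o _ =
    (fun x => \sum_(k < n) ((pint a b ('X^k)%R)%:E * (EFin \o (fun x => ((H x)`_k)%R)) x))%E).
  by apply: integrable_sum => // k _; exact: integrableZl.
apply/funext => x /=; rewrite sumEFin; congr EFin.
rewrite -{1}(coefK (H x)) poly_def linear_sum/=.
rewrite (big_ord_widen n (fun k => pint a b ((H x)`_k *: 'X^k)))// big_mkcond/=.
apply: eq_bigr => k _; rewrite linearZ/= mulrC.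
by case: ltnP => // h; rewrite nth_default// mulr0.
Qed.

(** Integrating in time first leaves, at each x, the algebraic integral of a real polynomial, to
    which the pointwise coercivity estimates apply. *)
Lemma slab_Rintegral n (H : X -> {poly R}) : L1poly n H ->
  \int[@leb_xt R d]_(z in Omega `*` I) (H z.1).[z.2]
  = \int[leb]_(x in Omega) pint a b (H x).
Proof.
move=> [sH iH].
transitivity (\sum_(k < n) (\int[leb]_(x in Omega) (H x)`_k) * pint a b 'X^k).
  transitivity (\int[@leb_xt R d]_(z in Omega `*` I)
      (\sum_(k < n) (H z.1)`_k * (z.2 : R) ^+ k)).
    by apply: eq_Rintegral => z _; rewrite (horner_coef_wide _ (sH _)).
  rewrite Rintegral_sum//; last first.
    move=> k; exact: (@integrable_tensor _ _ _ _ _ leb lebesgue_measure _ _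
      (fun x => (H x)`_k) (fun s => s ^+ k)).
  apply: eq_bigr => k _; rewrite -intXn.
  exact: (@integral_tensor _ _ _ _ _ leb lebesgue_measure _ _
      (fun x => (H x)`_k) (fun s => s ^+ k)).
transitivity (\int[leb]_(x in Omega) (\sum_(k < n) (H x)`_k * pint a b 'X^k)); last first.
  apply: eq_Rintegral => x _; rewrite -[in RHS](coefK (H x)) poly_def linear_sum/=.
  rewrite (big_ord_widen n (fun k => pint a b ((H x)`_k *: 'X^k)))// [in RHS]big_mkcond/=.
  apply: eq_bigr => k _; rewrite linearZ/=.
  by case: ltnP => // h; rewrite nth_default// mul0r.
rewrite Rintegral_sum//; last first.
  move=> k; rewrite (_ : _ \o _ =
    (fun x => (pint a b ('X^k)%R)%:E * (EFin \o (fun x => ((H x)`_k)%R)) x)%E).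
    exact: integrableZl.
  by apply/funext => x /=; rewrite mulrC EFinM.
by apply: eq_bigr => k _; rewrite RintegralZr.
Qed.

Lemma slab_ip n n' (F G : X -> R -> R) P Q : L2poly n P -> L2poly n' Q ->
  (forall x s, Omega x -> a < s < b -> F x s = (P x).[s]) ->
  (forall x s, Omega x -> a < s < b -> G x s = (Q x).[s]) ->
  ip (@leb_xt R d) (Omega `*` I) (xt F) (xt G) =
  \int[leb]_(x in Omega) pint a b (P x * Q x).
Proof.
move=> lP lQ FP GQ; rewrite -(slab_Rintegral (L2poly_mul lP lQ)).
apply: eq_Rintegral => -[x s] /set_mem[/= Ox]; rewrite in_itv/= => sab.
by rewrite /xt /= FP// GQ// hornerM.
Qed.

Lemma slab_ipv n n' (F G : X -> R -> X) (P Q : X -> 'I_d -> {poly R}) :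
  (forall i, L2poly n (P^~ i)) -> (forall i, L2poly n' (Q^~ i)) ->
  (forall x s, Omega x -> a < s < b -> F x s = \row_i (P x i).[s]) ->
  (forall x s, Omega x -> a < s < b -> G x s = \row_i (Q x i).[s]) ->
  ipv (@leb_xt R d) (Omega `*` I) (xt F) (xt G) =
  \sum_(i < d) \int[leb]_(x in Omega) pint a b (P x i * Q x i).
Proof.
move=> lP lQ FP GQ.
under [RHS]eq_bigr => i _ do rewrite -(slab_Rintegral (L2poly_mul (lP i) (lQ i))).
rewrite -Rintegral_sum//; last by move=> i; exact: slab_integrable (L2poly_mul (lP i) (lQ i)).
apply: eq_Rintegral => -[x s] /set_mem[/= Ox]; rewrite in_itv/= => sab.
rewrite /xt /= FP// GQ//; apply: eq_bigr => i _; by rewrite !mxE hornerM.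
Qed.

End L2poly.

(** * Spatial norms at fixed time and the load term *)

Section section_norm.
Context {R : realType} {d : nat}.
Variable Omega : set 'rV[R]_d.
Hypothesis mO : measurable Omega.
Local Notation leb := (@lebesgue_row R d).
Local Notation X := 'rV[R]_d.
Variables (a b : R).
Local Notation I := (`]a, b[%classic : set (measurableTypeR R)).

Let mI : measurable I. Proof. exact: measurable_itv. Qed.
Let mOI : measurable (Omega `*` I). Proof. exact: measurableX. Qed.

Lemma measurable_section (F : X -> R -> R) s : measurable_fun (Omega `*` I) (xt F) ->
  a < s < b -> measurable_fun Omega (F^~ s).
Proof.
move=> mF sab; apply/(measurable_restrictT _ mO).
have mF0 : measurable_fun setT (xt F \_ (Omega `*` I)) by exact/(measurable_restrictT _ mOI).
have := measurableT_comp mF0 (measurable_pair2 (s : measurableTypeR R)); congr measurable_fun.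
apply/funext => x /=; rewrite /patch in_setX /= (_ : (s \in I) = true) ?andbT//.
by apply/mem_set; rewrite /= in_itv.
Qed.

Lemma l2norm_sqrt (f : X -> R) :
  (l2norm leb Omega f = (\int[leb]_(x in Omega) (f x ^+ 2)%:E) `^ 2^-1)%E.
Proof.
rewrite -l2norm_sqr -poweR2 ?Lnorm_ge0// -poweRrM mulfV ?pnatr_eq0// poweRe1//.
exact: Lnorm_ge0.
Qed.

Lemma measurable_l2norm_section (F : X -> R -> R) : measurable_fun (Omega `*` I) (xt F) ->
  measurable_fun I (fun s => l2norm leb Omega (F^~ s)).
Proof.
move=> mF; pose f (z : X * measurableTypeR R) := ((xt F \_ (Omega `*` I)) z ^+ 2)%:E.
have mF0 : measurable_fun setT (xt F \_ (Omega `*` I)) by exact/(measurable_restrictT _ mOI).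
have mf : measurable_fun setT f by apply/measurable_EFinP; exact: measurable_funX.
have f0 z : (0 <= f z)%E by rewrite lee_fin sqr_ge0.
have mG := measurable_fun_fubini_tonelli_G (m1 := leb) f mf f0.
have mpG := measurableT_comp (measurable_poweR (2^-1 : R)) mG.
apply: (eq_measurable_fun _ _ (measurable_funTS mpG)) => s /set_mem Is /=.
rewrite l2norm_sqrt /fubini_G; congr (_ `^ _)%E.
rewrite [RHS]integral_mkcond; apply: eq_integral => x _.
rewrite /f /patch in_setX /= (mem_set Is) andbT.
by case: ifPn => // _; rewrite expr0n.
Qed.

(* Tonelli with the time integral outside, then Cauchy-Schwarz in space. *)
Lemma slab_hoelder (F G : X -> R -> R) (fn S : R) :
  measurable_fun (Omega `*` I) (xt F) -> measurable_fun (Omega `*` I) (xt G) ->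
  0 <= S ->
  (\int[lebesgue_measure]_(s in I) l2norm leb Omega (F^~ s) <= fn%:E)%E ->
  (forall s, a < s < b -> (l2norm leb Omega (G^~ s) ^+ 2 <= S%:E)%E) ->
  `|ip (@leb_xt R d) (Omega `*` I) (xt F) (xt G)| <= fn * Num.sqrt S.
Proof.
move=> mF mG S0 Ffn GS.
have mFG : measurable_fun (Omega `*` I) (fun z => xt F z * xt G z) by exact: measurable_funM.
pose h (z : X * measurableTypeR R) := (`|(fun z => xt F z * xt G z) \_ (Omega `*` I) z|)%:E.
have mh : measurable_fun setT h.
  apply/measurable_EFinP; apply: measurableT_comp => //.
  exact/(measurable_restrictT _ mOI).
have h0 z : (0 <= h z)%E by rewrite lee_fin.
suff bound : (\int[@leb_xt R d]_(z in Omega `*` I) `|(xt F z * xt G z)%:E| <= (fn * Num.sqrt S)%:E)%E.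
  have mEFG : measurable_fun (Omega `*` I) (EFin \o (fun z => xt F z * xt G z)).
    exact/measurable_EFinP.
  have := le_trans (le_abse_integral (@leb_xt R d) mOI mEFG) bound.
  rewrite /ip /Rintegral; set y := integral _ _ _.
  by case: y => [r| |]//=; rewrite lee_fin.
have sS := sqrtr_ge0 S.
have ml2 := measurable_l2norm_section mF.
rewrite (_ : integral _ _ _ = (\int[leb \x lebesgue_measure]_z h z)%E); last first.
  rewrite integral_mkcond; apply: eq_integral => z _; rewrite /h /patch.
  by case: ifPn => // _; rewrite normr0.
rewrite (fubini_tonelli2 h mh h0) /fubini_G.
apply: (@le_trans _ _ (\int[lebesgue_measure]_(s in I)
    (l2norm leb Omega (F^~ s) * (Num.sqrt S)%:E))%E).
  rewrite [leRHS]integral_mkcond; apply: ge0_le_integral => //.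
  - by move=> s _; exact: integral_ge0.
  - exact: measurable_fun_fubini_tonelli_G.
  - apply/(measurable_restrictT _ mI); apply: emeasurable_funM => //.
  move=> s _; rewrite [leRHS]/patch; case: ifPn => [/set_mem Is|nIs]; last first.
    rewrite integral0_eq// => x _; rewrite /h /patch in_setX /= (negbTE nIs) andbF.
    by rewrite normr0.
  have sab : a < s < b by move: Is; rewrite /= in_itv.
  have mFs := (measurable_restrictT _ mO).1 (measurable_section mF sab).
  have mGs := (measurable_restrictT _ mO).1 (measurable_section mG sab).
  rewrite (eq_integral (fun x => `|(EFin \o ((F^~ s \_ Omega) \* (G^~ s \_ Omega))%R) x|)%E); last first.
    move=> x _; rewrite /h /= /patch in_setX /= (mem_set Is) andbT.
    by case: ifPn => // _; rewrite mul0r.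
  rewrite -Lnorm1; apply: (le_trans (hoelder leb mFs mGs (ltr0n _ 2) (ltr0n _ 2) _)).
    by rewrite -[X in _ = X](mulfV (_ : 2 != 0 :> R)) ?pnatr_eq0// mulr_natl mulr2n.
  apply: lee_wpmul2l; first exact: Lnorm_ge0.
  apply: le_sqre; first by rewrite lee_fin.
  by rewrite -EFin_expe sqr_sqrtr//; exact: GS.
rewrite ge0_integralZr//; last by move=> s _; exact: Lnorm_ge0.
by rewrite EFinM lee_wpmul2r.
Qed.

End section_norm.

(** * The scheme on one slab *)

Section slabwise_polynomials.
Context {R : realType} {d : nat}.
Variables (Omega : set 'rV[R]_d) (N : nat) (t : nat -> R).
Hypothesis mO : measurable Omega.
Hypothesis tlt : forall n, (n < N)%N -> t n < t n.+1.
Local Notation leb := (@lebesgue_row R d).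
Local Notation X := 'rV[R]_d.
Implicit Types (u w : X -> R -> R) (Du Dw : X -> R -> X).
Implicit Types (P Q : nat -> X -> {poly R}) (G H : nat -> X -> 'I_d -> {poly R}).

Definition time_poly u P := forall n, (n < N)%N -> forall x s, Omega x ->
  t n < s < t n.+1 -> u x s = (P n x).[s].

Definition time_polyv Du G := forall n, (n < N)%N -> forall x s, Omega x ->
  t n < s < t n.+1 -> Du x s = \row_i (G n x i).[s].

Lemma time_poly_dt u P : time_poly u P -> time_poly (dt u) (fun n x => (P n x)^`()).
Proof. by move=> uP n nN x s Ox st; apply: derive1_poly st => r; exact: uP. Qed.

Lemma time_polyv_dt Du G : time_polyv Du G -> time_polyv (dt Du) (fun n x i => (G n x i)^`()).
Proof.
by move=> uP n nN x s Ox st; apply: (derive1_row_poly (p := G n x) _ st) => r; exact: uP.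
Qed.

Lemma trace_right_poly u P n x : time_poly u P -> (n < N)%N -> Omega x ->
  trace_right u (t n) x = (P n x).[t n].
Proof. by move=> uP nN Ox; apply: lim_right_poly (tlt nN) => s; exact: uP. Qed.

Lemma trace_left_poly u P n x : time_poly u P -> (n < N)%N -> Omega x ->
  trace_left u (t n.+1) x = (P n x).[t n.+1].
Proof. by move=> uP nN Ox; apply: lim_left_poly (tlt nN) => s; exact: uP. Qed.

Lemma trace_right_polyv Du G n x : time_polyv Du G -> (n < N)%N -> Omega x ->
  trace_right Du (t n) x = \row_i (G n x i).[t n].
Proof.
by move=> uP nN Ox; apply: (lim_right_row_poly (p := G n x) _ (tlt nN)) => s; exact: uP.
Qed.

Lemma trace_left_polyv Du G n x : time_polyv Du G -> (n < N)%N -> Omega x ->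
  trace_left Du (t n.+1) x = \row_i (G n x i).[t n.+1].
Proof.
by move=> uP nN Ox; apply: (lim_left_row_poly (p := G n x) _ (tlt nN)) => s; exact: uP.
Qed.

(* The trace at t n from the left, with the initial datum in place of the
   missing trace at t 0. *)
Definition left_value P (v0 : X -> R) n x := if n is n'.+1 then (P n' x).[t n] else v0 x.

Definition left_valuev G (Du0 : X -> X) n x i :=
  if n is n'.+1 then (G n' x i).[t n] else Du0 x ord0 i.

(** What slab n contributes to the form minus the data terms, the load aside. With [left_value], the
    jump at t n and the initial terms have the same shape. *)
Definition slab_form (c delta : R) P G (v0 : X -> R) (Du0 : X -> X) Q H n : R :=
  \int[leb]_(x in Omega) pint (t n) (t n.+1) ((P n x)^`()^`() * (Q n x)^`())
  + \int[leb]_(x in Omega)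
      (((P n x)^`().[t n] - left_value (fun n x => (P n x)^`()) v0 n x) * (Q n x)^`().[t n])
  + delta * \int[leb]_(x in Omega) pint (t n) (t n.+1) ((P n x)^`() * (Q n x)^`())
  + c ^+ 2 * \sum_(i < d) \int[leb]_(x in Omega) pint (t n) (t n.+1) (G n x i * (H n x i)^`())
  + c ^+ 2 * \sum_(i < d) \int[leb]_(x in Omega)
      (((G n x i).[t n] - left_valuev G Du0 n x i) * (H n x i).[t n]).

Variables (k : nat) (c delta : R) (f : X -> R -> R) (Du0 : X -> X) (v0 : X -> R).
Hypotheses (N0 : (0 < N)%N) (t0 : t 0%N = 0).
Hypotheses (lv0 : L2 leb Omega v0) (lDu0 : L2v leb Omega Du0).

Lemma L2_left_value P n : (forall n, (n < N)%N -> L2poly Omega k (P n)) -> (n < N)%N ->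
  L2 leb Omega (left_value P v0 n).
Proof.
case: n => [_ _|n lP nN]; first exact: lv0.
by apply: L2poly_horner (lP n _) => //; exact: ltnW.
Qed.

Lemma L2_left_valuev G n i : (forall n, (n < N)%N -> L2poly Omega k (fun x => G n x i)) -> (n < N)%N ->
  L2 leb Omega (fun x => left_valuev G Du0 n x i).
Proof.
case: n => [_ _|n lP nN]; first exact: lDu0.
by apply: L2poly_horner (lP n _) => //; exact: ltnW.
Qed.

(** Moving the initial data of [lform] to the left-hand side completes the traces at 0 to a jump, so
    that slab 0 looks like all others. *)
Lemma Bform_slabs u Du w Dw P G Q H :
  time_poly u P -> time_polyv Du G -> time_poly w Q -> time_polyv Dw H ->
  (forall n, (n < N)%N -> L2poly Omega k (P n)) ->
  (forall n i, (n < N)%N -> L2poly Omega k (fun x => G n x i)) ->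
  (forall n, (n < N)%N -> L2poly Omega k (Q n)) ->
  (forall n i, (n < N)%N -> L2poly Omega k (fun x => H n x i)) ->
  Bform Omega N t c delta u Du w Dw - lform Omega N t c f Du0 v0 w Dw =
  \sum_(n < N) slab_form c delta P G v0 Du0 Q H n
  - \sum_(n < N) ip (@leb_xt R d) (slab Omega t n) (xt f) (xt (dt w)).
Proof.
move=> uP DuG wQ DwH lP lG lQ lH.
have duP := time_poly_dt uP; have dduP := time_poly_dt duP; have dwQ := time_poly_dt wQ.
have dDwH := time_polyv_dt DwH.
have lP' n : (n < N)%N -> L2poly Omega k (fun x => (P n x)^`()).
  by move=> nN; exact: (L2poly_deriv mO (lP n nN)).
have lQ' n : (n < N)%N -> L2poly Omega k (fun x => (Q n x)^`()).
  by move=> nN; exact: (L2poly_deriv mO (lQ n nN)).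
have lH' n i : (n < N)%N -> L2poly Omega k (fun x => (H n x i)^`()).
  by move=> nN; exact: (L2poly_deriv mO (lH n i nN)).
have jumpE n : (0 < n < N)%N ->
    ip leb Omega (jump (dt u) (t n)) (trace_right (dt w) (t n)) =
    \int[leb]_(x in Omega)
      (((P n x)^`().[t n] - left_value (fun n x => (P n x)^`()) v0 n x) * (Q n x)^`().[t n]).
  case: n => //= n nN; apply: eq_Rintegral => x /set_mem Ox.
  rewrite /jump (trace_right_poly duP)// (trace_left_poly duP) ?(ltnW nN)//.
  by rewrite (trace_right_poly dwQ).
have jumpvE n : (0 < n < N)%N ->
    ipv leb Omega (jump Du (t n)) (trace_right Dw (t n)) =
    \sum_(i < d) \int[leb]_(x in Omega)
      (((G n x i).[t n] - left_valuev G Du0 n x i) * (H n x i).[t n]).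
  move=> /andP[n0 nN]; rewrite -Rintegral_sum//; last first.
    move=> i; apply: L2_mul_integrable => //; last exact: (L2poly_horner mO _ (lH n i nN)).
    have h1 := L2poly_horner mO (t n) (lG n i nN).
    have h2 := L2Z mO (-1) (@L2_left_valuev G n i (fun n nN => lG n i nN) nN).
    by apply: (L2_eq mO _ (L2D mO h1 h2)) => x _; rewrite mulN1r.
  apply: eq_Rintegral => x /set_mem Ox.
  case: n n0 nN => //= n _ nN.
  rewrite /jump (trace_right_polyv DuG)// (trace_left_polyv DuG) ?(ltnW nN)//.
  rewrite (trace_right_polyv DwH)//; apply: eq_bigr => i _; by rewrite !mxE.
have j0E : ip leb Omega (trace_right (dt u) 0) (trace_right (dt w) 0)
    - ip leb Omega v0 (trace_right (dt w) 0) =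
    \int[leb]_(x in Omega)
      (((P 0%N x)^`().[t 0%N] - left_value (fun n x => (P n x)^`()) v0 0%N x) * (Q 0%N x)^`().[t 0%N]).
  have l1 := L2poly_horner mO (t 0%N) (lP' 0%N N0).
  have l2 := L2poly_horner mO (t 0%N) (lQ' 0%N N0).
  under [RHS]eq_Rintegral do rewrite mulrBl.
  rewrite RintegralB//; [|exact: L2_mul_integrable|exact: L2_mul_integrable].
  rewrite -t0; congr (_ - _); apply: eq_Rintegral => x /set_mem Ox.
    by rewrite (trace_right_poly duP)// (trace_right_poly dwQ).
  by rewrite (trace_right_poly dwQ).
have j0vE : ipv leb Omega (trace_right Du 0) (trace_right Dw 0)
    - ipv leb Omega Du0 (trace_right Dw 0) =
    \sum_(i < d) \int[leb]_(x in Omega)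
      (((G 0%N x i).[t 0%N] - left_valuev G Du0 0%N x i) * (H 0%N x i).[t 0%N]).
  have -> : trace_right Du 0 = trace_right Du (t 0%N) by rewrite t0.
  have -> : trace_right Dw 0 = trace_right Dw (t 0%N) by rewrite t0.
  have l1 i := L2poly_horner mO (t 0%N) (lG 0%N i N0).
  have l2 i := L2poly_horner mO (t 0%N) (lH 0%N i N0).
  transitivity (\sum_(i < d) (\int[leb]_(x in Omega) ((G 0%N x i).[t 0%N] * (H 0%N x i).[t 0%N])
      - \int[leb]_(x in Omega) (Du0 x ord0 i * (H 0%N x i).[t 0%N]))); last first.
    apply: eq_bigr => i _; under [RHS]eq_Rintegral do rewrite mulrBl.
    by rewrite RintegralB//; apply: L2_mul_integrable => //; exact: lDu0.
  rewrite big_split/= sumrN -!Rintegral_sum//.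
  - congr (_ - _); apply: eq_Rintegral => x /set_mem Ox.
      rewrite (trace_right_polyv DuG)// (trace_right_polyv DwH)//.
      by apply: eq_bigr => i _; rewrite !mxE.
    rewrite (trace_right_polyv DwH)//.
    by apply: eq_bigr => i _; rewrite !mxE.
  - by move=> i; apply: L2_mul_integrable => //; exact: lDu0.
  - by move=> i; exact: L2_mul_integrable.
have e1 : \sum_(n < N) ip (@leb_xt R d) (slab Omega t n) (xt (dt (dt u))) (xt (dt w)) =
    \sum_(n < N) \int[leb]_(x in Omega) pint (t n) (t n.+1) ((P n x)^`()^`() * (Q n x)^`()).
  apply: eq_bigr => n _; apply: (slab_ip mO (tlt (ltn_ord n)) (n := k) (n' := k)).
  - exact: (L2poly_deriv mO (lP' n (ltn_ord n))).
  - exact: lQ'.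
  - exact: dduP.
  - exact: dwQ.
have e2 : \sum_(n < N) ip (@leb_xt R d) (slab Omega t n) (xt (dt u)) (xt (dt w)) =
    \sum_(n < N) \int[leb]_(x in Omega) pint (t n) (t n.+1) ((P n x)^`() * (Q n x)^`()).
  apply: eq_bigr => n _; apply: (slab_ip mO (tlt (ltn_ord n)) (n := k) (n' := k)).
  - exact: lP'.
  - exact: lQ'.
  - exact: duP.
  - exact: dwQ.
have e3 : \sum_(n < N) ipv (@leb_xt R d) (slab Omega t n) (xt Du) (xt (dt Dw)) =
    \sum_(n < N) \sum_(i < d) \int[leb]_(x in Omega) pint (t n) (t n.+1) (G n x i * (H n x i)^`()).
  apply: eq_bigr => n _.
  apply: (slab_ipv mO (tlt (ltn_ord n)) (n := k) (n' := k) (Q := fun x i => (H n x i)^`())).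
  - by move=> i; exact: lG.
  - by move=> i; exact: lH'.
  - exact: DuG.
  - exact: dDwH.
pose J n := \int[leb]_(x in Omega)
  (((P n x)^`().[t n] - left_value (fun n x => (P n x)^`()) v0 n x) * (Q n x)^`().[t n]).
pose Jv n := \sum_(i < d) \int[leb]_(x in Omega)
  (((G n x i).[t n] - left_valuev G Du0 n x i) * (H n x i).[t n]).
have e4 : \sum_(1 <= n < N) ip leb Omega (jump (dt u) (t n)) (trace_right (dt w) (t n)) =
    \sum_(1 <= n < N) J n.
  by apply: eq_big_nat => n nN; exact: jumpE.
have e5 : \sum_(1 <= n < N) ipv leb Omega (jump Du (t n)) (trace_right Dw (t n)) =
    \sum_(1 <= n < N) Jv n.
  by apply: eq_big_nat => n nN; exact: jumpvE.
have sJ : \sum_(n < N) J n = J 0%N + \sum_(1 <= n < N) J n.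
  by rewrite -(big_mkord xpredT J) big_ltn.
have sJv : \sum_(n < N) Jv n = Jv 0%N + \sum_(1 <= n < N) Jv n.
  by rewrite -(big_mkord xpredT Jv) big_ltn.
rewrite /slab_form !big_split/= -!mulr_sumr -/J.
rewrite /Bform /lform e1 e2 e3 e4 e5.
move: j0E j0vE; rewrite -/(J 0%N) -/(Jv 0%N).
move: sJ sJv; rewrite {1}/J {1}/Jv => -> ->.
move: (J 0%N) (Jv 0%N) => J0 J0v <- <-; ring.
Qed.

End slabwise_polynomials.

(** * Localisation of the scheme to one slab *)

Section slab_equations.
Context {R : realType} {d : nat}.
Variables (Omega : set 'rV[R]_d) (T : R) (N : nat) (t : nat -> R).
Variables (p q m : nat) (V : 'I_m -> 'I_d.+1 -> 'rV[R]_d).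
Hypothesis oO : open Omega.
Hypothesis part : time_partition T N t.
Local Notation leb := (@lebesgue_row R d).
Local Notation X := 'rV[R]_d.

Let mO : measurable Omega. Proof. exact: open_measurable_row. Qed.
Let N0 : (0 < N)%N. Proof. by case: part. Qed.
Let t0 : t 0%N = 0. Proof. by case: part. Qed.
Let tlt n : (n < N)%N -> t n < t n.+1. Proof. by case: part => _ _ _; exact. Qed.

Lemma time_partition_le i j : (i <= j <= N)%N -> t i <= t j.
Proof.
elim: j => [|j IH]; first by rewrite leqn0 => /andP[/eqP->].
rewrite leq_eqVlt => /andP[/orP[/eqP->//|ij] jN].
by apply: le_trans (IH _) (ltW (tlt jN)); rewrite -ltnS ij ltnW.
Qed.

Lemma slab_disjoint n n' s : (n < N)%N -> (n' < N)%N -> n' != n ->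
  t n' < s < t n'.+1 -> (t n < s < t n.+1) = false.
Proof.
move=> nN n'N; rewrite neq_ltn => /orP[] h /andP[s1 s2]; apply/negbTE; rewrite negb_and -!leNgt.
  by rewrite (le_trans (ltW s2))// time_partition_le// h ltnW.
by rewrite (le_trans _ (ltW s1)) ?orbT// time_partition_le// h ltnW.
Qed.

Definition preserves_degree k (W : {poly R} -> {poly R}) :=
  linear W /\ forall r : {poly R}, (size r <= k)%N -> (size (W r) <= k)%N.

(** W touches the time variable only: the new coefficients are the same linear combinations of the
    spatial functions and of their gradients. Cutting off by 0 outside the slab is admissible
    because nothing links neighbouring slabs. *)
Lemma Vdisc_poly (u : X -> R -> R) (Du : X -> R -> X) : Vdisc Omega N t p q V u Du ->
  exists (P : nat -> X -> {poly R}) (G : nat -> X -> 'I_d -> {poly R}),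
  [/\ time_poly Omega N t u P, time_polyv Omega N t Du G,
      forall n, (n < N)%N -> L2poly Omega q.+1 (P n),
      forall n i, (n < N)%N -> L2poly Omega q.+1 (fun x => G n x i)
    & forall n W, (n < N)%N -> preserves_degree q.+1 W ->
      Vdisc Omega N t p q V
        (fun x s => if t n < s < t n.+1 then (W (P n x)).[s] else 0)
        (fun x s => if t n < s < t n.+1 then \row_i (W (G n x i)).[s] else 0)].
Proof.
move=> uV.
have /choice[vg Hvg] : forall n, exists vg : ('I_q.+1 -> X -> R) * ('I_q.+1 -> X -> X),
    (n < N)%N -> (forall k, Vh Omega p V (vg.1 k) (vg.2 k)) /\
    forall x s, Omega x -> t n < s < t n.+1 ->
      u x s = \sum_(k < q.+1) s ^+ k * vg.1 k x /\
      Du x s = \sum_(k < q.+1) s ^+ k *: vg.2 k x.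
  move=> n; have [nN|nN] := boolP (n < N)%N; last by exists (fun _ _ => 0, fun _ _ => 0).
  by have [v [g h]] := uV n nN; exists (v, g).
pose P n x := \poly_(k < q.+1) (vg n).1 (inord k) x.
pose G n x i := \poly_(k < q.+1) ((vg n).2 (inord k) x) ord0 i.
exists P, G.
have coP n x (k : 'I_q.+1) : (P n x)`_k = (vg n).1 k x.
  by rewrite coef_poly ltn_ord inord_val.
have coG n x i (k : 'I_q.+1) : (G n x i)`_k = (vg n).2 k x ord0 i.
  by rewrite coef_poly ltn_ord inord_val.
have sP n x : (size (P n x) <= q.+1)%N by exact: size_poly.
have sG n x i : (size (G n x i) <= q.+1)%N by exact: size_poly.
split.
- move=> n nN x s Ox st; have [_ h] := Hvg n nN; rewrite (h _ _ Ox st).1.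
  rewrite (horner_coef_wide _ (sP n x)); apply: eq_bigr => k _.
  by rewrite coP mulrC.
- move=> n nN x s Ox st; have [_ h] := Hvg n nN; rewrite (h _ _ Ox st).2.
  apply/rowP => i; rewrite summxE mxE (horner_coef_wide _ (sG n x i)).
  by apply: eq_bigr => k _; rewrite coG !mxE mulrC.
- move=> n nN; split => // i; have [h _] := Hvg n nN.
  have [iq|iq] := ltnP i q.+1; last first.
    apply: (L2_eq mO _ (L2_0 leb Omega)) => x _; by rewrite nth_default// (leq_trans (sP n x)).
  have [[[lv _ _] _] _] := h (Ordinal iq).
  by apply: (L2_eq mO _ lv) => x _; rewrite -coP.
- move=> n i nN; split => // j; have [h _] := Hvg n nN.
  have [jq|jq] := ltnP j q.+1; last first.
    apply: (L2_eq mO _ (L2_0 leb Omega)) => x _; by rewrite nth_default// (leq_trans (sG n x i)).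
  have [[[_ lg _] _] _] := h (Ordinal jq).
  by apply: (L2_eq mO _ (lg i)) => x _; rewrite -coG.
move=> n W nN [linW sW] n' n'N; have [h _] := Hvg n nN.
(* Indicator of the chosen slab; on the others the representation required by [Vdisc] has zero
   coefficients. *)
pose e : R := (n' == n)%:R.
exists (fun k x => \sum_(j < q.+1) (e * (W 'X^j)`_k) * (vg n).1 j x).
exists (fun k x => \sum_(j < q.+1) (e * (W 'X^j)`_k) *: (vg n).2 j x).
split; first by move=> k; exact: Vh_sum.
move=> x s Ox st; rewrite /e; have [nn|nn] := eqVneq n' n; last first.
  rewrite (slab_disjoint nN n'N nn st); split.
    rewrite big1// => k _; rewrite big1 ?mulr0// => j _; by rewrite !mul0r.
  rewrite big1// => k _; rewrite big1 ?scaler0// => j _; by rewrite mul0r scale0r.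
rewrite -nn st; split.
  rewrite (horner_coef_wide _ (sW _ (sP n' x))); apply: eq_bigr => k _.
  rewrite mulrC (linear_poly_expand linW (sP n' x)) coef_sum; congr (_ * _).
  by apply: eq_bigr => j _; rewrite coefZ coP mul1r mulrC nn.
apply/rowP => i; rewrite summxE mxE (horner_coef_wide _ (sW _ (sG n' x i))).
apply: eq_bigr => k _; rewrite !mxE mulrC summxE (linear_poly_expand linW (sG n' x i)) coef_sum.
by congr (_ * _); apply: eq_bigr => j _; rewrite coefZ coG !mxE mul1r mulrC nn.
Qed.

Variables (c delta : R) (f : X -> R -> R) (Du0 : X -> X) (v0 : X -> R).
Hypotheses (lv0 : L2 leb Omega v0) (lDu0 : L2v leb Omega Du0).

(** The form sees the test function at a node only through its trace from the right, so one
    supported in slab n meets no jump but the one at t n. *)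
Lemma slab_equation (u : X -> R -> R) (Du : X -> R -> X) : Vdisc Omega N t p q V u Du ->
  (forall (w : X -> R -> R) (Dw : X -> R -> X), Vdisc Omega N t p q V w Dw ->
    Bform Omega N t c delta u Du w Dw = lform Omega N t c f Du0 v0 w Dw) ->
  exists (P : nat -> X -> {poly R}) (G : nat -> X -> 'I_d -> {poly R}),
  [/\ time_poly Omega N t u P, time_polyv Omega N t Du G,
      forall n, (n < N)%N -> L2poly Omega q.+1 (P n),
      forall n i, (n < N)%N -> L2poly Omega q.+1 (fun x => G n x i)
    & forall n W, (n < N)%N -> preserves_degree q.+1 W ->
      slab_form Omega t c delta P G v0 Du0 (fun n x => W (P n x)) (fun n x i => W (G n x i)) n
      = ip (@leb_xt R d) (slab Omega t n) (xt f) (xt (fun x s => (W (P n x))^`().[s]))].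
Proof.
move=> uV eqB; have [P [G [uP DuG lP lG wV]]] := Vdisc_poly uV.
exists P, G; split => // n W nN pW.
have [linW sW] := pW.
pose w (x : X) (s : R) := if t n < s < t n.+1 then (W (P n x)).[s] else 0.
pose Dw (x : X) (s : R) : X := if t n < s < t n.+1 then \row_i (W (G n x i)).[s] else 0.
pose Q n' x := if n' == n then W (P n x) else 0.
pose H n' x i := if n' == n then W (G n x i) else 0.
have wQ : time_poly Omega N t w Q.
  move=> n' n'N x s Ox st; rewrite /w /Q; have [<-|nn] := eqVneq n' n; first by rewrite st.
  by rewrite (slab_disjoint nN n'N nn st) horner0.
have DwH : time_polyv Omega N t Dw H.
  move=> n' n'N x s Ox st; rewrite /Dw /H; have [<-|nn] := eqVneq n' n; first by rewrite st.
  by rewrite (slab_disjoint nN n'N nn st); apply/rowP => i; rewrite !mxE horner0.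
have lQ n' : (n' < N)%N -> L2poly Omega q.+1 (Q n').
  move=> n'N; rewrite /Q; case: (n' == n); last exact: L2poly0.
  exact: (L2poly_linear mO linW sW (lP n nN)).
have lH n' i : (n' < N)%N -> L2poly Omega q.+1 (fun x => H n' x i).
  move=> n'N; rewrite /H; case: (n' == n); last exact: L2poly0.
  exact: (L2poly_linear mO linW sW (lG n i nN)).
have := Bform_slabs mO tlt c delta f N0 t0 lv0 lDu0 uP DuG wQ DwH lP lG lQ lH.
rewrite eqB; last exact: (wV n W nN pW).
rewrite subrr => /esym/eqP; rewrite subr_eq0 => /eqP.
rewrite (bigD1 (Ordinal nN))//= big1 ?addr0; last first.
  move=> i; rewrite -val_eqE /= => ni; rewrite /slab_form /Q /H (negbTE ni).
  rewrite !deriv0.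
  have z1 g : \int[leb]_(x in Omega) pint (t i) (t i.+1) (g x * 0) = 0.
    by under eq_Rintegral do rewrite mulr0 linear0; rewrite Rintegral_cst// mul0r.
  have z2 (g : X -> R) : \int[leb]_(x in Omega) (g x * (0 : {poly R}).[t i]) = 0.
    by under eq_Rintegral do rewrite horner0 mulr0; rewrite Rintegral_cst// mul0r.
  rewrite !z1 z2 big1; last by move=> j _; exact: z1.
  rewrite big1; last by move=> j _; exact: z2.
  by rewrite !mulr0 !addr0.
rewrite (_ : slab_form _ _ _ _ _ _ _ _ Q H n = slab_form Omega t c delta P G v0 Du0
  (fun n x => W (P n x)) (fun n x i => W (G n x i)) n); last first.
  by rewrite /slab_form /Q /H eqxx.
move=> ->.
rewrite (bigD1 (Ordinal nN))//= [X in _ + X]big1 ?addr0; last first.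
  move=> i; rewrite -val_eqE /= => ni.
  rewrite /ip (@eq_Rintegral _ _ _ _ _ (fun=> 0)).
    by rewrite Rintegral_cst ?mul0r//; apply: measurableX => //; exact: measurable_itv.
  move=> [x s] /set_mem[/= Ox]; rewrite in_itv/= => st.
  by rewrite /xt /= (time_poly_dt wQ (ltn_ord i) Ox st) /Q (negbTE ni) deriv0 horner0 mulr0.
apply: eq_Rintegral => -[x s] /set_mem[/= Ox]; rewrite in_itv/= => st.
by rewrite /xt /= (time_poly_dt wQ nN Ox st) /Q eqxx.
Qed.

End slab_equations.

(** * Energy estimates *)

Section energy_identities.
Context {R : realType} {d : nat}.
Variable Omega : set 'rV[R]_d.
Hypothesis mO : measurable Omega.
Local Notation leb := (@lebesgue_row R d).
Local Notation X := 'rV[R]_d.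
Implicit Types (P Q : X -> {poly R}) (v : X -> R).
Variables (a b : R) (k : nat).

Lemma L2B (f g : X -> R) : L2 leb Omega f -> L2 leb Omega g ->
  L2 leb Omega (fun x => f x - g x).
Proof.
move=> lf lg; apply: (L2_eq mO _ (L2D mO lf (L2Z mO (-1) lg))) => x _.
by rewrite mulN1r.
Qed.

Lemma L2_sqr_integrable (f : X -> R) : L2 leb Omega f ->
  leb.-integrable Omega (EFin \o (fun x => f x ^+ 2)).
Proof. by move=> /sqr_integrableP[]. Qed.

Lemma pint_mul_integrable P Q : L2poly Omega k P -> L2poly Omega k Q ->
  leb.-integrable Omega (EFin \o (fun x => pint a b (P x * Q x))).
Proof. by move=> lP lQ; exact: pint_integrable (L2poly_mul mO lP lQ). Qed.

(** With y the value at the left end, (y - v) y is half of y^2 - v^2 + (y - v)^2, and the y^2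
    cancels against the integral of P'P. It is used for u' and for each component of the
    gradient. *)
Lemma energy_identity P v : L2poly Omega k P -> L2 leb Omega v ->
  \int[leb]_(x in Omega) pint a b ((P x)^`() * P x)
  + \int[leb]_(x in Omega) (((P x).[a] - v x) * (P x).[a]) =
  2^-1 * \int[leb]_(x in Omega) (P x).[b] ^+ 2
  - 2^-1 * \int[leb]_(x in Omega) v x ^+ 2
  + 2^-1 * \int[leb]_(x in Omega) ((P x).[a] - v x) ^+ 2.
Proof.
move=> lP lv.
have lPa := L2poly_horner mO a lP; have lPb := L2poly_horner mO b lP.
have lJ := L2B lPa lv.
have i1 := pint_mul_integrable (L2poly_deriv mO lP) lP.
have i2 := L2_mul_integrable mO lJ lPa.
have Z (f : X -> R) (i : leb.-integrable Omega (EFin \o f)) :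
    leb.-integrable Omega (EFin \o (fun x => 2^-1 * f x)) by exact: (integrableZl mO 2^-1 i).
have i3 := Z _ (L2_sqr_integrable lPb); have i4 := Z _ (L2_sqr_integrable lv).
have i5 := Z _ (L2_sqr_integrable lJ).
rewrite -RintegralD// -!RintegralZl//; try exact: L2_sqr_integrable.
rewrite -RintegralB// -RintegralD//; last exact: (integrableB mO i3 i4).
by apply: eq_Rintegral => x _; rewrite pint_half_sqr; field.
Qed.

Lemma le_slab_integral (A B D : X -> R) v (k1 k2 : R) :
  leb.-integrable Omega (EFin \o A) -> leb.-integrable Omega (EFin \o B) ->
  leb.-integrable Omega (EFin \o D) -> L2 leb Omega v ->
  (forall x, k1 * D x - k2 * v x ^+ 2 <= A x + B x) ->
  k1 * \int[leb]_(x in Omega) D x - k2 * \int[leb]_(x in Omega) v x ^+ 2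
  <= \int[leb]_(x in Omega) A x + \int[leb]_(x in Omega) B x.
Proof.
move=> iA iB iD lv h; have iv := L2_sqr_integrable lv.
rewrite -!RintegralZl// -RintegralB//; [|exact: (integrableZl mO k1 iD)|exact: (integrableZl mO k2 iv)].
rewrite -RintegralD//; apply: le_Rintegral => //.
- exact: (integrableB mO (integrableZl mO k1 iD) (integrableZl mO k2 iv)).
- exact: (integrableD mO iA iB).
Qed.

Lemma le_integral_sup_poly P Q s (K : R) : L2poly Omega k P -> L2poly Omega k Q ->
  (forall x, (Q x).[s] ^+ 2 <= K * pint a b (P x * P x)) ->
  \int[leb]_(x in Omega) (Q x).[s] ^+ 2 <= K * \int[leb]_(x in Omega) pint a b (P x * P x).
Proof.
move=> lP lQ h; have i := pint_mul_integrable lP lP.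
rewrite -RintegralZl//; apply: le_Rintegral => //.
- by apply: L2_sqr_integrable; exact: (L2poly_horner mO s lQ).
- exact: (integrableZl mO K i).
Qed.

Lemma l2norm_eucl (g : X -> X) : L2v leb Omega g ->
  (l2norm leb Omega (fun x => eucl (g x)) ^+ 2 =
   (\sum_(i < d) \int[leb]_(x in Omega) (g x ord0 i) ^+ 2)%:E)%E.
Proof.
move=> lg; rewrite l2norm_sqr -Rintegral_sum//; last by move=> i; exact: L2_sqr_integrable.
rewrite /Rintegral fineK; first by apply: eq_integral => x _; rewrite eucl_sqr.
apply: integrable_fin_num => //.
rewrite (_ : (fun x => _) = (fun x => \sum_(i < d) (EFin \o (fun x => (g x ord0 i ^+ 2)%R)) x)%E).
  by apply: integrable_sum => // i _; exact: L2_sqr_integrable.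
by apply/funext => x; rewrite sumEFin.
Qed.

Lemma measurable_slab_poly Q : L2poly Omega k Q ->
  measurable_fun (Omega `*` (`]a, b[%classic : set (measurableTypeR R)))
    (xt (fun x s => (Q x).[s])).
Proof.
move=> [sQ lQ]; set D := _ `*` _.
have mI : measurable (`]a, b[%classic : set (measurableTypeR R)) by exact: measurable_itv.
have mD : measurable D by exact: measurableX.
apply: (@eq_measurable_fun _ _ _ _ D (fun z => \sum_(i < k) (Q z.1)`_i * (z.2 : R) ^+ i)).
  by move=> z _; rewrite /xt (horner_coef_wide _ (sQ _)).
apply: measurable_sum => i; apply: measurable_funM.
  have [mQ _] := lQ i; apply: (measurable_comp mO _ mQ) => //.
    by move=> _ [z [Oz _] <-].
  exact: measurable_funTS measurable_fst.
apply: measurable_funX; exact: measurable_funTS measurable_snd.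
Qed.

End energy_identities.

(** All loads are measured against the single number [s], the root of K times the largest slab mean.
    Summing the first recursion bounds every energy by E 0 + F s; the second then bounds the maximum
    by a term linear in its own root, which Young's inequality absorbs. *)
Lemma energy_bound {R : realType} (M K F : R) N (E D H S f : nat -> R) :
  0 <= M -> 0 < K -> (forall n, 0 <= f n) -> 0 <= E 0%N ->
  (forall n, 0 <= D n) -> (forall n, (n < N)%N -> 0 <= H n) -> \sum_(n < N) f n <= F ->
  (forall n, (n < N)%N -> E n.+1 + D n + H n <= E n + f n * Num.sqrt (K * S n)) ->
  (forall n, (n < N)%N -> 4^-1 * S n <= (M + 1) * E n + f n * Num.sqrt (K * S n)) ->
  let C1 := 8 * (M + 1) + 16 * (M + 2) ^+ 2 * K in
  (forall n, (n < N)%N -> S n <= C1 * (E 0%N + F ^+ 2)) /\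
  E N + \sum_(n < N) (D n + H n) <= (1 + K * C1) * (E 0%N + F ^+ 2).
Proof.
move=> M0 K0 f0 E0 D0 H0 fF h1 h2 C1.
pose Sm := \big[Num.max/0]_(n < N) S n.
have Sm0 : 0 <= Sm by exact: bigmax_ge_id.
have SSm n : (n < N)%N -> S n <= Sm.
  by move=> nN; rewrite /Sm (le_bigmax _ (fun n : 'I_N => S n) (Ordinal nN)).
pose s := Num.sqrt (K * Sm).
have s0 : 0 <= s by exact: sqrtr_ge0.
have s2 : s ^+ 2 = K * Sm by rewrite sqr_sqrtr// mulr_ge0// ltW.
have sS n : (n < N)%N -> f n * Num.sqrt (K * S n) <= f n * s.
  by move=> nN; rewrite ler_wpM2l// ler_wsqrtr// ler_pM2l// SSm.
have En n : (n <= N)%N -> E n + \sum_(i < n) (D i + H i) <= E 0%N + (\sum_(i < n) f i) * s.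
  elim: n => [|n IH] nN; first by rewrite !big_ord0 mul0r.
  rewrite !big_ord_recr/= mulrDl.
  by have := IH (ltnW nN); have := h1 n nN; have := sS n nN; lra.
have F0 : 0 <= F by apply: le_trans fF; apply: sumr_ge0.
have Fn n : (n <= N)%N -> \sum_(i < n) f i <= F.
  move=> nN; apply: le_trans fF.
  rewrite -!(big_mkord xpredT f) [leRHS](@big_cat_nat _ _ _ n)//= lerDl.
  by apply: sumr_ge0.
have En' n : (n <= N)%N -> E n + \sum_(i < n) (D i + H i) <= E 0%N + F * s.
  by move=> nN; apply: (le_trans (En n nN)); rewrite lerD2l ler_wpM2r// Fn.
have fFs n : (n < N)%N -> f n * s <= F * s.
  move=> nN; rewrite ler_wpM2r//; apply: le_trans (Fn n.+1 nN).
  by rewrite big_ord_recr/= lerDr; apply: sumr_ge0.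
(* One more F s comes from the load on the slab itself, which turns M + 1 into M + 2. *)
have Sn n : (n < N)%N -> S n <= 4 * (M + 1) * E 0%N + 4 * (M + 2) * (F * s).
  move=> nN; have a1 := h2 n nN; have a2 := sS n nN; have a3 := fFs n nN.
  have a4 := En' n (ltnW nN).
  have a5 : 0 <= \sum_(i < n) (D i + H i) by apply: sumr_ge0 => i _; rewrite addr_ge0 ?H0// (ltn_trans (ltn_ord i)).
  have : (M + 1) * E n <= (M + 1) * (E 0%N + F * s).
    by rewrite ler_wpM2l ?addr_ge0//; lra.
  nra.
have Smle : Sm <= 4 * (M + 1) * E 0%N + 4 * (M + 2) * (F * s).
  apply: bigmax_le => [|i _]; last exact: Sn.
  by rewrite addr_ge0// !mulr_ge0// ?addr_ge0.
have Sm1 : Sm <= C1 * (E 0%N + F ^+ 2).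
  (* Young's inequality with half of the maximum on the right; absorbing it doubles the remaining
     terms, which gives [C1]. *)
  have : 4 * (M + 2) * (F * s) <= 2^-1 * Sm + 8 * (M + 2) ^+ 2 * K * F ^+ 2.
    have -> : Sm = s ^+ 2 / K by rewrite s2 mulrC mulKf// gt_eqF.
    have -> : 2^-1 * (s ^+ 2 / K) + 8 * (M + 2) ^+ 2 * K * F ^+ 2 =
      4 * (M + 2) * (F * s) + (s / K - 4 * (M + 2) * F) ^+ 2 * (K / 2).
      by field; rewrite gt_eqF.
    by rewrite lerDl mulr_ge0 ?sqr_ge0// divr_ge0// ltW.
  move=> h; have : Sm <= 8 * (M + 1) * E 0%N + 16 * (M + 2) ^+ 2 * K * F ^+ 2 by lra.
  move=> h'; apply: (le_trans h'); rewrite /C1.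
  have q1 : 0 <= (M + 1) * F ^+ 2 by rewrite mulr_ge0 ?sqr_ge0 ?addr_ge0.
  have q2 : 0 <= (M + 2) ^+ 2 * K * E 0%N by rewrite !mulr_ge0 ?sqr_ge0 ?addr_ge0// ltW.
  nra.
split; first by move=> n nN; exact: le_trans (SSm n nN) Sm1.
apply: (le_trans (En' N (leqnn N))).
have h3 : K * Sm <= K * (C1 * (E 0%N + F ^+ 2)) by rewrite ler_pM2l.
have := sqr_ge0 (F - s); rewrite -s2 in h3.
have q3 := sqr_ge0 F.
rewrite mulrDl mul1r -mulrA; nra.
Qed.

(** * Stability of the slab energies *)

Section stability.
Context {R : realType} {d : nat}.
Variables (Omega : set 'rV[R]_d) (T : R) (N : nat) (t : nat -> R) (q : nat).
Hypothesis mO : measurable Omega.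
Hypothesis part : time_partition T N t.
Local Notation leb := (@lebesgue_row R d).
Local Notation X := 'rV[R]_d.
Variables (c delta : R) (f : X -> R -> R) (Du0 : X -> X) (v0 : X -> R).
Hypotheses (delta0 : 0 < delta).
Hypotheses (lv0 : L2 leb Omega v0) (lDu0 : L2v leb Omega Du0).
Hypothesis mf : measurable_fun (QT Omega T) (xt f).
Variables (P : nat -> X -> {poly R}) (G : nat -> X -> 'I_d -> {poly R}).
Hypothesis lP : forall n, (n < N)%N -> L2poly Omega q.+1 (P n).
Hypothesis lG : forall n i, (n < N)%N -> L2poly Omega q.+1 (fun x => G n x i).
Hypothesis slab_eq : forall n W, (n < N)%N -> preserves_degree q.+1 W ->
  slab_form Omega t c delta P G v0 Du0 (fun n x => W (P n x)) (fun n x i => W (G n x i)) n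
  = ip (@leb_xt R d) (slab Omega t n) (xt f) (xt (fun x s => (W (P n x))^`().[s])).

Let tlt n : (n < N)%N -> t n < t n.+1. Proof. by case: part => _ _ _; exact. Qed.
Let t0 : t 0%N = 0. Proof. by case: part. Qed.
Let tN : t N = T. Proof. by case: part. Qed.

Let z n x := (P n x)^`().
Let zm n := left_value t z v0 n.
Let Um n x i := left_valuev t G Du0 n x i.
Let l2sum (g : X -> 'I_d -> R) := \sum_(i < d) \int[leb]_(x in Omega) (g x i) ^+ 2.

(** Taken at the trace from the left, so that [energy 0] is the energy of the data and [energy N]
    that of the trace at T. *)
Definition energy n :=
  2^-1 * (\int[leb]_(x in Omega) (zm n x) ^+ 2 + c ^+ 2 * l2sum (Um n)).

Definition jump_energy n :=
  2^-1 * (\int[leb]_(x in Omega) ((z n x).[t n] - zm n x) ^+ 2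
          + c ^+ 2 * l2sum (fun x i => (G n x i).[t n] - Um n x i)).

Definition kinetic n := \int[leb]_(x in Omega) pint (t n) (t n.+1) (z n x * z n x).

Definition potential n :=
  \sum_(i < d) \int[leb]_(x in Omega) pint (t n) (t n.+1) (G n x i * G n x i).

Definition slab_energy n := (t n.+1 - t n)^-1 * (kinetic n + c ^+ 2 * potential n).

Let lz n : (n < N)%N -> L2poly Omega q.+1 (z n).
Proof. by move=> nN; exact: (L2poly_deriv mO (lP nN)). Qed.

Let lzm n : (n < N)%N -> L2 leb Omega (zm n).
Proof. by move=> nN; exact: (L2_left_value t mO lv0 lz nN). Qed.

Let lUm n i : (n < N)%N -> L2 leb Omega (fun x => Um n x i).
Proof. by move=> nN; exact: (L2_left_valuev t mO lDu0 (fun n nN => lG i nN) nN). Qed.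

Lemma kinetic_ge0 n : (n < N)%N -> 0 <= kinetic n.
Proof. by move=> nN; apply: Rintegral_ge0 => x _; exact: pint_sqr_ge0 (tlt nN). Qed.

Lemma potential_ge0 n : (n < N)%N -> 0 <= potential n.
Proof.
move=> nN; apply: sumr_ge0 => i _; apply: Rintegral_ge0 => x _; exact: pint_sqr_ge0 (tlt nN).
Qed.

(** The discrete energy balance: the jumps act as numerical dissipation beside the damping. *)
Lemma slab_form_id n : (n < N)%N ->
  slab_form Omega t c delta P G v0 Du0 P G n =
  energy n.+1 - energy n + jump_energy n + delta * kinetic n.
Proof.
move=> nN; rewrite /slab_form -/(kinetic n).
have h1 := energy_identity mO (t n) (t n.+1) (lz nN) (lzm nN).
have h2 : \sum_(i < d) \int[leb]_(x in Omega) pint (t n) (t n.+1) (G n x i * (G n x i)^`())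
    + \sum_(i < d) \int[leb]_(x in Omega) (((G n x i).[t n] - Um n x i) * (G n x i).[t n])
    = 2^-1 * l2sum (Um n.+1) - 2^-1 * l2sum (Um n)
      + 2^-1 * l2sum (fun x i => (G n x i).[t n] - Um n x i).
  rewrite -big_split /l2sum !mulr_sumr -sumrB -big_split/=; apply: eq_bigr => i _.
  rewrite -(energy_identity mO (t n) (t n.+1) (lG i nN) (lUm i nN)); congr (_ + _).
  by apply: eq_Rintegral => x _; rewrite mulrC.
rewrite -addrA -mulrDr h2 h1 /energy /jump_energy; ring.
Qed.

Variables (M K : R).
Hypotheses (M0 : 0 <= M) (K0 : 0 < K).

Hypothesis tests : forall a b, a < b -> exists W, slab_test_spec q M K a b W.

Lemma slab_test_degree a b W : slab_test_spec q M K a b W -> preserves_degree q.+1 W.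
Proof. by move=> [linW h]; split => // p sp; have [] := h p sp. Qed.

Lemma slab_form_test n W : (n < N)%N -> slab_test_spec q M K (t n) (t n.+1) W ->
  4^-1 * slab_energy n - (M + 1) * energy n <=
  slab_form Omega t c delta P G v0 Du0 (fun n x => W (P n x)) (fun n x i => W (G n x i)) n.
Proof.
move=> nN hW; have [linW sW] := slab_test_degree hW; have [_ HW] := hW.
set a := t n; set b := t n.+1.
have lWP : L2poly Omega q.+1 (fun x => W (P n x)) by exact: (L2poly_linear mO linW sW (lP nN)).
have lWG i : L2poly Omega q.+1 (fun x => W (G n x i)).
  exact: (L2poly_linear mO linW sW (lG i nN)).
have lWP' := L2poly_deriv mO lWP; have lWG' i := L2poly_deriv mO (lWG i).
have sP x : (size (P n x) <= q.+1)%N by have [] := lP nN.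
have sG x i : (size (G n x i) <= q.+1)%N by have [] := lG i nN.
have h1 : 4^-1 / (b - a) * kinetic n - (M + 1) / 2 * \int[leb]_(x in Omega) (zm n x) ^+ 2 <=
    \int[leb]_(x in Omega) pint a b ((z n x)^`() * (W (P n x))^`())
    + \int[leb]_(x in Omega) (((z n x).[a] - zm n x) * (W (P n x))^`().[a]).
  apply: (le_slab_integral mO).
  - exact: (pint_mul_integrable mO a b (L2poly_deriv mO (lz nN)) lWP').
  - apply: L2_mul_integrable => //; last exact: (L2poly_horner mO a lWP').
    exact: (L2B mO (L2poly_horner mO a (lz nN)) (lzm nN)).
  - exact: (pint_mul_integrable mO a b (lz nN) (lz nN)).
  - exact: lzm.
  - by move=> x; have [_ h _ _ _] := HW _ (sP x); have := h (zm n x); rewrite mulrA.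
have h2 : 0 <= \int[leb]_(x in Omega) pint a b (z n x * (W (P n x))^`()).
  by apply: Rintegral_ge0 => x _; have [_ _ h _ _] := HW _ (sP x).
have h3 : 4^-1 / (b - a) * potential n - (M + 1) / 2 * l2sum (Um n) <=
    \sum_(i < d) \int[leb]_(x in Omega) pint a b (G n x i * (W (G n x i))^`())
    + \sum_(i < d) \int[leb]_(x in Omega) (((G n x i).[a] - Um n x i) * (W (G n x i)).[a]).
  rewrite /potential /l2sum !mulr_sumr -sumrB -big_split/=; apply: ler_sum => i _.
  apply: (le_slab_integral mO).
  - exact: (pint_mul_integrable mO a b (lG i nN) (lWG' i)).
  - apply: L2_mul_integrable => //; last exact: (L2poly_horner mO a (lWG i)).
    exact: (L2B mO (L2poly_horner mO a (lG i nN)) (lUm i nN)).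
  - exact: (pint_mul_integrable mO a b (lG i nN) (lG i nN)).
  - exact: lUm.
  - by move=> x; have [_ _ _ h _] := HW _ (sG x i); have := h (Um n x i); rewrite mulrA.
rewrite /slab_form -/a -/b -/(z n) -addrA -mulrDr.
have h4 := mulr_ge0 (ltW delta0) h2.
have h5 := ler_wpM2l (sqr_ge0 c) h3.
apply: (le_trans _ (lerD (lerD h1 h4) h5)).
rewrite addr0 /slab_energy /energy -/a -/b le_eqVlt; apply/orP; left; apply/eqP.
by move: ((b - a)^-1) => ?; field.
Qed.

Lemma slab_energy_ge n : (n < N)%N ->
  (t n.+1 - t n)^-1 * kinetic n <= slab_energy n /\
  c ^+ 2 * ((t n.+1 - t n)^-1 * potential n) <= slab_energy n /\ 0 <= slab_energy n.
Proof.
move=> nN; rewrite /slab_energy mulrDr [c ^+ 2 * (_ * _)]mulrCA.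
have tau0 : 0 <= (t n.+1 - t n)^-1 by rewrite invr_ge0 subr_ge0 ltW ?tlt.
have h1 := mulr_ge0 tau0 (kinetic_ge0 nN).
have h2 := mulr_ge0 tau0 (mulr_ge0 (sqr_ge0 c) (potential_ge0 nN)).
by rewrite lerDl lerDr addr_ge0.
Qed.

Lemma slab_sup n W s : (n < N)%N -> slab_test_spec q M K (t n) (t n.+1) W -> t n <= s <= t n.+1 ->
  [/\ \int[leb]_(x in Omega) (W (P n x))^`().[s] ^+ 2 <= K * slab_energy n,
      \int[leb]_(x in Omega) (z n x).[s] ^+ 2 <= K * slab_energy n
    & c ^+ 2 * (\sum_(i < d) \int[leb]_(x in Omega) (G n x i).[s] ^+ 2) <= K * slab_energy n].
Proof.
move=> nN hW sab; have [linW sW] := slab_test_degree hW; have [_ HW] := hW.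
have lWP : L2poly Omega q.+1 (fun x => W (P n x)) by exact: (L2poly_linear mO linW sW (lP nN)).
have sP x : (size (P n x) <= q.+1)%N by have [] := lP nN.
have sG x i : (size (G n x i) <= q.+1)%N by have [] := lG i nN.
have [e1 [e2 _]] := slab_energy_ge nN.
split.
- apply: le_trans (ler_wpM2l (ltW K0) e1); rewrite mulrA.
  apply: (le_integral_sup_poly mO (lz nN) (L2poly_deriv mO lWP)) => x.
  by rewrite -mulrA; have [_ _ _ _ h] := HW _ (sP x); have [] := h s sab.
- apply: le_trans (ler_wpM2l (ltW K0) e1); rewrite mulrA.
  apply: (le_integral_sup_poly mO (lz nN) (lz nN)) => x.
  by rewrite -mulrA; have [_ _ _ _ h] := HW _ (sP x); have [] := h s sab.
apply: le_trans (ler_wpM2l (ltW K0) e2); rewrite mulrCA ler_wpM2l ?sqr_ge0//.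
rewrite /potential !mulr_sumr; apply: ler_sum => i _; rewrite mulrA.
apply: (le_integral_sup_poly mO (lG i nN) (lG i nN)) => x.
by rewrite -mulrA; have [_ _ _ _ h] := HW _ (sG x i); have [] := h s sab.
Qed.

Let g s := l2norm leb Omega (f^~ s).

Let mg : measurable_fun (`]0, T[%classic : set (measurableTypeR R)) g.
Proof. exact: measurable_l2norm_section. Qed.

Let g0 s : (0 <= g s)%E. Proof. exact: Lnorm_ge0. Qed.

Let subI n : (n < N)%N -> `]t n, t n.+1[%classic `<=` `]0, T[%classic.
Proof.
move=> nN s /=; rewrite !in_itv/= => /andP[s1 s2]; apply/andP; split.
  by apply: le_lt_trans s1; rewrite -[X in X <= _]t0; apply: (time_partition_le part); rewrite leq0n ltnW.
by apply: (lt_le_trans s2); rewrite -tN; apply: (time_partition_le part); rewrite nN leqnn.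
Qed.

Lemma sum_slab_integral n : (n <= N)%N ->
  (\sum_(k < n) \int[lebesgue_measure]_(s in `]t k, t k.+1[) g s <=
   \int[lebesgue_measure]_(s in `]0%R, t n[) g s)%E.
Proof.
elim: n => [|n IH] nN; first by rewrite big_ord0 integral_ge0.
have tn0 : 0 <= t n by rewrite -[X in X <= _]t0; apply: (time_partition_le part); rewrite leq0n ltnW.
have sub0 i : (i <= N)%N -> `]0, t i[%classic `<=` `]0, T[%classic.
  move=> iN s /=; rewrite !in_itv/= => /andP[-> s2]; apply: (lt_le_trans s2).
  by rewrite -tN; apply: (time_partition_le part); rewrite iN leqnn.
have msub (A : set R) : A `<=` `]0, T[%classic -> measurable_fun A g.
  by move=> AT; apply: measurable_funS mg.
rewrite big_ord_recr/= (le_trans (leeD2r _ (IH (ltnW nN))))//.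
rewrite -ge0_integral_setU//.
- apply: ge0_subset_integral => //.
  + exact: measurableU.
  + exact: msub (sub0 _ nN).
  + move=> s [] /=; rewrite !in_itv/= => /andP[s1 s2]; apply/andP; split => //.
      exact: lt_trans s2 (tlt nN).
    exact: le_lt_trans s1.
- apply: msub => s [|]; first exact: sub0 (ltnW nN) s.
  exact: subI.
- apply/disj_setPS => s /= []; rewrite !in_itv/= => /andP[_ s2] /andP[s1 _].
  by have := lt_trans s1 s2; rewrite ltxx.
Qed.

Lemma stability_bound (F : R) :
  (\int[lebesgue_measure]_(s in `]0%R, T[) g s <= F%:E)%E ->
  let C1 := 8 * (M + 1) + 16 * (M + 2) ^+ 2 * K in
  (forall n, (n < N)%N -> slab_energy n <= C1 * (energy 0%N + F ^+ 2)) /\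
  energy N + \sum_(n < N) (jump_energy n + delta * kinetic n)
  <= (1 + K * C1) * (energy 0%N + F ^+ 2).
Proof.
move=> gF.
pose fn n := fine (\int[lebesgue_measure]_(s in `]t n, t n.+1[) g s)%E.
have fn0 n : 0 <= fn n by rewrite fine_ge0// integral_ge0.
have fin n : (n < N)%N ->
    (\int[lebesgue_measure]_(s in `]t n, t n.+1[) g s)%E \is a fin_num.
  move=> nN; rewrite ge0_fin_numE ?integral_ge0//.
  apply: le_lt_trans (ltry F); apply: le_trans gF.
  by apply: ge0_subset_integral => //; exact: subI.
have l2ge0 (h : X -> 'I_d -> R) : 0 <= l2sum h.
  by apply: sumr_ge0 => i _; apply: Rintegral_ge0 => x _; exact: sqr_ge0.
have sqge0 (h : X -> R) : 0 <= \int[leb]_(x in Omega) h x ^+ 2.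
  by apply: Rintegral_ge0 => x _; exact: sqr_ge0.
(* Hoelder's inequality, L1 in time for the load and the supremum over the slab for the derivative
   of the test function. *)
have load n W : (n < N)%N -> preserves_degree q.+1 W ->
    (forall s, t n <= s <= t n.+1 ->
      \int[leb]_(x in Omega) (W (P n x))^`().[s] ^+ 2 <= K * slab_energy n) ->
    `|ip (@leb_xt R d) (slab Omega t n) (xt f) (xt (fun x s => (W (P n x))^`().[s]))|
    <= fn n * Num.sqrt (K * slab_energy n).
  move=> nN [linW sW] h.
  have lWP' := L2poly_deriv mO (L2poly_linear mO linW sW (lP nN)).
  have [_ [_ S0]] := slab_energy_ge nN.
  apply: slab_hoelder => //.
  - apply: measurable_funS mf.
      by apply: measurableX => //; exact: measurable_itv.
    by move=> [x s] [Ox sI]; split => //; exact: subI nN _ sI.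
  - by apply: measurable_slab_poly lWP'.
  - by rewrite mulr_ge0// ltW.
  - by rewrite /fn fineK// fin.
  move=> s /andP[s1 s2]; rewrite (l2norm_sqr_fin mO); last exact: (L2poly_horner mO s lWP').
  by rewrite lee_fin h// !ltW.
apply: (@energy_bound _ M K F N energy jump_energy (fun n => delta * kinetic n)
  slab_energy fn) => //.
- by rewrite /energy mulr_ge0// addr_ge0// mulr_ge0 ?sqr_ge0.
- by move=> n; rewrite /jump_energy mulr_ge0// addr_ge0// mulr_ge0 ?sqr_ge0.
- by move=> n nN; rewrite mulr_ge0 ?kinetic_ge0// ltW.
- rewrite -lee_fin -sumEFin; apply: le_trans gF; rewrite -tN.
  apply: le_trans (sum_slab_integral (leqnn N)).
  by apply: lee_sum => k _; rewrite /fn fineK// fin.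
(* The test with u itself; from [W] only the inverse inequality for u' in its specification is
   taken. *)
- move=> n nN; have [W hW] := tests (tlt nN).
  have pid : preserves_degree q.+1 (@id {poly R}) by split.
  have := slab_eq nN pid; rewrite slab_form_id// => e.
  have := load n id nN pid (fun s hs => let: And3 _ h _ := slab_sup nN hW hs in h).
  by rewrite -e => /(le_trans (ler_norm _)); lra.
- move=> n nN; have [W hW] := tests (tlt nN).
  have pW := slab_test_degree hW.
  have h1 := slab_form_test nN hW.
  have := load n W nN pW (fun s hs => let: And3 h _ _ := slab_sup nN hW hs in h).
  by rewrite -(slab_eq nN pW) => /(le_trans (ler_norm _)); lra.
Qed.

End stability.

(** * The norms of the theorem *)

Section space_time_norms.
Context {R : realType} {d : nat}.
Variables (Omega : set 'rV[R]_d) (T : R) (N : nat) (t : nat -> R).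
Hypothesis mO : measurable Omega.
Hypothesis part : time_partition T N t.
Local Notation leb := (@lebesgue_row R d).
Local Notation X := 'rV[R]_d.

Let tlt n : (n < N)%N -> t n < t n.+1. Proof. by case: part => _ _ _; exact. Qed.
Let t0 : t 0%N = 0. Proof. by case: part. Qed.
Let tN : t N = T. Proof. by case: part. Qed.
Let N0 : (0 < N)%N. Proof. by case: part. Qed.

(** [Vdisc] leaves u arbitrary at the nodes, so space-time norms are compared outside this null
    set. *)
Let nodes : set (measurableTypeR R) := [set t n | n in `I_N.+1].

Let countable_nodes : countable nodes.
Proof. by apply: finite_set_countable; apply: finite_image; exact: finite_II. Qed.

Let measurable_nodes : measurable nodes.
Proof. by apply: countable_measurable => // s; exact: measurable_set1. Qed.

Let nodes0 : lebesgue_measure nodes = 0%E.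
Proof. exact: countable_lebesgue_measure0. Qed.

Lemma in_some_slab s : 0 < s < T -> ~ nodes s -> exists2 n, (n < N)%N & t n < s < t n.+1.
Proof.
move=> /andP[s0 sT] ns.
suff aux k : (k <= N)%N -> s < t k -> exists2 n, (n < N)%N & t n < s < t n.+1.
  by apply: (aux N) => //; rewrite tN.
elim: k => [|k IH] kN; first by rewrite t0 ltNge (ltW s0).
move=> sk; have [sk'|] := ltP s (t k); first exact: IH (ltnW kN) sk'.
rewrite le_eqVlt => /orP[/eqP tks|ks]; last by exists k => //; rewrite ks.
by exfalso; apply: ns; exists k => //=; exact: ltnW.
Qed.

Lemma LooL2norm_le (v : X -> R -> R) (B : R) : 0 <= B ->
  (forall n s, (n < N)%N -> t n < s < t n.+1 -> (l2norm leb Omega (v^~ s) ^+ 2 <= B%:E)%E) ->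
  (LrL2norm Omega T +oo v ^+ 2 <= B%:E)%E.
Proof.
move=> B0 vB.
have h : (LrL2norm Omega T +oo v <= (Num.sqrt B)%:E)%E.
  rewrite /LrL2norm unlock; case: ifPn => _; last by rewrite lee_fin sqrtr_ge0.
  apply/ess_supP; exists nodes; split => // s /=; apply: contra_notP => ns.
  rewrite /patch; case: ifPn => [/set_mem|_]; last by rewrite abse0 lee_fin sqrtr_ge0.
  rewrite /= in_itv/= => sT; have [n nN st] := in_some_slab sT ns.
  rewrite gee0_abs ?Lnorm_ge0//; apply: le_sqre; first by rewrite lee_fin sqrtr_ge0.
  by rewrite -EFin_expe sqr_sqrtr//; exact: vB st.
have L0 : (0 <= LrL2norm Omega T +oo v)%E by exact: Lnorm_ge0.
rewrite -(sqr_sqrtr B0) EFin_expe !expe2; exact: lee_pmul.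
Qed.

(** Only a bound from above is claimed, since the left integrand may fail to be measurable over the
    nodes; the majorant is a sum of measurable functions, one per slab. *)
Lemma l2norm_QT_le k (v : X -> R -> R) (Q : nat -> X -> {poly R}) :
  time_poly Omega N t v Q -> (forall n, (n < N)%N -> L2poly Omega k (Q n)) ->
  (l2norm (@leb_xt R d) (QT Omega T) (xt v) ^+ 2 <=
   (\sum_(n < N) \int[leb]_(x in Omega) pint (t n) (t n.+1) (Q n x * Q n x))%:E)%E.
Proof.
move=> vQ lQ; rewrite l2norm_sqr.
have mI n : measurable (`]t n, t n.+1[%classic : set (measurableTypeR R)).
  exact: measurable_itv.
have mS n : measurable (slab Omega t n) by exact: measurableX.
pose h n (z : X * measurableTypeR R) := ((Q n z.1 * Q n z.1).[z.2])%:E.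
have h0 n z : (0 <= h n z)%E by rewrite lee_fin hornerM -expr2 sqr_ge0.
have ih n : (n < N)%N -> (@leb_xt R d).-integrable (slab Omega t n) (h n).
  by move=> nN; exact: (slab_integrable mO (tlt nN) (L2poly_mul mO (lQ n nN) (lQ n nN))).
pose g z := (\sum_(n < N) (h n \_ (slab Omega t n)) z)%E.
have hp0 n z : (0 <= (h n \_ (slab Omega t n)) z)%E by rewrite /patch; case: ifPn.
have mh n : (n < N)%N -> measurable_fun setT (h n \_ (slab Omega t n)).
  by move=> nN; apply/(measurable_restrictT _ (mS n)); have /measurable_int := ih n nN.
have mg : measurable_fun setT g.
  by apply: emeasurable_sum => i _; exact: mh.
have mQT : measurable (QT Omega T) by apply: measurableX => //; exact: measurable_itv.
apply: (@le_trans _ _ (\int[@leb_xt R d]_z g z)%E).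
  apply: (@le_trans _ _ (\int[@leb_xt R d]_(z in QT Omega T) g z)%E); last first.
    apply: ge0_subset_integral => //.
    by move=> z _; apply: sume_ge0 => i _; exact: hp0.
  apply: (@ge0_le_integral_off_null _ _ _ _ _ (setT `*` nodes)) => //.
  - exact: measurableX.
  - have null : (leb \x lebesgue_measure)%E ([set: X] `*` nodes) = 0%E.
      rewrite product_measure1E//.
      by have /(congr1 (fun r => leb [set: X] * r)%E) := nodes0; rewrite mule0.
    exact: null.
  - exact: measurable_funTS.
  - by move=> z _; rewrite lee_fin sqr_ge0.
  - by move=> z _; apply: sume_ge0 => i _; exact: hp0.
  move=> [x s] [/= Ox]; rewrite in_itv/= => sT ns.
  have [|n nN st] := in_some_slab sT; first by move=> ns'; apply: ns; split.
  rewrite /g (bigD1 (Ordinal nN))//=; apply: (le_trans _ (leeDl _ _)); last first.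
    by apply: sume_ge0 => i _; exact: hp0.
  rewrite /patch mem_set; last by split => //=; rewrite in_itv.
  by rewrite /h /xt /= (vQ n nN x s Ox st) hornerM -expr2.
rewrite ge0_integral_sum//; last by move=> n; exact: mh.
rewrite -sumEFin; apply: lee_sum => n _.
rewrite -integral_mkcond.
rewrite -(slab_Rintegral mO (tlt (ltn_ord n)) (L2poly_mul mO (lQ n (ltn_ord n)) (lQ n (ltn_ord n)))).
rewrite /Rintegral fineK//; exact: (integrable_fin_num (mS n) (ih n (ltn_ord n))).
Qed.

(** The norm contains the trace at 0, whereas the scheme controls its distance [j 0] to the datum;
    the factors 2 and the term [e0] come from passing between the two. *)
Lemma jumpnorm2_le (E : normedModType R) (nrm : E -> R) (v : X -> R -> E)
    (e e0 : R) (j : nat -> R) : (forall n, 0 <= j n) ->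
  (l2norm leb Omega (nrm \o trace_left v T) ^+ 2 <= e%:E)%E ->
  (forall n, (0 < n < N)%N -> l2norm leb Omega (nrm \o jump v (t n)) ^+ 2 <= (j n)%:E)%E ->
  (l2norm leb Omega (nrm \o trace_right v 0%R) ^+ 2 <= (2 * j 0%N + 2 * e0)%:E)%E ->
  (jumpnorm2 Omega T N t nrm v <= (e + 2 * \sum_(n < N) j n + 2 * e0)%:E)%E.
Proof.
move=> j0 he hj hr.
apply: (@le_trans _ _ (e%:E + (\sum_(1 <= n < N) j n)%:E + (2 * j 0%N + 2 * e0)%:E)%E).
  rewrite /jumpnorm2 leeD// leeD// -sumEFin big_nat [leRHS]big_nat.
  by apply: lee_sum => n; exact: hj.
rewrite -!EFinD lee_fin -(big_mkord xpredT j) [in leRHS]big_ltn//.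
have : 0 <= \sum_(1 <= n < N) j n by apply: sumr_ge0.
lra.
Qed.

End space_time_norms.

Section nodal_norms.
Context {R : realType} {d : nat}.
Variable Omega : set 'rV[R]_d.
Hypothesis mO : measurable Omega.
Local Notation leb := (@lebesgue_row R d).
Local Notation X := 'rV[R]_d.

Lemma l2norm_norm_sqr (v w : X -> R) : L2 leb Omega w -> {in Omega, v =1 w} ->
  (l2norm leb Omega ((fun y : R => `|y|%R) \o v) ^+ 2 =
   (\int[leb]_(x in Omega) w x ^+ 2)%:E)%E.
Proof.
move=> lw vw; rewrite -(l2norm_sqr_fin mO lw) !l2norm_sqr; apply: eq_integral => x xO.
by rewrite /= real_normK ?num_real// vw.
Qed.

Lemma l2norm_eucl_sqr (v : X -> X) (w : X -> 'I_d -> R) :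
  (forall i, L2 leb Omega (w^~ i)) -> {in Omega, forall x, v x = \row_i w x i} ->
  (l2norm leb Omega (eucl \o v) ^+ 2 =
   (\sum_(i < d) \int[leb]_(x in Omega) w x i ^+ 2)%:E)%E.
Proof.
move=> lw vw.
rewrite (_ : l2norm _ _ _ = l2norm leb Omega (fun x => eucl (\row_i w x i))); last first.
  by apply: l2norm_eq => x xO; rewrite /= vw.
rewrite l2norm_eucl//.
  by congr EFin; apply: eq_bigr => i _; apply: eq_Rintegral => x _; rewrite mxE.
by move=> i; apply: (L2_eq mO _ (lw i)) => x _; rewrite mxE.
Qed.

Lemma integral_sqr_le_jump (v w : X -> R) : L2 leb Omega v -> L2 leb Omega w ->
  \int[leb]_(x in Omega) v x ^+ 2 <=
  2 * \int[leb]_(x in Omega) (v x - w x) ^+ 2 + 2 * \int[leb]_(x in Omega) w x ^+ 2.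
Proof.
move=> lv lw; have iv := L2_sqr_integrable (L2B mO lv lw); have iw := L2_sqr_integrable lw.
rewrite -!RintegralZl//.
rewrite -RintegralD//; [|exact: (integrableZl mO 2 iv)|exact: (integrableZl mO 2 iw)].
apply: le_Rintegral => //; first exact: L2_sqr_integrable.
  exact: (integrableD mO (integrableZl mO 2 iv) (integrableZl mO 2 iw)).
by move=> x _; have := sqr_ge0 (v x - w x - w x); nra.
Qed.

End nodal_norms.

Theorem proposition6p8 (R : realType) (q : nat) (hq : (2 <= q)%N) :
  exists2 C : R, 0 < C &
  forall (p d : nat) (kappa : R), (1 <= p)%N -> (1 <= d <= 3)%N ->
  exists2 CCFL : R, 0 < CCFL &
  forall (Omega : set 'rV[R]_d) (m : nat) (V : 'I_m -> 'I_d.+1 -> 'rV[R]_d)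
    (T : R) (N : nat) (t : nat -> R) (c delta : R)
    (f : 'rV[R]_d -> R -> R) (u0 : 'rV[R]_d -> R)
    (Du0 : 'rV[R]_d -> 'rV[R]_d) (v0 : 'rV[R]_d -> R),
  polytopic_domain Omega -> conforming_mesh Omega V -> shape_regular kappa V ->
  0 < T -> time_partition T N t -> 0 < c -> 0 < delta ->
  L2 (@leb_xt R d) (QT Omega T) (xt f) ->
  H01 Omega u0 Du0 ->
  L2 (@lebesgue_row R d) Omega v0 ->
  tau N t <= CCFL * hmin V / c ->
  forall (u : 'rV[R]_d -> R -> R) (Du : 'rV[R]_d -> R -> 'rV[R]_d),
  Vdisc Omega N t p q V u Du ->
  (forall (w : 'rV[R]_d -> R -> R) (Dw : 'rV[R]_d -> R -> 'rV[R]_d),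
    Vdisc Omega N t p q V w Dw ->
    Bform Omega N t c delta u Du w Dw = lform Omega N t c f Du0 v0 w Dw) ->
  (LrL2norm Omega T +oo (dt u) ^+ 2
   + (c ^+ 2)%:E * LrL2norm Omega T +oo (fun x s => eucl (Du x s)) ^+ 2
   + jumpnorm2 Omega T N t (fun y : R => `|y|%R) (dt u)
   + (c ^+ 2)%:E * jumpnorm2 Omega T N t eucl Du
   + delta%:E * l2norm (@leb_xt R d) (QT Omega T) (xt (dt u)) ^+ 2
   <= C%:E * (LrL2norm Omega T 1 f ^+ 2
              + l2norm (@lebesgue_row R d) Omega v0 ^+ 2
              + (c ^+ 2)%:E
                * l2norm (@lebesgue_row R d) Omega (fun x => eucl (Du0 x)) ^+ 2))%E.
Proof.
have [M [K [M0 K0 tests]]] := @slab_test R q (ltnW hq).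
pose C1 := 8 * (M + 1) + 16 * (M + 2) ^+ 2 * K; pose C2 := 1 + K * C1.
have C10 : 0 <= C1.
  rewrite addr_ge0// mulr_ge0 ?addr_ge0//; last by rewrite ltW.
  by rewrite mulr_ge0 ?sqr_ge0.
have KC10 : 0 <= K * C1 by rewrite mulr_ge0// ltW.
have C20 : 0 <= C2 by rewrite addr_ge0.
(* [2 * (K * C1)] pays for the two suprema in time, [5 * C2] for the trace at T, the jumps and the
   damping, and 4 for the initial data brought in by the traces at 0. *)
pose C := 2 * (K * C1) + 5 * C2 + 4.
have C0 : 0 < C by rewrite /C /C2; lra.
exists C => // p d kappa _ _; exists 1 => // Omega m V T N t c delta f u0 Du0 v0.
move=> [_ _ [m' [V' [_ OmegaE]]]] _ _ T0 part c0 delta0 [mf _] [[lu0 lDu0 _] _] lv0 _ u Du uV eqB.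
have oO : open Omega by rewrite OmegaE; exact: open_interior.
have mO : measurable Omega by exact: open_measurable_row.
have [P [G [uP DuG lP lG slab_eq]]] := slab_equation oO part lv0 lDu0 uV eqB.
have [N0 t0 tN tlt] := part.
have c20 : 0 < c ^+ 2 by rewrite exprn_gt0.
have duP := time_poly_dt uP.
pose leb := @lebesgue_row R d.
pose z n x := (P n x)^`().
have lz n : (n < N)%N -> L2poly Omega q.+1 (z n).
  by move=> nN; exact: (L2poly_deriv mO (lP n nN)).
rewrite (l2norm_sqr_fin mO lv0) (l2norm_eucl mO lDu0).
have LE : LrL2norm Omega T 1 f =
    (\int[lebesgue_measure]_(s in `]0%R, T[) l2norm leb Omega (f^~ s))%E.
  rewrite /LrL2norm Lnorm1 [RHS]integral_mkcond; apply: eq_integral => s _.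
  rewrite /patch; case: ifPn => _; last by rewrite abse0.
  by rewrite gee0_abs// Lnorm_ge0.
have L0 : (0 <= LrL2norm Omega T 1 f)%E by exact: Lnorm_ge0.
pose v2 := \int[leb]_(x in Omega) v0 x ^+ 2.
pose g2 := \sum_(i < d) \int[leb]_(x in Omega) Du0 x ord0 i ^+ 2.
have v20 : 0 <= v2 by apply: Rintegral_ge0 => x _; exact: sqr_ge0.
have g20 : 0 <= g2.
  by apply: sumr_ge0 => i _; apply: Rintegral_ge0 => x _; exact: sqr_ge0.
rewrite -/v2 -/g2 -EFinM.
(* With an infinite load norm the right-hand side is infinite; the case distinction replaces a proof
   of finiteness from f in L2. *)
case LF : (LrL2norm Omega T 1 f) L0 => [F| |]// F0; last first.
  have -> : (+oo ^+ 2 = +oo :> \bar R)%E by rewrite expe2 mulyy.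
  by rewrite !addye// gt0_muley ?lte_fin// leey.
have gF : (\int[lebesgue_measure]_(s in `]0%R, T[) l2norm leb Omega (f^~ s) <= F%:E)%E.
  by rewrite -LE LF.
have [SB EB] := stability_bound mO part delta0 lv0 lDu0 mf lP lG slab_eq M0 K0 tests gF.
rewrite -/C1 -/C2 in SB EB.
set E0 := energy Omega t c Du0 v0 P G 0%N in SB EB.
have E0E : E0 = 2^-1 * (v2 + c ^+ 2 * g2) by [].
pose B := E0 + F ^+ 2; rewrite -/B in SB EB.
have B0 : 0 <= B by rewrite addr_ge0 ?sqr_ge0// E0E mulr_ge0// addr_ge0// mulr_ge0// ltW.
have sup n s : (n < N)%N -> t n < s < t n.+1 ->
    \int[leb]_(x in Omega) (z n x).[s] ^+ 2 <= K * C1 * B /\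
    c ^+ 2 * (\sum_(i < d) \int[leb]_(x in Omega) (G n x i).[s] ^+ 2) <= K * C1 * B.
  move=> nN /andP[s1 s2]; have [W hW] := tests _ _ (tlt n nN).
  have sn : t n <= s <= t n.+1 by rewrite !ltW.
  have [_ h1 h2] := slab_sup mO part c lP lG K0 nN hW sn.
  have h3 : K * slab_energy Omega t c P G n <= K * C1 * B.
    by rewrite -mulrA ler_pM2l// SB.
  by split; [exact: le_trans h1 h3|exact: le_trans h2 h3].
have T1 : (LrL2norm Omega T +oo (dt u) ^+ 2 <= (K * C1 * B)%:E)%E.
  apply: (LooL2norm_le part); first by rewrite mulr_ge0.
  move=> n s nN st.
  rewrite (l2norm_eq leb (g := fun x => (z n x).[s])); last first.
    by move=> x /set_mem Ox; exact: duP.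
  rewrite (l2norm_sqr_fin mO); last exact: (L2poly_horner mO s (lz n nN)).
  by rewrite lee_fin; have [] := sup n s nN st.
have T2 : ((c ^+ 2)%:E * LrL2norm Omega T +oo (fun x s => eucl (Du x s)) ^+ 2
    <= (K * C1 * B)%:E)%E.
  have -> : (K * C1 * B)%:E = ((c ^+ 2)%:E * ((c ^+ 2)^-1 * (K * C1 * B))%:E)%E.
    by rewrite -EFinM mulVKf// gt_eqF.
  apply: lee_wpmul2l; first by rewrite lee_fin ltW.
  apply: (LooL2norm_le part); first by rewrite mulr_ge0 ?invr_ge0 ?(ltW c20)// mulr_ge0.
  move=> n s nN st.
  rewrite (l2norm_eucl_sqr mO (v := Du^~ s) (w := fun x i => (G n x i).[s])); last 2 first.
  - by move=> i; exact: (L2poly_horner mO s (lG n i nN)).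
  - by move=> x /set_mem Ox; exact: DuG.
  by rewrite lee_fin mulrC ler_pdivlMr// mulrC; have [] := sup n s nN st.
pose zm := left_value t z v0; pose Um := left_valuev t G Du0.
pose J n := \int[leb]_(x in Omega) ((z n x).[t n] - zm n x) ^+ 2.
pose Jv n := \sum_(i < d) \int[leb]_(x in Omega) ((G n x i).[t n] - Um n x i) ^+ 2.
pose e := \int[leb]_(x in Omega) zm N x ^+ 2.
pose ev := \sum_(i < d) \int[leb]_(x in Omega) Um N x i ^+ 2.
have J0 n : 0 <= J n by apply: Rintegral_ge0 => x _; exact: sqr_ge0.
have Jv0 n : 0 <= Jv n.
  by apply: sumr_ge0 => i _; apply: Rintegral_ge0 => x _; exact: sqr_ge0.
have lzm n : (n < N)%N -> L2 leb Omega (zm n).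
  by move=> nN; exact: (L2_left_value t mO lv0 lz nN).
have lUm n i : (n < N)%N -> L2 leb Omega (fun x => Um n x i).
  by move=> nN; exact: (L2_left_valuev t mO lDu0 (fun n nN => lG n i nN) nN).
(* Below, N is rewritten as a successor so that the left values at N unfold to the polynomial of the
   last slab. *)
have Npred : (N.-1 < N)%N by rewrite prednK.
have T3 : (jumpnorm2 Omega T N t (fun y : R => `|y|%R) (dt u)
    <= (e + 2 * \sum_(n < N) J n + 2 * v2)%:E)%E.
  apply: jumpnorm2_le => //.
  - rewrite (@l2norm_norm_sqr _ _ _ mO _ (zm N))//.
      by rewrite /zm -(prednK N0); exact: (L2poly_horner mO _ (lz _ Npred)).
    move=> x /set_mem Ox; rewrite -tN /zm -(prednK N0).
    by rewrite (trace_left_poly tlt duP).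
  - move=> n /andP[n0 nN].
    rewrite (@l2norm_norm_sqr _ _ _ mO _ (fun x => (z n x).[t n] - zm n x))//.
      exact: (L2B mO (L2poly_horner mO _ (lz n nN)) (lzm n nN)).
    move=> x /set_mem Ox; case: n n0 nN => // n _ nN.
    by rewrite /jump (trace_right_poly tlt duP)// (trace_left_poly tlt duP)// ltnW.
  - rewrite (@l2norm_norm_sqr _ _ _ mO _ (fun x => (z 0%N x).[t 0%N])).
    + rewrite lee_fin; apply: (integral_sqr_le_jump mO) => //.
      exact: (L2poly_horner mO _ (lz _ N0)).
    + exact: (L2poly_horner mO _ (lz _ N0)).
    + by move=> x /set_mem Ox; rewrite -t0 (trace_right_poly tlt duP).
have T4 : (jumpnorm2 Omega T N t eucl Du <= (ev + 2 * \sum_(n < N) Jv n + 2 * g2)%:E)%E.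
  apply: jumpnorm2_le => //.
  - rewrite (@l2norm_eucl_sqr _ _ _ mO _ (Um N))//.
      by move=> i; rewrite /Um -(prednK N0); exact: (L2poly_horner mO _ (lG _ i Npred)).
    move=> x /set_mem Ox; rewrite -tN /Um -(prednK N0).
    by rewrite (trace_left_polyv tlt DuG).
  - move=> n /andP[n0 nN].
    rewrite (@l2norm_eucl_sqr _ _ _ mO _ (fun x i => (G n x i).[t n] - Um n x i))//.
      by move=> i; exact: (L2B mO (L2poly_horner mO _ (lG n i nN)) (lUm n i nN)).
    move=> x /set_mem Ox; case: n n0 nN => // n _ nN.
    rewrite /jump (trace_right_polyv tlt DuG)// (trace_left_polyv tlt DuG) ?(ltnW nN)//.
    by apply/rowP => i; rewrite !mxE.
  - rewrite (@l2norm_eucl_sqr _ _ _ mO _ (fun x i => (G 0%N x i).[t 0%N])).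
    + rewrite lee_fin /Jv /g2 !mulr_sumr -big_split/=; apply: ler_sum => i _.
      apply: (integral_sqr_le_jump mO); last exact: lDu0.
      exact: (L2poly_horner mO _ (lG _ i N0)).
    + by move=> i; exact: (L2poly_horner mO _ (lG _ i N0)).
    + by move=> x /set_mem Ox; rewrite -[X in trace_right _ X]t0 (trace_right_polyv tlt DuG).
have T5 : (l2norm (@leb_xt R d) (QT Omega T) (xt (dt u)) ^+ 2
    <= (\sum_(n < N) kinetic Omega t P n)%:E)%E.
  exact: (l2norm_QT_le mO part duP lz).
have c2E : (0 <= (c ^+ 2)%:E)%E by rewrite lee_fin ltW.
have dE : (0 <= delta%:E)%E by rewrite lee_fin ltW.
apply: (le_trans (leeD (leeD (leeD (leeD T1 T2) T3) (lee_wpmul2l c2E T4)) (lee_wpmul2l dE T5))).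
rewrite -EFin_expe -!EFinM -!EFinD lee_fin.
have kin0 : 0 <= \sum_(n < N) delta * kinetic Omega t P n.
  apply: sumr_ge0 => n _; rewrite mulr_ge0 ?(ltW delta0)//.
  exact: (kinetic_ge0 Omega part P (ltn_ord n)).
have ENE : energy Omega t c Du0 v0 P G N = 2^-1 * (e + c ^+ 2 * ev) by [].
have EDE : \sum_(n < N) (jump_energy Omega t c Du0 v0 P G n + delta * kinetic Omega t P n) =
    2^-1 * (\sum_(n < N) J n + c ^+ 2 * \sum_(n < N) Jv n) + \sum_(n < N) delta * kinetic Omega t P n.
  by rewrite big_split/= -mulr_sumr big_split/= -mulr_sumr.
rewrite ENE EDE -mulr_sumr in EB; rewrite -mulr_sumr in kin0.
have sJ0 : 0 <= \sum_(n < N) J n by apply: sumr_ge0.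
have sJv0 : 0 <= c ^+ 2 * \sum_(n < N) Jv n by rewrite mulr_ge0 ?(ltW c20)//; apply: sumr_ge0.
have e0 : 0 <= e by apply: Rintegral_ge0 => x _; exact: sqr_ge0.
have ev0 : 0 <= c ^+ 2 * ev.
  rewrite mulr_ge0 ?(ltW c20)//; apply: sumr_ge0 => i _; apply: Rintegral_ge0 => x _.
  exact: sqr_ge0.
have cg0 : 0 <= c ^+ 2 * g2 by rewrite mulr_ge0// ltW.
have CB : C * B <= C * (F ^+ 2 + v2 + c ^+ 2 * g2).
  by rewrite ler_pM2l// /B E0E; lra.
apply: le_trans CB; rewrite /C.
have C2B : 0 <= C2 * B by rewrite mulr_ge0.
have F20 := sqr_ge0 F.
have EB4 : 2 * (v2 + c ^+ 2 * g2) <= 4 * B by rewrite /B E0E; lra.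
move: EB4 EB C2B kin0 sJv0 ev0; clear -e0 sJ0.
move: B C2 e ev (\sum_(n < N) J n) (\sum_(n < N) Jv n) (\sum_(n < N) kinetic Omega t P n) e0 sJ0.
by move=> *; lra.
Qed.
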